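(* Let $p \in (0,1)$ and $s \in [0,1]$, and let $\{S_n\}$ and $\{S'_n\}$ be two independent elephant random walks with the same memory parameter $p$ and first-step parameter $s$. (i) If $0<p<3/4$, then almost surely $\limsup_{n\to\infty} \frac{S_n - S'_n}{\sqrt{n\log\log n}} = \frac{2}{\sqrt{3-4p}}$ and $\limsup_{n\to\infty} \frac{-(S_n - S'_n)}{\sqrt{n\log\log n}} = \frac{2}{\sqrt{3-4p}}$. (ii) If $p = 3/4$, then almost surely $\limsup_{n\to\infty} \frac{S_n - S'_n}{\sqrt{n\log n\log\log\log n}} = 2$ and $\limsup_{n\to\infty} \frac{-(S_n - S'_n)}{\sqrt{n\log n\log\log\log n}} = 2$. (iii) If $3/4 < p < 1$, then there is a random variable $M$ with $P(M \neq 0) = 1$ such that $\lim_{n\to\infty} \frac{S_n - S'_n}{n^{2p-1}} = M$ almost surely.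
   Context: An elephant random walk with memory parameter $p \in (0,1)$ and first-step parameter $s \in [0,1]$ is defined as follows. Let $X_1 = +1$ with probability $s$ and $X_1 = -1$ with probability $1-s$. Let $\{U_n : n \ge 1\}$ be an independent family of random variables with $U_n$ uniformly distributed on $\{1,\dots,n\}$, also independent of $X_1$. For each $n \ge 1$, set $X_{n+1} = X_{U_n}$ with probability $p$ and $X_{n+1} = -X_{U_n}$ with probability $1-p$, where this choice is made independently of everything else. Set $S_0 = 0$ and $S_n = \sum_{i=1}^n X_i$ for $n \ge 1$. *)

(* Defs.v *)
From HB Require Import structures.
From mathcomp Require Import all_boot all_order all_algebra.
From mathcomp Require Import all_classical all_reals all_analysis.
Set Implicit Arguments. Unset Strict Implicit. Unset Printing Implicit Defensive.
Import Order.TTheory GRing.Theory Num.Theory.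
Import numFieldNormedType.Exports.
Local Open Scope classical_set_scope.
Local Open Scope ring_scope.

Definition discrete_mutual_indep (R : realType) (d : measure_display)
    (T : measurableType d) (P : probability T R) (I : eqType)
    (Y : I -> T -> nat) : Prop :=
  (forall i v, measurable (Y i @^-1` [set v])) /\
  forall (l : seq I) (v : I -> nat), uniq l ->
    P (\bigcap_(i in [set` l]) (Y i @^-1` [set v i])) =
    (\prod_(i <- l) P (Y i @^-1` [set v i]))%E.

(* Index of the driving variables of two elephant random walks.
   (w, None)          : encodes X_1 of walk w   (value 1 means X_1 = +1, otherwise X_1 = -1)
   (w, Some (m,true)) : U_{m+1} of walk w (uniform on {1,...,m+1})
   (w, Some (m,false)): the coin used at step m+2 of walk w
                        (value 1 means X_{m+2} = X_{U_{m+1}}, otherwise -X_{U_{m+1}}). *)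
Definition erw_index := (bool * option (nat * bool))%type.

Definition erw_pair_family (R : realType) (d : measure_display)
    (T : measurableType d) (P : probability T R) (p s : R)
    (Y : erw_index -> T -> nat) : Prop :=
  discrete_mutual_indep P Y /\
  (forall w, P (Y (w, None) @^-1` [set 1%N]) = s%:E /\
             P (Y (w, None) @^-1` [set 0%N]) = (1 - s)%:E) /\
  (forall w m k, (1 <= k <= m.+1)%N ->
             P (Y (w, Some (m, true)) @^-1` [set k]) = (m.+1%:R^-1)%:E) /\
  (forall w m, P (Y (w, Some (m, false)) @^-1` [set 1%N]) = p%:E /\
               P (Y (w, Some (m, false)) @^-1` [set 0%N]) = (1 - p)%:E).

Definition sgn01 (R : realType) (x : nat) : R := if x == 1%N then 1 else -1.

(* erw_steps x1 u c n = [:: X_1; ...; X_n], where x1 encodes X_1,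
   u m = U_{m+1} and c m is the coin for step m+2. *)
Fixpoint erw_steps (R : realType) (x1 : nat) (u c : nat -> nat) (n : nat)
    : seq R :=
  match n with
  | 0 => [::]
  | n'.+1 =>
    match n' with
    | 0 => [:: sgn01 R x1]
    | m.+1 =>
      let l := erw_steps R x1 u c n' in
      rcons l (sgn01 R (c m) * nth 0 l (u m).-1)
    end
  end.

Definition erw_S (R : realType) (d : measure_display) (T : measurableType d)
    (Y : erw_index -> T -> nat) (w : bool) (n : nat) (t : T) : R :=
  \sum_(x <- erw_steps R (Y (w, None) t) (fun m => Y (w, Some (m, true)) t)
                        (fun m => Y (w, Some (m, false)) t) n) x.
Arguments erw_S {R d T} Y w n t.

(* Main.v *)
Require Import Defs.
From HB Require Import structures.
From mathcomp Require Import all_boot all_order all_algebra.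
From mathcomp Require Import all_classical all_reals all_analysis.
From mathcomp Require Import measurable_realfun.
From mathcomp Require Import zify ring lra.
Import Order.TTheory GRing.Theory Num.Theory.
Import numFieldNormedType.Exports.
Local Open Scope classical_set_scope.
Local Open Scope ring_scope.
Set Implicit Arguments.
Unset Strict Implicit.
Unset Printing Implicit Defensive.

(** The pair of walks is a Markov chain on histories.  With q = 2p - 1 and a_n the product of the
    1 + q/k for k < n, (S_n - S'_n) / a_n is a martingale whose increments are w_j xi_j, where
    w_j = 1/a_(j+1) and xi_j is bounded with conditional variance 2 up to the drifts
    (q S_j / j)^2, (q S'_j / j)^2.  Conditional exponential moments of the xi_j are therefore pinched
    between exp((1 ± e) l^2), and an exponential maximal inequality together with a matching lower tail
    bound gives an iterated logarithm law at the clock B_n, the sum of the w_j^2.  The upper half,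
    applied to S and S' separately, shows S_n / n -> 0, so the drifts are eventually negligible;
    truncating the increments where they are not makes the lower half available.  If p <= 3/4 then
    B_n -> oo and its asymptotics give the stated normalisations.  If p > 3/4 then B_n is bounded,
    the martingale converges, and anticoncentration of its increments after time n, whose variance
    dominates every single increment, forbids the limit 0. *)

(** The constant 2 in the laws is sqrt(2 * 2), the conditional variance of an increment being close
    to 2. The lower half needs exponential moments bounded below with a constant near 1 after every
    history, but the drifts become small only almost surely and only after a random time. Hence the
    rescaled increments, whose variance is near 2 everywhere and whose sum differs from the true
    martingale by an eventually constant random amount. Block probabilities are then bounded below
    uniformly in the past, by 1/(i+1) for block i, and the vanishing product of the 1 - 1/(i+1)
    takes the place of the second Borel-Cantelli lemma. The asymptotics of a_n avoid the Gamma
    function: n w^2 satisfies a recursion that ties it to the clock with coefficient 1 - 2q = 3 -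
    4p, which is where the threshold 3/4 comes from. Probability enters only through events of
    finite histories, whose laws are finite sums, so neither filtrations nor conditional
    expectations are built. *)

(** * Exponential moments of bounded centred variables *)

Lemma expR_taylor2 (R : realType) (x : R) : `|x| <= 2^-1 ->
  `|expR x - (1 + x + x ^+ 2 / 2)| <= 2 * `|x| ^+ 3.
Proof.
move=> x2.
(* This bounds the derivative of the remainder; the mean value theorem then gives the cubic bound.
   From exp(-c) >= 1 - c one gets (1 - c) exp(c) <= 1, so exp(c) - 1 - c <= c^2 / (1 - c) <= 2
   c^2. *)
have E (c : R) : `|c| <= 2^-1 -> 0 <= expR c - (1 + c) <= 2 * c ^+ 2.
  move=> c2; apply/andP; split; first by rewrite subr_ge0 expR_ge1Dx.
  have := expR_ge1Dx (- c); rewrite expRN.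
  have := expR_gt0 c; move: (expR c) => e e0 h.
  have : (1 - c) * e <= 1.
    by have := ler_wpM2r (ltW e0) h; rewrite mulVf ?gt_eqF.
  by move: c2; rewrite ler_norml => /andP[c2 c2'] h1; nra.
pose f (y : R) := expR y - (1 + y + y ^+ 2 / 2).
have df (y : R) : is_derive y 1 f (expR y - (1 + y)).
  rewrite /f; apply: is_derive_eq.
  by rewrite /GRing.scale /= ; field.
have cf : continuous f.
  by move=> y; apply/differentiable_continuous/derivable1_diffP/(@ex_derive _ _ _ _ _ _ _ (df y)).
have f0 : f 0 = 0 by rewrite /f expR0; field.
have K (c y : R) : `|c| <= `|y| -> `|y| <= 2^-1 -> `|(expR c - (1 + c)) * y| <= 2 * `|y| ^+ 3.
  move=> cy y2; rewrite normrM exprSr mulrA ler_wpM2r //.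
  have /andP[p1 p2] := E c (le_trans cy y2).
  rewrite ger0_norm // (le_trans p2) // ler_wpM2l // -(real_normK (num_real c)).
  by rewrite lerXn2r // nnegrE.
rewrite -/(f x).
have [x0|x0|->] := ltgtP x 0.
- have [c /itvP cI] := MVT x0 (fun y _ => df y) (continuous_subspaceT cf).
  rewrite f0 => fE; have -> : f x = (expR c - (1 + c)) * x by lra.
  by apply: K => //; rewrite !ler0_norm ?lerN2 ?cI // ltW.
- have [c /itvP cI] := MVT x0 (fun y _ => df y) (continuous_subspaceT cf).
  rewrite f0 !subr0 => ->.
  by apply: K => //; rewrite !ger0_norm ?cI // ltW.
- by rewrite f0 normr0 expr0n /= mulr0.
Qed.

Section MeanZeroLaplace.
Variables (R : realType) (Z : finType) (p xi : Z -> R) (K : R).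
Hypotheses (p0 : forall z, 0 <= p z) (p1 : \sum_z p z = 1).
Hypotheses (mean0 : \sum_z p z * xi z = 0) (xiK : forall z, `|xi z| <= K) (K1 : 1 <= K).

(** The cubic remainder is bounded by K |l| times l^2 xi^2, so the error is proportional to the
    variance itself. It can therefore be absorbed as a relative error 1 + d or 1 - d, however small
    the variance is. *)
Lemma laplace_expansion (l : R) : `|l| * K <= 2^-1 ->
  `|\sum_z p z * expR (l * xi z) - (1 + l ^+ 2 / 2 * \sum_z p z * xi z ^+ 2)|
    <= 2 * K * `|l| * l ^+ 2 * \sum_z p z * xi z ^+ 2.
Proof.
move=> lK.
have -> : \sum_z p z * expR (l * xi z) - (1 + l ^+ 2 / 2 * \sum_z p z * xi z ^+ 2)
  = \sum_z p z * (expR (l * xi z) - (1 + l * xi z + (l * xi z) ^+ 2 / 2)).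
  transitivity (\sum_z p z * expR (l * xi z) - (\sum_z p z + l * (\sum_z p z * xi z)
      + l ^+ 2 / 2 * \sum_z p z * xi z ^+ 2)); first by rewrite p1 mean0 mulr0 addr0.
  rewrite !mulr_sumr -!big_split /= -sumrB; by apply: eq_bigr => z _; field.
apply: le_trans (ler_norm_sum _ _ _) _; rewrite mulr_sumr ler_sum // => z _.
rewrite normrM ger0_norm // -[leRHS]mulrCA ler_wpM2l //.
have h : `|l * xi z| <= `|l| * K by rewrite normrM ler_wpM2l.
rewrite (le_trans (expR_taylor2 (le_trans h lK))) //.
have -> : 2 * `|l * xi z| ^+ 3 = `|xi z| * (2 * `|l| * (l ^+ 2 * xi z ^+ 2)).
  by rewrite normrM -[in RHS](real_normK (num_real l)) -(real_normK (num_real (xi z))); ring.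
have -> : 2 * K * `|l| * l ^+ 2 * xi z ^+ 2 = K * (2 * `|l| * (l ^+ 2 * xi z ^+ 2)) by ring.
apply: ler_wpM2r (xiK z); apply: mulr_ge0; first by rewrite mulr_ge0.
by apply: mulr_ge0; exact: sqr_ge0.
Qed.

Lemma laplace_le (l c d : R) : \sum_z p z * xi z ^+ 2 <= 2 * c -> 0 <= d -> d <= 1 ->
  `|l| <= d / (4 * K) ->
  \sum_z p z * expR (l * xi z) <= expR (c * (1 + d) * l ^+ 2).
Proof.
move=> vc d0 d1 lK.
have K0 : 0 < K by apply: lt_le_trans K1.
have lK4 : `|l| * K <= d / 4.
  by rewrite -ler_pdivlMr // (le_trans lK) // invfM mulrA.
have v0 : 0 <= \sum_z p z * xi z ^+ 2.
  by apply: sumr_ge0 => z _; rewrite mulr_ge0 // sqr_ge0.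
have := @laplace_expansion l ltac:(lra).
rewrite ler_norml => /andP[_ h]; apply: le_trans (expR_ge1Dx _).
have l20 : 0 <= l ^+ 2 by rewrite sqr_ge0.
move: v0 vc h lK4; set v := \sum_z p z * xi z ^+ 2 => v0 vc h lK4.
have : 2 * K * `|l| * l ^+ 2 * v <= d / 2 * l ^+ 2 * v.
  by have := ler_wpM2r (mulr_ge0 l20 v0) lK4; lra.
have : l ^+ 2 * v <= l ^+ 2 * (2 * c) by rewrite ler_wpM2l.
nra.
Qed.

Lemma laplace_ge (l c d : R) : 0 <= c -> c <= 1 -> 2 * c <= \sum_z p z * xi z ^+ 2 ->
  0 <= d -> d <= 1 -> `|l| <= d / (8 * K) ->
  expR (c * (1 - d) * l ^+ 2) <= \sum_z p z * expR (l * xi z).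
Proof.
move=> c0 c1 vc d0 d1 lK.
have K0 : 0 < K by apply: lt_le_trans K1.
have lK8 : `|l| * K <= d / 8.
  by rewrite -ler_pdivlMr // (le_trans lK) // invfM mulrA.
have := @laplace_expansion l ltac:(lra).
rewrite ler_norml => /andP[h _].
have l20 : 0 <= l ^+ 2 by rewrite sqr_ge0.
have l2 : l ^+ 2 <= d / 8.
  have : `|l| <= `|l| * K by rewrite ler_peMr.
  rewrite -(real_normK (num_real l)); have := normr_ge0 l; nra.
move: vc h; set v := \sum_z p z * xi z ^+ 2 => vc h.
have h1 : 2 * K * `|l| * l ^+ 2 * v <= d / 4 * l ^+ 2 * v.
  have v0 : 0 <= v by apply: le_trans vc; rewrite mulr_ge0.
  by have := ler_wpM2r (mulr_ge0 l20 v0) lK8; lra.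
pose y := c * l ^+ 2 * (1 - d / 2).
have y0 : 0 <= y by apply: mulr_ge0; [exact: mulr_ge0|lra].
have yS : 1 + y <= \sum_z p z * expR (l * xi z).
  have : l ^+ 2 * (2 * c) * (1 / 2 - d / 4) <= l ^+ 2 * v * (1 / 2 - d / 4).
    by rewrite ler_wpM2r ?ler_wpM2l //; lra.
  rewrite /y; lra.
apply: le_trans yS.
(* Turning 1 + y back into an exponential costs the factor 1 / (1 + y) in the exponent; since y <= d
   / 8, the half of d not yet spent on the cubic error pays for it. *)
have e1 : expR (y / (1 + y)) <= 1 + y.
  have := expR_ge1Dx (- (y / (1 + y))).
  have -> : 1 + - (y / (1 + y)) = (1 + y)^-1 by field; lra.
  by rewrite expRN lef_pV2 // posrE ?expR_gt0 //; lra.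
apply: le_trans e1; rewrite ler_expR ler_pdivlMr; last by lra.
have yl : y <= d / 8 by have := ler_wpM2r l20 c1; have := mulr_ge0 c0 l20; rewrite /y; nra.
have -> : c * (1 - d) * l ^+ 2 * (1 + y) = c * l ^+ 2 * ((1 - d) * (1 + y)) by ring.
by apply: (ler_wpM2l (mulr_ge0 c0 l20)); nra.
Qed.

End MeanZeroLaplace.

(** * Exponential inequalities for a chain on histories *)

Section Chain.
Variables (R : realType) (Z : finType) (k : seq Z -> Z -> R).

(* Histories are listed most recent step first; [cexp n G h] is the expectation of [G] after [n]
   more steps of the chain with transition probabilities [k], started from the history [h]. *)
Fixpoint cexp (n : nat) (G : seq Z -> R) (h : seq Z) : R :=
  if n is m.+1 then \sum_z k h z * cexp m G (z :: h) else G h.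

Definition stochastic := (forall h z, 0 <= k h z) /\ (forall h, \sum_z k h z = 1).

(** The empty history is excluded because the first step has its own law and is not centred; the
    value of [M] after one step is bounded separately. *)
Definition increments (w : nat -> R) (xi : seq Z -> Z -> R) (M : seq Z -> R) :=
  forall z h, (0 < size h)%N -> M (z :: h) = M h + w (size h) * xi h z.

(** The constant [c] stands for a conditional variance 2c, so [c] near 1 is the case of the
    difference of the two walks. *)
Definition laplace_ub (xi : seq Z -> Z -> R) (c mu : R) := forall h l,
  (0 < size h)%N -> `|l| <= mu -> \sum_z k h z * expR (l * xi h z) <= expR (c * l ^+ 2).

Definition laplace_lb (xi : seq Z -> Z -> R) (c mu : R) := forall h l,
  (0 < size h)%N -> `|l| <= mu -> expR (c * l ^+ 2) <= \sum_z k h z * expR (l * xi h z).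

Definition clock (w : nat -> R) (n : nat) : R := \sum_(0 <= j < n) w j ^+ 2.

Lemma clockS w n : clock w n.+1 = clock w n + w n ^+ 2.
Proof. by rewrite /clock big_nat_recr. Qed.

Lemma clock_le w m n : (m <= n)%N -> clock w m <= clock w n.
Proof.
move=> /subnKC <-; elim: (n - m)%N => [|i IH]; first by rewrite addn0.
by rewrite addnS clockS (le_trans IH) // lerDl sqr_ge0.
Qed.

Lemma incrementsN w xi M : increments w xi M ->
  increments w (fun h z => - xi h z) (fun h => - M h).
Proof. by move=> MS z h h0; rewrite MS // opprD mulrN. Qed.

Lemma laplace_ubN xi c mu : laplace_ub xi c mu -> laplace_ub (fun h z => - xi h z) c mu.
Proof.
move=> H h l h0 lmu; under eq_bigr do rewrite mulrN -mulNr.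
by rewrite -[X in expR (_ * X)]sqrrN; apply: H; rewrite ?normrN.
Qed.

Lemma laplace_lbN xi c mu : laplace_lb xi c mu -> laplace_lb (fun h z => - xi h z) c mu.
Proof.
move=> H h l h0 lmu; under eq_bigr do rewrite mulrN -mulNr.
by rewrite -[X in expR (_ * X)]sqrrN; apply: H; rewrite ?normrN.
Qed.

Hypothesis kS : stochastic.

Lemma cexp_le n F G h : (forall l, size l = n -> F (l ++ h) <= G (l ++ h)) ->
  cexp n F h <= cexp n G h.
Proof.
elim: n h => [|n IH] h FG /=; first exact: (FG [::]).
apply: ler_sum => z _; apply: ler_wpM2l; first exact: kS.1.
apply: IH => l ln; rewrite -cat_rcons; apply: FG; by rewrite size_rcons ln.
Qed.

Lemma eq_cexp n F G h : (forall l, size l = n -> F (l ++ h) = G (l ++ h)) ->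
  cexp n F h = cexp n G h.
Proof. by move=> FG; apply/le_anti/andP; split; apply: cexp_le => l /FG ->. Qed.

Lemma cexp_cst n c h : cexp n (fun=> c) h = c.
Proof.
elim: n h => [//|n IH] h /=.
by under eq_bigr do rewrite IH; rewrite -mulr_suml kS.2 mul1r.
Qed.

Lemma cexpD n F G h : cexp n (fun x => F x + G x) h = cexp n F h + cexp n G h.
Proof.
elim: n h => [//|n IH] h /=; rewrite -big_split /=.
by apply: eq_bigr => z _; rewrite IH mulrDr.
Qed.

Lemma cexpZ n c F h : cexp n (fun x => c * F x) h = c * cexp n F h.
Proof.
elim: n h => [//|n IH] h /=; rewrite mulr_sumr.
by apply: eq_bigr => z _; rewrite IH mulrCA.
Qed.

Lemma cexp_ge0 n F h : (forall x, 0 <= F x) -> 0 <= cexp n F h.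
Proof. by move=> F0; rewrite -[leLHS](cexp_cst n 0 h); apply: cexp_le. Qed.

Lemma cexp_add m n G h : cexp (m + n) G h = cexp m (cexp n G) h.
Proof. by elim: m h => [//|m IH] h /=; apply: eq_bigr => z _; rewrite IH. Qed.

Lemma cexp_pred_le1 n (A : pred (seq Z)) h : cexp n (fun x => (A x)%:R) h <= 1.
Proof. by rewrite -[leRHS](cexp_cst n 1 h); apply: cexp_le => l _; case: (A _). Qed.

Section Increments.
Variables (w : nat -> R) (xi : seq Z -> Z -> R) (M : seq Z -> R) (mu : R).
Hypotheses (w0 : forall j, 0 <= w j) (MS : increments w xi M).
Local Notation B := (clock w).

Lemma cexp_expR_le (c : R) r (l : R) h : laplace_ub xi c mu -> (0 < size h)%N ->
  (forall j, (size h <= j < size h + r)%N -> `|l| * w j <= mu) ->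
  cexp r (fun x => expR (l * (M x - M h))) h
    <= expR (c * l ^+ 2 * (B (size h + r) - B (size h))).
Proof.
move=> ub; elim: r h => [|r IH] h h0 lw /=.
  by rewrite addn0 !subrr !mulr0.
have -> : c * l ^+ 2 * (B (size h + r.+1) - B (size h)) =
    c * (l * w (size h)) ^+ 2 + c * l ^+ 2 * (B ((size h).+1 + r) - B (size h).+1).
  by rewrite addSnnS clockS; ring.
have lw1 : `|l * w (size h)| <= mu by rewrite normrM (ger0_norm (w0 _)) lw //; lia.
rewrite expRD; apply: le_trans (ler_wpM2r (expR_ge0 _) (ub h _ h0 lw1)).
rewrite mulr_suml; apply: ler_sum => z _; rewrite -[leRHS]mulrA ler_wpM2l ?kS.1 //.
have -> : l * w (size h) * xi h z = l * (M (z :: h) - M h) by rewrite MS //; ring.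
rewrite (eq_cexp (G := fun x => expR (l * (M (z :: h) - M h)) * expR (l * (M x - M (z :: h))))).
  rewrite cexpZ.
  apply: ler_wpM2l; first exact: expR_ge0.
  apply: (IH (z :: h)) => // j /= jr; apply: lw; lia.
by move=> y _; rewrite -expRD; congr expR; ring.
Qed.

Lemma cexp_expR_ge (c : R) r (l : R) h : laplace_lb xi c mu -> (0 < size h)%N ->
  (forall j, (size h <= j < size h + r)%N -> `|l| * w j <= mu) ->
  expR (c * l ^+ 2 * (B (size h + r) - B (size h)))
    <= cexp r (fun x => expR (l * (M x - M h))) h.
Proof.
move=> ub; elim: r h => [|r IH] h h0 lw /=.
  by rewrite addn0 !subrr !mulr0.
have -> : c * l ^+ 2 * (B (size h + r.+1) - B (size h)) =
    c * (l * w (size h)) ^+ 2 + c * l ^+ 2 * (B ((size h).+1 + r) - B (size h).+1).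
  by rewrite addSnnS clockS; ring.
have lw1 : `|l * w (size h)| <= mu by rewrite normrM (ger0_norm (w0 _)) lw //; lia.
rewrite expRD; apply: le_trans (ler_wpM2r (expR_ge0 _) (ub h _ h0 lw1)) _.
rewrite mulr_suml; apply: ler_sum => z _; rewrite -[leLHS]mulrA ler_wpM2l ?kS.1 //.
have -> : l * w (size h) * xi h z = l * (M (z :: h) - M h) by rewrite MS //; ring.
rewrite (eq_cexp (G := fun x => expR (l * (M (z :: h) - M h)) * expR (l * (M x - M (z :: h))))).
  rewrite cexpZ.
  apply: ler_wpM2l; first exact: expR_ge0.
  apply: (IH (z :: h)) => // j /= jr; apply: lw; lia.
by move=> y _; rewrite -expRD; congr expR; ring.
Qed.

(** Since [drop j] undoes the last [j] steps, this says that the running maximum over the last [r]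
    steps reaches [x]. *)
Definition passes (r : nat) (x : R) (h : seq Z) := has (fun j => x <= M (drop j h)) (iota 0 r.+1).

(** Doob's maximal inequality for the exponential supermartingale. The induction on the remaining
    steps replaces a stopping time: a start at or above [x] makes the right side at least 1, and a
    start below [x] leaves the passage to the later histories. *)
Lemma cexp_passes_le (c : R) r (l x : R) h : laplace_ub xi c mu -> 0 <= c -> 0 <= l -> (0 < size h)%N ->
  (forall j, (size h <= j < size h + r)%N -> l * w j <= mu) ->
  cexp r (fun y => (passes r x y)%:R) h
    <= expR (l * (M h - x) + c * l ^+ 2 * (B (size h + r) - B (size h))).
Proof.
move=> ub c0 l0; elim: r h => [|r IH] h h0 lw.
  rewrite addn0 subrr mulr0 addr0 /= /passes /= drop0 orbF.
  case: (leP x (M h)) => xM; last exact: expR_ge0.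
  apply: (@le_trans _ _ (expR 0)); first by rewrite expR0.
  by rewrite ler_expR mulr_ge0 // subr_ge0.
have [xM|xM] := leP x (M h).
  apply: le_trans (cexp_pred_le1 _ _ _) _; rewrite -[leLHS]expR0 ler_expR addr_ge0 //.
    by rewrite mulr_ge0 // subr_ge0.
  by rewrite mulr_ge0 ?mulr_ge0 ?sqr_ge0 // subr_ge0 clock_le // leq_addr.
have -> : l * (M h - x) + c * l ^+ 2 * (B (size h + r.+1) - B (size h)) =
    c * (l * w (size h)) ^+ 2 +
    (l * (M h - x) + c * l ^+ 2 * (B ((size h).+1 + r) - B (size h).+1)).
  by rewrite addSnnS clockS; ring.
have lw1 : `|l * w (size h)| <= mu.
  by rewrite normrM (ger0_norm (w0 _)) (ger0_norm l0) lw //; lia.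
rewrite expRD; apply: le_trans (ler_wpM2r (expR_ge0 _) (ub h _ h0 lw1)).
rewrite mulr_suml /=; apply: ler_sum => z _; rewrite -[leRHS]mulrA ler_wpM2l ?kS.1 //.
rewrite -expRD (eq_cexp (G := fun y => (passes r x y)%:R)).
  apply: le_trans (IH (z :: h) isT _) _; first by move=> j /= ?; apply: lw; lia.
  by rewrite ler_expR /= MS //; lra.
move=> y yr; rewrite /passes -addn1 iotaD has_cat /= add0n orbF.
have -> : drop r.+1 (y ++ z :: h) = h.
  by rewrite drop_cat yr ltnNge leqnSn /= subSnn /= drop0.
by rewrite (lt_geF xM) orbF.
Qed.

(* The two-sided Laplace bound alone gives the lower tail: pointwise, with x± = 2 (1 ± e) l v,
   exp(l x) is at most exp((1-e) l x + e l x-) + exp((1+e) l x - e l x+) + 1_(x >= x-) exp(l x+),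
   and the first two terms have small expectation. *)
Lemma cexp_tail_ge r (l e : R) h : 0 < e -> e <= 2^-1 -> 0 <= l ->
  laplace_ub xi (1 + e ^+ 2 / 8) mu -> laplace_lb xi (1 - e ^+ 2 / 8) mu ->
  (0 < size h)%N -> (forall j, (size h <= j < size h + r)%N -> 2 * l * w j <= mu) ->
  let v := B (size h + r) - B (size h) in 4 <= e ^+ 2 * (l ^+ 2 * v) ->
  expR (- ((1 + e) ^+ 2 * (l ^+ 2 * v)))
    <= cexp r (fun x => (2 * (1 - e) * l * v <= M x - M h)%R%:R) h.
Proof.
move=> e0 e2 l0 ub lb h0 lw v eV.
set xm := 2 * (1 - e) * l * v; pose xp := 2 * (1 + e) * l * v.
set V := l ^+ 2 * v in eV *; set d := e ^+ 2 / 8 in ub lb.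
have lw' t : 0 <= t -> t <= 2 -> forall j, (size h <= j < size h + r)%N -> `|t * l| * w j <= mu.
  move=> t0 t2 j /lw; apply: le_trans; rewrite ger0_norm ?mulr_ge0 //.
  by rewrite ler_wpM2r // ler_wpM2r.
have lw1 j : (size h <= j < size h + r)%N -> `|l| * w j <= mu.
  by move=> /(lw' 1 ler01 (ltac:(lra))); rewrite mul1r.
have L1 := cexp_expR_ge lb h0 lw1.
have L2 := cexp_expR_le ub h0 (lw' (1 - e) _ _).
have L3 := cexp_expR_le ub h0 (lw' (1 + e) _ _).
have {L1} L1 : expR ((1 - d) * V) <= cexp r (fun x => expR (l * (M x - M h))) h.
  by rewrite /V mulrA.
have {L2} L2 : cexp r (fun x => expR ((1 - e) * l * (M x - M h))) h
    <= expR ((1 + d) * (1 - e) ^+ 2 * V).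
  have -> : (1 + d) * (1 - e) ^+ 2 * V = (1 + d) * ((1 - e) * l) ^+ 2 * v by rewrite /V; ring.
  by apply: L2; lra.
have {L3} L3 : cexp r (fun x => expR ((1 + e) * l * (M x - M h))) h
    <= expR ((1 + d) * (1 + e) ^+ 2 * V).
  have -> : (1 + d) * (1 + e) ^+ 2 * V = (1 + d) * ((1 + e) * l) ^+ 2 * v by rewrite /V; ring.
  by apply: L3; lra.
set P := cexp r _ h.
have key : expR ((1 - d) * V) <= expR (e * l * xm) * expR ((1 + d) * (1 - e) ^+ 2 * V)
    + expR (- (e * l * xp)) * expR ((1 + d) * (1 + e) ^+ 2 * V) + expR (l * xp) * P.
  apply: le_trans L1 _.
  have := ler_wpM2l (expR_ge0 (e * l * xm)) L2.
  have := ler_wpM2l (expR_ge0 (- (e * l * xp))) L3.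
  rewrite -!cexpZ => H3 H2.
  apply: (@le_trans _ _ (cexp r (fun x => expR (e * l * xm) * expR ((1 - e) * l * (M x - M h))
     + expR (- (e * l * xp)) * expR ((1 + e) * l * (M x - M h))
     + expR (l * xp) * (xm <= M x - M h)%R%:R) h)).
    apply: cexp_le => y _; set X := M _ - M h; rewrite -!expRD.
    have [Xm|Xm] := leP xm X; rewrite ?mulr1 ?mulr0 ?addr0.
      have [Xp|Xp] := leP X xp.
        apply: (@le_trans _ _ (expR (l * xp))); first by rewrite ler_expR ler_wpM2l.
        by rewrite lerDr addr_ge0 ?expR_ge0.
      rewrite -addrA addrCA; apply: ler_wpDr; first by rewrite addr_ge0 ?expR_ge0.
      rewrite ler_expR; have := mulr_ge0 (mulr_ge0 (ltW e0) l0) (ltW (etrans (subr_gt0 _ _) Xp)); lra.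
    apply: ler_wpDr; first by rewrite expR_ge0.
    rewrite ler_expR; have := mulr_ge0 (mulr_ge0 (ltW e0) l0) (ltW (etrans (subr_gt0 _ _) Xm)); lra.
  by rewrite !cexpD !cexpZ; rewrite !cexpZ in H2 H3; rewrite lerD2r lerD.
have V0 : 0 <= V.
  by rewrite /V mulr_ge0 ?sqr_ge0 // subr_ge0 clock_le // leq_addr.
have dE : d = e ^+ 2 / 8 by [].
have e2V : expR (- 2) <= 4^-1 :> R.
  have := expR_ge1Dx (1 : R) => h1.
  rewrite expRN lef_pV2 ?posrE ?expR_gt0 //.
  by rewrite (_ : 2 = 1 + 1 :> R) // expRD; nra.
have e1V : expR (- 1) <= 2^-1 :> R.
  have := expR_ge1Dx (1 : R) => h1.
  by rewrite expRN lef_pV2 ?posrE ?expR_gt0.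
(* The exponents of the two tilted terms are (1 - e^2) V plus d (1 - e)^2 V or d (1 + e)^2 V. As d =
   e^2 / 8 and e^2 V >= 4, both lie at least 2 below (1 - d) V, so each term takes at most a quarter
   of the left side of [key]. *)
have small (q : R) : q <= (1 - d) * V - 2 -> expR q <= expR ((1 - d) * V) / 4.
  move=> qV; apply: (@le_trans _ _ (expR ((1 - d) * V - 2))); first by rewrite ler_expR.
  by rewrite expRD ler_wpM2l // expR_ge0.
have xmE : e * l * xm = 2 * e * (1 - e) * V by rewrite /xm /V; ring.
have xpE : e * l * xp = 2 * e * (1 + e) * V by rewrite /xp /V; ring.
have xpE' : l * xp = 2 * (1 + e) * V by rewrite /xp /V; ring.
have eV0 : 0 <= e ^+ 2 * V by rewrite mulr_ge0 // sqr_ge0.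
have eeV : e ^+ 2 * V * e <= e ^+ 2 * V * 2^-1 by rewrite ler_wpM2l.
have eeV0 : 0 <= e ^+ 2 * V * e by rewrite mulr_ge0 // ltW.
have eeeV : e ^+ 2 * V * e * e <= e ^+ 2 * V * 2^-1 * 2^-1.
  apply: le_trans (ler_wpM2l eeV0 e2) _; by rewrite ler_wpM2r.
have eeeV0 : 0 <= e ^+ 2 * V * e * e by rewrite mulr_ge0 // ltW.
have A1 := small (e * l * xm + (1 + d) * (1 - e) ^+ 2 * V) ltac:(rewrite xmE dE; lra).
have A2 := small (- (e * l * xp) + (1 + d) * (1 + e) ^+ 2 * V) ltac:(rewrite xpE dE; lra).
move: A1 A2 key; rewrite !expRD => A1 A2 key.
have {}key : expR ((1 - d) * V) / 2 <= expR (l * xp) * P by lra.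
rewrite -(ler_pM2l (expR_gt0 (l * xp))); apply: le_trans key; rewrite -expRD.
apply: (@le_trans _ _ (expR ((1 - d) * V - 1))).
  by rewrite ler_expR xpE' dE; lra.
by rewrite expRD ler_wpM2l ?expR_ge0.
Qed.

(* Paley-Zygmund applied to exp(l (M x - M h)). *)
Lemma cexp_anticoncentration r (l c c' : R) h : 0 < c -> 0 <= l ->
  laplace_ub xi c' mu -> laplace_lb xi c mu ->
  (0 < size h)%N -> (forall j, (size h <= j < size h + r)%N -> 2 * l * w j <= mu) ->
  l ^+ 2 * (B (size h + r) - B (size h)) = 1 ->
  expR (- (4 * c')) * (expR c - expR (c / 2)) ^+ 2
    <= cexp r (fun x => (c / 2 <= l * (M x - M h))%R%:R) h.
Proof.
move=> c0 l0 ub lb h0 lw lv.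
have lw1 j : (size h <= j < size h + r)%N -> `|l| * w j <= mu.
  move=> /lw; apply: le_trans; rewrite ger0_norm // ler_wpM2r // ler_peMl //; lra.
have lw2 j : (size h <= j < size h + r)%N -> `|2 * l| * w j <= mu.
  by move=> /lw; rewrite ger0_norm // mulr_ge0.
have := cexp_expR_ge lb h0 lw1; rewrite -mulrA lv mulr1 => L1.
have := cexp_expR_le ub h0 lw2; rewrite -mulrA exprMn -mulrA lv mulr1 => L2.
set P := cexp r _ h.
(* The Cauchy-Schwarz step is replaced by its linear form: for Y >= c/2, exp(Y) <= 1/(2a) + (a/2)
   exp(2Y). The choice of [a] makes the second moment term equal to g/2, half of the gap to be
   explained. *)
pose g := expR c - expR (c / 2); pose a := expR (- (4 * c')) * g.
have g0 : 0 < g by rewrite subr_gt0 ltr_expR; lra.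
have a0 : 0 < a by rewrite mulr_gt0 ?expR_gt0.
have key : expR c <= expR (c / 2) + (2 * a)^-1 * P + a / 2 * expR (c' * 2 ^+ 2).
  apply: le_trans L1 _.
  apply: (@le_trans _ _ (cexp r (fun x => expR (c / 2) + (2 * a)^-1 * (c / 2 <= l * (M x - M h))%R%:R
     + a / 2 * expR (2 * l * (M x - M h))) h)).
    apply: cexp_le => y _; rewrite -(mulrA 2 l); set Y := l * (_ - M h).
    have [Ym|Ym] := leP (c / 2) Y; rewrite ?mulr1 ?mulr0 ?addr0.
      have -> : expR (2 * Y) = expR Y ^+ 2 by rewrite -expRM_natl.
      apply: (@le_trans _ _ ((2 * a)^-1 + a / 2 * expR Y ^+ 2)); last first.
        by rewrite lerD2r lerDr expR_ge0.
      rewrite -subr_ge0.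
      have -> : (2 * a)^-1 + a / 2 * expR Y ^+ 2 - expR Y = (2 * a)^-1 * (1 - a * expR Y) ^+ 2.
        by field; rewrite gt_eqF.
      by rewrite mulr_ge0 ?sqr_ge0 // invr_ge0 mulr_ge0 // ltW.
    rewrite -[leLHS]addr0 lerD ?ler_expR ?(ltW Ym) //.
    by rewrite mulr_ge0 ?expR_ge0 // divr_ge0 // ltW.
  rewrite !cexpD cexp_cst; apply: lerD; first by rewrite cexpZ.
  by rewrite cexpZ; apply: ler_wpM2l L2; rewrite divr_ge0 // ltW.
have aE : a * expR (c' * 2 ^+ 2) = g.
  rewrite /a mulrAC -expRD (_ : _ + _ = 0) ?expR0 ?mul1r //; ring.
have {}key : g / 2 <= (2 * a)^-1 * P by move: key; rewrite mulrAC aE /g; lra.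
rewrite expr2 mulrA -/g -/a.
have a20 : 0 < 2 * a by rewrite mulr_gt0.
have := ler_wpM2r (ltW a20) key.
rewrite (_ : g / 2 * (2 * a) = a * g); last by field.
by rewrite (_ : (2 * a)^-1 * P * (2 * a) = P) //; field; rewrite gt_eqF.
Qed.

End Increments.
End Chain.

(** * Integration over finitely many independent discrete coordinates *)

Section DiscreteIndependence.
Variables (R : realType) (d : measure_display) (T : measurableType d) (P : probability T R).
Variables (I : eqType) (Y : I -> T -> nat) (supp : I -> seq nat) (wt : I -> nat -> R).
Hypothesis Yind : discrete_mutual_indep P Y.
Hypotheses (supp_uniq : forall i, uniq (supp i)) (wt1 : forall i, \sum_(v <- supp i) wt i v = 1).
Hypothesis wtP : forall i v, v \in supp i -> P (Y i @^-1` [set v]) = (wt i v)%:E.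

Local Notation Pr A := (fine (P A)).

Lemma fineP (A : set T) : measurable A -> P A = (Pr A)%:E.
Proof. by move=> mA; rewrite fineK // fin_num_measure. Qed.

Definition upd (om : I -> nat) i v := fun j => if j == i then v else om j.

Fixpoint iexp (l : seq I) (G : (I -> nat) -> R) (om : I -> nat) : R :=
  if l is i :: l' then \sum_(v <- supp i) wt i v * iexp l' G (upd om i v) else G om.

Lemma iexp_cat l1 l2 G om : iexp (l1 ++ l2) G om = iexp l1 (iexp l2 G) om.
Proof. by elim: l1 om => [//|i l1 IH] om /=; apply: eq_bigr => v _; rewrite IH. Qed.

Lemma eq_iexp l F G om : F =1 G -> iexp l F om = iexp l G om.
Proof. by move=> FG; elim: l om => [//|i l IH] om /=; apply: eq_bigr => v _; rewrite IH. Qed.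

Definition depends_on {X} (l : seq I) (A : (I -> nat) -> X) :=
  forall om om', {in l, om =1 om'} -> A om = A om'.

Lemma measurable_fiber i v : measurable (Y i @^-1` [set v]).
Proof. by have [/(_ i v)] := Yind. Qed.

(** The values are natural numbers, so fixing one coordinate at a time writes the event as a
    countable union. *)
Lemma measurable_depends l (A : pred (I -> nat)) : depends_on l A ->
  measurable [set t | A (Y^~ t)].
Proof.
elim: l A => [|i l IH] A dA.
  rewrite (_ : [set t | _] = [set _ | A (fun=> 0%N)]).
    by case: (A _); [rewrite (_ : mkset _ = setT)|rewrite (_ : mkset _ = set0)] => //;
       apply/seteqP; split.
  by apply/seteqP; split=> t /=; rewrite (dA _ (fun=> 0%N)).
rewrite (_ : [set t | _] = \bigcup_v (Y i @^-1` [set v] `&` [set t | A (upd (Y^~ t) i v)])).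
  apply: bigcupT_measurable => v; apply: measurableI; first exact: measurable_fiber.
  apply: (IH (fun om => A (upd om i v))) => om om' oo; apply: dA => j.
  by rewrite in_cons /upd; case: eqP => //= _ /oo.
apply/seteqP; split=> t /=.
  move=> At; exists (Y i t) => //; split=> //=.
  by rewrite (dA _ (Y^~ t)) // => j _; rewrite /upd; case: eqP => // ->.
move=> [v _ [/= Yv]]; rewrite (dA _ (Y^~ t)) // => j _; rewrite /upd.
by case: eqP => // ->.
Qed.

Lemma prob_supp i s (E : set T) : uniq s -> measurable E ->
  measurable (E `&` [set t | Y i t \in s]) /\
  Pr (E `&` [set t | Y i t \in s]) = \sum_(v <- s) Pr (E `&` Y i @^-1` [set v]).
Proof.
move=> + mE; elim: s => [_|v s IH /= /andP[vs us]].
  rewrite big_nil (_ : _ `&` _ = set0); last by apply/seteqP; split=> t // [].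
  by rewrite measure0.
have [m1 e1] := IH us.
have mv : measurable (E `&` Y i @^-1` [set v]).
  by apply: measurableI => //; exact: measurable_fiber.
have -> : E `&` [set t | Y i t \in v :: s] =
    (E `&` Y i @^-1` [set v]) `|` (E `&` [set t | Y i t \in s]).
  apply/seteqP; split=> t /=; rewrite in_cons.
    by move=> [Et /orP[/eqP|] ?]; [left|right].
  by move=> [[Et /= ->]|[Et ->]]; rewrite ?eqxx ?orbT.
split; first exact: measurableU.
rewrite measureU //; last first.
  by apply/seteqP; split=> t // [[_ /= Yv] [_ /= vs']]; rewrite -Yv vs' in vs.
by rewrite fineD ?fin_num_measure // e1 big_cons.
Qed.

(** The values lie in [supp i] only almost surely: the point masses there already add up to 1. *)
Lemma off_supp0 i : P [set t | Y i t \notin supp i] = 0%E.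
Proof.
have [m e] := prob_supp i (supp_uniq i) (@measurableT _ T).
rewrite setTI in m e.
have -> : [set t | Y i t \notin supp i] = ~` [set t | Y i t \in supp i].
  by apply/seteqP; split=> t /= /negP.
have {}e : Pr [set t | Y i t \in supp i] = 1.
  by rewrite e -(wt1 i); apply: eq_big_seq => v vs; rewrite setTI wtP.
by rewrite probability_setC // fineP // e subee.
Qed.

Lemma prob_split i (E : set T) : measurable E ->
  Pr E = \sum_(v <- supp i) Pr (E `&` Y i @^-1` [set v]).
Proof.
move=> mE; have [m <-] := prob_supp i (supp_uniq i) mE.
have mN : measurable [set t | Y i t \notin supp i].
  apply: (@measurable_depends [:: i] (fun om => om i \notin supp i)) => om om' oo.
  by rewrite oo // mem_head.
set N := [set t | Y i t \notin supp i] in mN *.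
have PN : P (E `&` N) = 0%E.
  apply/eqP; rewrite -measure_le0 -(off_supp0 i) le_measure // inE //.
  exact: measurableI.
have EU : E = (E `&` [set t | Y i t \in supp i]) `|` (E `&` N).
  rewrite -setIUr (_ : _ `|` _ = setT) ?setIT //.
  by apply/seteqP; split=> t //= _; rewrite /N /=; case: (_ \in _); [left|right].
have -> : P E = (P (E `&` [set t | Y i t \in supp i]) + P (E `&` N))%E.
  rewrite [in LHS]EU; apply: measureU => //; first exact: measurableI.
  by apply/seteqP; split=> t // [[_ /= Yt] [_]]; rewrite /N /= Yt.
by rewrite PN adde0.
Qed.

(** The induction moves each coordinate of [l] into the fixed prefix by summing over its values.
    Independence enters only at the end, when the fixed values decide [A] and the probability of
    their cylinder factors. *)
Lemma prob_iexp_given pre l (A : pred (I -> nat)) om : uniq (pre ++ l) ->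
  depends_on (pre ++ l) A ->
  Pr ([set t | A (Y^~ t)] `&` \bigcap_(i in [set` pre]) (Y i @^-1` [set om i])) =
  (\prod_(i <- pre) Pr (Y i @^-1` [set om i])) * iexp l (fun x => (A x)%:R) om.
Proof.
elim: l pre om => [|i l IH] pre om.
  rewrite cats0 => upre dA /=.
  have AE t : (\bigcap_(i in [set` pre]) (Y i @^-1` [set om i])) t -> A (Y^~ t) = A om.
    by move=> H; apply: dA => j jp; exact: (H j).
  have [Aom|Aom] := boolP (A om).
    rewrite mulr1 (_ : _ `&` _ = \bigcap_(i in [set` pre]) (Y i @^-1` [set om i])).
      rewrite Yind.2 // -[LHS]/(fine _).
      rewrite (eq_bigr (fun i => (Pr (Y i @^-1` [set om i]))%:E)) ?prodEFin // => j _.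
      by rewrite fineP //; exact: measurable_fiber.
    by apply/seteqP; split=> t; [case|move=> Ht; split=> //=; rewrite AE].
  rewrite mulr0 (_ : _ `&` _ = set0) ?measure0 //.
  by apply/seteqP; split=> t //= [At /AE]; rewrite At (negbTE Aom).
move=> upre dA /=; rewrite (prob_split i); last first.
  apply: measurableI; first exact: measurable_depends dA.
  rewrite (_ : \bigcap_(i in _) _ = [set t | all (fun j => Y j t == om j) pre]).
    apply: (@measurable_depends pre (fun x => all (fun j => x j == om j) pre)) => x x' xx.
    by apply: eq_in_all => j /xx ->.
  by apply/seteqP; split=> t /= H; [apply/allP => j jp; apply/eqP; exact: (H j)|
    move=> j /= jp; apply/eqP; exact: (allP H)].
have pe : perm_eq (pre ++ i :: l) ((i :: pre) ++ l) by rewrite -cat_rcons perm_cat2r perm_rcons.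
rewrite mulr_sumr; apply: eq_big_seq => v vs.
have ipre : i \notin pre by move: upre; rewrite cat_uniq /= negb_or => /and3P[_ /andP[]].
have := IH (i :: pre) (upd om i v).
rewrite -(perm_uniq pe) => /(_ upre).
have dA' : depends_on ((i :: pre) ++ l) A.
  by move=> x x' xx; apply: dA => j; rewrite (perm_mem pe) => /xx.
move=> /(_ dA'); have updE : upd om i v i = v by rewrite /upd eqxx.
rewrite big_cons updE => IHv.
rewrite [RHS]mulrCA mulrA -[wt i v]/(fine (wt i v)%:E) -wtP //.
have -> : \prod_(j <- pre) Pr (Y j @^-1` [set om j]) =
          \prod_(j <- pre) Pr (Y j @^-1` [set upd om i v j]).
  by apply: eq_big_seq => j jp; rewrite /upd; case: eqP jp ipre => // -> ->.
rewrite -IHv; congr (fine (P _)); apply/seteqP; split=> t /=.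
  move=> [[At H] Yt]; split=> // j /=; rewrite in_cons /upd; case: eqP => [->//|_ /= jp].
  exact: H.
move=> [At H]; split; last by have := H i; rewrite /= mem_head /upd eqxx; apply.
split=> // j /= jp; have := H j; rewrite /= in_cons jp orbT /upd => /(_ isT).
by case: eqP jp ipre => // -> ->.
Qed.

Lemma prob_iexp l (A : pred (I -> nat)) om : uniq l -> depends_on l A ->
  P [set t | A (Y^~ t)] = (iexp l (fun x => (A x)%:R) om)%:E.
Proof.
move=> ul dA; rewrite fineP; last exact: measurable_depends dA.
have := @prob_iexp_given [::] l A om ul dA.
by rewrite big_nil mul1r (_ : \bigcap_(i in _) _ = setT) ?setIT => [->|];
  last by apply/seteqP; split.
Qed.

End DiscreteIndependence.

Lemma ae_foralln (R : realType) (d : measure_display) (T : measurableType d)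
    (P : {measure set T -> \bar R}) (Q : nat -> T -> Prop) :
  (forall n, {ae P, forall t, Q n t}) -> {ae P, forall t, forall n, Q n t}.
Proof.
move=> H; apply: negligibleS (negligible_bigcup H) => t /= /existsNP[n nQ].
by exists n.
Qed.

(** * Two independent elephant walks as a Markov chain on histories *)

Section ElephantLaw.
Variables (R : realType) (p s : R).

Definition sg (b : bool) : R := if b then 1 else -1.

(* [step om w m l] is the step [X_(m+1)] of walk [w] (as a sign) driven by the values [om], when the
   previous steps are [l], most recent first. *)
Definition step (om : erw_index -> nat) (w : bool) (m : nat) (l : seq bool) : bool :=
  if m is m'.+1 then
    (om (w, Some (m', false)) == 1%N) == nth false (rev l) (om (w, Some (m', true))).-1
  else om (w, None) == 1%N.

Fixpoint signs (om : erw_index -> nat) (w : bool) (n : nat) : seq bool :=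
  if n is m.+1 then step om w m (signs om w m) :: signs om w m else [::].

Definition hist om n := zip (signs om true n) (signs om false n).

Definition kstep (l : seq bool) (b : bool) : R :=
  if l is [::] then (if b then s else 1 - s)
  else (size l)%:R^-1 * \sum_(x <- l) (if x == b then p else 1 - p).

Definition kpair (h : seq (bool * bool)) (z : bool * bool) : R :=
  kstep (unzip1 h) z.1 * kstep (unzip2 h) z.2.

Definition wt (i : erw_index) (v : nat) : R :=
  match i.2 with
  | None => if v == 1%N then s else 1 - s
  | Some (m, true) => m.+1%:R^-1
  | Some (_, false) => if v == 1%N then p else 1 - p
  end.

Definition supp (i : erw_index) : seq nat :=
  if i.2 is Some (m, true) then iota 1 m.+1 else [:: 0%N; 1%N].

Lemma supp_uniq i : uniq (supp i).
Proof. by case: i => w [[m []]|] //; exact: (iota_uniq 1 m.+1). Qed.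

Lemma wt_sum1 i : \sum_(v <- supp i) wt i v = 1.
Proof.
case: i => w [[m []]|]; rewrite /supp /wt /=.
- rewrite -/(iota 1 m.+1) big_const_seq count_predT size_iota iter_addr_0.
  by rewrite -[LHS]mulr_natr mulVf.
- by rewrite !big_cons big_nil /=; ring.
- by rewrite !big_cons big_nil /=; ring.
Qed.

(** The number of steps already made when the coordinate is read; a history of length n depends only
    on the coordinates with [ctime] below n. *)
Definition ctime (i : erw_index) : nat := if i.2 is Some (m, _) then m.+1 else 0%N.

Definition coords1 (w : bool) (m : nat) : seq erw_index :=
  if m is m'.+1 then [:: (w, Some (m', true)); (w, Some (m', false))] else [:: (w, None)].

Definition coords_step m := coords1 true m ++ coords1 false m.

Fixpoint coords n : seq erw_index := if n is m.+1 then coords m ++ coords_step m else [::].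

Lemma ctime_step m i : i \in coords_step m -> ctime i = m.
Proof.
by case: m => [|m]; rewrite /coords_step mem_cat !inE;
  [case/orP => /eqP ->|case/orP => /orP[] /eqP ->].
Qed.

Lemma ctime_coords n i : i \in coords n -> (ctime i < n)%N.
Proof.
elim: n => [//|n IH] /=; rewrite mem_cat => /orP[/IH|/ctime_step ->] //.
by move=> h; apply: ltnW.
Qed.

Lemma coords_uniq n : uniq (coords n).
Proof.
elim: n => [//|n IH] /=; rewrite cat_uniq IH /=; apply/andP; split; last first.
  apply: (@map_uniq _ _ (fun i => (i.1, if i.2 is Some (_, b) then b else false))).
  by case: n {IH}.
apply/hasPn => i /ctime_step it; apply/negP => /ctime_coords; by rewrite it ltnn.
Qed.

Lemma size_signs om w n : size (signs om w n) = n.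
Proof. by elim: n => [//|n IH] /=; rewrite IH. Qed.

Lemma size_hist om n : size (hist om n) = n.
Proof. by rewrite /hist size_zip !size_signs minnn. Qed.

Lemma histS om n : hist om n.+1 =
  (step om true n (signs om true n), step om false n (signs om false n)) :: hist om n.
Proof. by []. Qed.

Lemma unzip1_hist om n : unzip1 (hist om n) = signs om true n.
Proof. by rewrite unzip1_zip // !size_signs. Qed.

Lemma unzip2_hist om n : unzip2 (hist om n) = signs om false n.
Proof. by rewrite unzip2_zip // !size_signs. Qed.

Lemma mem_coords i n : (ctime i < n)%N -> i \in coords n.
Proof.
elim: n => [//|n IH]; rewrite ltnS leq_eqVlt /= mem_cat => /orP[/eqP it|/IH -> //].
apply/orP; right; rewrite /coords_step mem_cat.
by move: it; clear IH; case: i => [[] [[m []]|]] /= <-; rewrite /= ?inE ?eqxx ?orbT.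
Qed.

Lemma signs_ext om om' w n : (forall i, (ctime i < n)%N -> om i = om' i) ->
  signs om w n = signs om' w n.
Proof.
elim: n => [//|n IH] H /=; rewrite IH; last by move=> i ?; apply: H; apply: ltnW.
by congr (_ :: _); case: n H {IH} => [|n] H /=; rewrite !H.
Qed.

Lemma hist_ext om om' n : (forall i, (ctime i < n)%N -> om i = om' i) -> hist om n = hist om' n.
Proof. by move=> H; rewrite /hist !(signs_ext _ H). Qed.

Lemma step_mean (F : bool -> R) (l : seq bool) m : size l = m.+1 ->
  \sum_(u <- iota 1 m.+1) m.+1%:R^-1 * \sum_(c <- [:: 0%N; 1%N])
     (if c == 1%N then p else 1 - p) * F ((c == 1%N) == nth false (rev l) u.-1)
  = \sum_b kstep l b * F b.
Proof.
move=> lm; rewrite -mulr_sumr.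
rewrite (_ : \sum_(u <- _) _ = \sum_(x <- l) (p * F x + (1 - p) * F (~~ x))).
  have -> : \sum_b kstep l b * F b =
      m.+1%:R^-1 * \sum_b (\sum_(x <- l) (if x == b then p else 1 - p)) * F b.
    rewrite mulr_sumr; apply: eq_bigr => b _; rewrite mulrA; congr (_ * _).
    by case: l lm => // a l [lm]; rewrite /kstep /= lm.
  congr (_ * _); rewrite big_bool /= !mulr_suml -big_split /=; apply: eq_bigr => -[] _ /=; ring.
rewrite -[iota 1 m.+1]/(iota (1 + 0) m.+1) iotaDl big_map /=.
rewrite [RHS](_ : _ = \sum_(x <- rev l) (p * F x + (1 - p) * F (~~ x))); last first.
  by apply: perm_big; rewrite perm_sym perm_rev.
rewrite (big_nth false) size_rev lm /index_iota subn0; apply: eq_bigr => u _.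
rewrite !big_cons big_nil /= addr0 addrC; congr (_ * F _ + _ * F _).
Qed.

Lemma step0_mean (F : bool -> R) :
  \sum_(c <- [:: 0%N; 1%N]) (if c == 1%N then s else 1 - s) * F (c == 1%N)
  = \sum_b kstep [::] b * F b.
Proof. by rewrite !big_cons big_nil /= big_bool /= addr0 addrC. Qed.

Lemma sum_kpair h (G : bool * bool -> R) : \sum_z kpair h z * G z =
  \sum_b kstep (unzip1 h) b * \sum_b' kstep (unzip2 h) b' * G (b, b').
Proof.
under [RHS]eq_bigr do rewrite mulr_sumr.
rewrite pair_big /=; apply: eq_bigr => -[b b'] _; by rewrite mulrA.
Qed.

(** The coordinates read at time [n] are fresh: overwriting them leaves the history of length [n]
    unchanged, and what remains is the mean over one index and one coin for each walk. *)
Lemma iexp_coords_step n (G : seq (bool * bool) -> R) om :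
  iexp supp wt (coords_step n) (fun x => G (hist x n.+1)) om =
  \sum_z kpair (hist om n) z * G (z :: hist om n).
Proof.
rewrite sum_kpair unzip1_hist unzip2_hist.
have hE om' : (forall i, (ctime i < n)%N -> om' i = om i) ->
    G (hist om' n.+1) =
      G ((step om' true n (signs om true n), step om' false n (signs om false n)) :: hist om n).
  by move=> oo; rewrite histS (hist_ext oo) !(signs_ext _ oo).
case: n hE => [|n] hE.
  rewrite /coords_step /= -step0_mean; apply: eq_bigr => c _; congr (_ * _).
  rewrite -step0_mean; apply: eq_bigr => c' _; congr (_ * _).
rewrite /coords_step /=.
rewrite -(step_mean (fun b => \sum_b' kstep (signs om false n.+1) b' * G ((b, b') :: hist om n.+1))
  (size_signs om true n.+1)); apply: eq_bigr => u _; congr (_ * _).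
apply: eq_bigr => c _; congr (_ * _).
rewrite -(step_mean (fun b' => G ((_, b') :: hist om n.+1)) (size_signs om false n.+1)).
apply: eq_bigr => u' _; congr (_ * _).
apply: eq_bigr => c' _; congr (_ * _).
rewrite hE; last first.
  have upt om' i j v : ctime j <> ctime i -> upd om' i v j = om' j.
    by rewrite /upd; case: eqP => // ->.
  by move=> i it; rewrite !upt //= => e; move: it; rewrite e ltnn.
(* [f] separates the four coordinates of one step, so every lookup after the updates is decided by
   computation. *)
pose f (i : erw_index) := (i.1, if i.2 is Some (_, b) then b else false).
have upf om' i j v : f j != f i -> upd om' i v j = om' j.
  by rewrite /upd; case: (j =P i) => // ->; rewrite eqxx.
have upe om' i v : upd om' i v i = v by rewrite /upd eqxx.
by rewrite /step !(upe, upf).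
Qed.

Lemma iexp_coords n (G : seq (bool * bool) -> R) om :
  iexp supp wt (coords n) (fun x => G (hist x n)) om = cexp kpair n G [::].
Proof.
elim: n G => [//|n IH] G.
rewrite -[n.+1 in RHS]addn1 cexp_add -IH /= iexp_cat; apply: eq_iexp => x.
by rewrite iexp_coords_step.
Qed.

Lemma kstep_sum l : \sum_b kstep l b = 1.
Proof.
case: l => [|a l]; first by rewrite big_bool /=; ring.
rewrite big_bool /= -mulrDr -big_split /= -[RHS](@mulVf _ (size l).+1%:R) //.
congr (_ * _); rewrite (eq_bigr (fun=> 1)) => [|[] _ /=]; [|ring..].
by rewrite big_const_seq count_predT iter_addr_0.
Qed.

Lemma stochastic_kpair : 0 <= p <= 1 -> 0 <= s <= 1 -> stochastic kpair.
Proof.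
move=> /andP[p0 p1] /andP[s0 s1].
have k0 l b : 0 <= kstep l b.
  case: l => [|a l]; first by case: b; rewrite /= ?subr_ge0.
  rewrite mulr_ge0 ?invr_ge0 ?ler0n // sumr_ge0 // => x _.
  by case: ifP; rewrite ?subr_ge0.
split=> [h z|h]; first by rewrite mulr_ge0.
have := sum_kpair h (fun=> 1); under eq_bigr do rewrite mulr1.
move=> ->; under eq_bigr do rewrite (eq_bigr _ (fun b _ => mulr1 _)) kstep_sum mulr1.
by rewrite kstep_sum.
Qed.

Section Coupling.
Variables (d : measure_display) (T : measurableType d) (P : probability T R).
Variable (Y : erw_index -> T -> nat).
Hypothesis YP : erw_pair_family P p s Y.

Lemma wt_law i v : v \in supp i -> P (Y i @^-1` [set v]) = (wt i v)%:E.
Proof.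
case: YP => _ [Y0 [Yu Yc]]; case: i => w [[m []]|] vs; rewrite /wt.
- by apply: Yu; move: vs; rewrite /supp -/(iota 1 m.+1) mem_iota add1n ltnS.
- by have [c1 c0] := Yc w m; move: vs; rewrite !inE => /orP[] /eqP ->.
- by have [c1 c0] := Y0 w; move: vs; rewrite !inE => /orP[] /eqP ->.
Qed.

Lemma hist_law n (A : pred (seq (bool * bool))) :
  measurable [set t | A (hist (Y^~ t) n)] /\
  P [set t | A (hist (Y^~ t) n)] = (cexp kpair n (fun h => (A h)%:R) [::])%:E.
Proof.
have dA : depends_on (coords n) (fun om => A (hist om n)).
  by move=> x x' xx; congr (A _); apply: hist_ext => i /mem_coords/xx.
split; first exact: (measurable_depends YP.1 dA).
rewrite (prob_iexp YP.1 supp_uniq wt_sum1 wt_law (fun=> 0%N) (coords_uniq n) dA).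
by rewrite (iexp_coords n (fun h => (A h)%:R)).
Qed.

(** Only almost sure: an index beyond the range picks the default 0 in [erw_steps], but the default
    [false], that is the step -1, in [signs]. *)
Lemma erw_S_signs : {ae P, forall t, forall w n,
  erw_S Y w n t = \sum_(b <- signs (Y^~ t) w n) sg b}.
Proof.
have H w m : {ae P, forall t, Y (w, Some (m, true)) t \in supp (w, Some (m, true))}.
  have := off_supp0 YP.1 supp_uniq wt_sum1 wt_law (w, Some (m, true)).
  exists [set t | Y (w, Some (m, true)) t \notin supp (w, Some (m, true))]; split => //.
  - apply: (@measurable_depends _ _ _ P _ Y YP.1 [:: (w, Some (m, true))]
      (fun om => om (w, Some (m, true)) \notin supp (w, Some (m, true)))) => om om' oo.
    by rewrite oo // mem_head.
  - by move=> t /= /negP.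
move: (ae_foralln (H true)) (ae_foralln (H false)); apply: filterS2 => t Ht Hf w n.
have {Ht Hf} Hw m : (0 < Y (w, Some (m, true)) t <= m.+1)%N.
  have : Y (w, Some (m, true)) t \in supp (w, Some (m, true)) by case: w; [exact: Ht|exact: Hf].
  by rewrite /supp -/(iota 1 m.+1) mem_iota add1n ltnS.
rewrite /erw_S.
rewrite (_ : erw_steps _ _ _ _ _ = map sg (rev (signs (Y^~ t) w n))).
  by rewrite big_map; apply: perm_big; rewrite perm_rev.
elim: n => [//|[//|n] IH].
have -> x u c : erw_steps R x u c n.+2 = rcons (erw_steps R x u c n.+1)
    (sgn01 R (c n) * nth 0 (erw_steps R x u c n.+1) (u n).-1) by [].
have -> om : signs om w n.+2 = step om w n.+1 (signs om w n.+1) :: signs om w n.+1 by [].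
rewrite IH rev_cons map_rcons; congr rcons.
rewrite (nth_map false); last first.
  by rewrite size_rev size_signs; have := Hw n; lia.
rewrite /step /sgn01 /sg.
by case: (_ == 1%N); case: (nth _ _ _) => /=; ring.
Qed.

End Coupling.
End ElephantLaw.

(** * Events of the history process *)

Section ChainLaw.
Variables (R : realType) (Z : finType) (k : seq Z -> Z -> R).
Variables (d : measure_display) (T : measurableType d) (P : probability T R).
Variable (X : nat -> T -> seq Z).

(** The whole interface between the probability space and the chain: histories grow by one step at a
    time, and events of one history have the law given by [cexp] from the empty history. *)
Definition chain_law :=
  [/\ forall n t, size (X n t) = n,
      forall n t, drop 1 (X n.+1 t) = X n t &
      forall n (A : pred (seq Z)), measurable [set t | A (X n t)] /\
        P [set t | A (X n t)] = (cexp k n (fun h => (A h)%:R) [::])%:E].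

Hypotheses (kS : stochastic k) (XL : chain_law).

Lemma chain_size n t : size (X n t) = n. Proof. by case: XL. Qed.

Lemma chain_measurable n (A : pred (seq Z)) : measurable [set t | A (X n t)].
Proof. by case: XL => _ _ /(_ n A)[]. Qed.

Lemma chain_prob n (A : pred (seq Z)) :
  P [set t | A (X n t)] = (cexp k n (fun h => (A h)%:R) [::])%:E.
Proof. by case: XL => _ _ /(_ n A)[]. Qed.

Lemma chain_drop m n t : drop m (X (n + m) t) = X n t.
Proof.
elim: m n => [|m IH] n; first by rewrite drop0 addn0.
rewrite -[m.+1]addn1 -drop_drop addnA addn1.
by case: XL => _ -> _.
Qed.

Lemma chain_event n (A : pred (seq Z)) (b : R) :
  cexp k n (fun h => (A h)%:R) [::] <= b -> (P [set t | A (X n t)] <= b%:E)%E.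
Proof. by rewrite chain_prob lee_fin. Qed.

(** A conditional probability bound without conditioning: both events are read off the longer
    history, the earlier one through [drop r], and the bound for the chain restarted at each history
    of length [n] is summed. *)
Lemma chain_cond_le n r (A Q : pred (seq Z)) (rho : R) :
  (forall h, size h = n -> A h -> cexp k r (fun x => (Q x)%:R) h <= rho) ->
  (P [set t | A (X n t) && Q (X (n + r) t)] <= rho%:E * P [set t | A (X n t)])%E.
Proof.
move=> H.
pose B h := A (drop r h) && Q h.
have -> : [set t | A (X n t) && Q (X (n + r) t)] = [set t | B (X (n + r) t)].
  by apply/seteqP; split=> t; rewrite /B /= chain_drop.
rewrite !chain_prob -EFinM lee_fin cexp_add -cexpZ //.
apply: (cexp_le kS) => h hn; rewrite cats0 /B.
have [Ah|nA] := boolP (A h).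
  rewrite mulr1; apply: le_trans (H h hn Ah); apply: (cexp_le kS) => l lr.
  by rewrite ler_nat; case: (Q _); rewrite ?andbT ?andbF // leq_b1.
rewrite mulr0 -[leRHS](cexp_cst kS r 0 h); apply: (cexp_le kS) => l lr.
by rewrite drop_size_cat // (negbTE nA).
Qed.

(** A product bound for dependent blocks: the bounds [rho i] hold after any past, so they multiply
    as if the blocks were independent. *)
Lemma chain_all_le (tau : nat -> nat) (Q : nat -> pred (seq Z)) (rho : nat -> R) n :
  (forall i, (tau i <= tau i.+1)%N) -> (forall i, 0 <= rho i) ->
  (forall i h, size h = tau i -> cexp k (tau i.+1 - tau i) (fun x => (Q i x)%:R) h <= rho i) ->
  (P [set t | all (fun i => Q i (X (tau i.+1) t)) (iota 0 n)] <= (\prod_(0 <= i < n) rho i)%:E)%E.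
Proof.
move=> tauS rho0 H.
have [A AE] : exists A : nat -> pred (seq Z), forall m t,
    all (fun i => Q i (X (tau i.+1) t)) (iota 0 m) = A m (X (tau m) t).
  (* [chain_cond_le] needs a predicate of a single history, so the conjunction over the blocks is
     rebuilt by dropping back to the earlier times. *)
  pose A := fix A m h := if m is m'.+1 then
    A m' (drop (tau m - tau m') h) && Q m' h else true.
  exists A; elim=> [//|m IH] t; rewrite -addn1 iotaD all_cat IH addn1 /= andbT add0n.
  by rewrite -{3}(subnKC (tauS m)) chain_drop.
have iotaS m : iota 0 m.+1 = iota 0 m ++ [:: m] by rewrite -addn1 iotaD.
elim: n => [|n IH].
  rewrite big_geq // (_ : [set t | _] = setT) ?probability_setT //.
  by apply/seteqP; split.
rewrite big_nat_recr //= EFinM.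
have -> : [set t | all (fun i => Q i (X (tau i.+1) t)) (iota 0 n.+1)] =
    [set t | A n (X (tau n) t) && Q n (X (tau n + (tau n.+1 - tau n)) t)].
  by apply: eq_set => t; rewrite iotaS all_cat AE /= andbT subnKC.
apply: le_trans (chain_cond_le (rho := rho n) _) _; first by move=> h hn _; exact: H.
rewrite muleC; apply: lee_wpmul2r; first by rewrite lee_fin.
by apply: le_trans IH; rewrite le_eqVlt; apply/orP; left; apply/eqP; congr (P _);
   apply/seteqP; split=> t /=; rewrite AE.
Qed.

Lemma chain_passes_le (w : nat -> R) xi M mu (c l x C1 : R) r : (forall j, 0 <= w j) ->
  increments w xi M -> laplace_ub k xi c mu -> 0 <= c -> 0 <= l -> (forall z, M [:: z] <= C1) ->
  (forall j, (0 < j <= r)%N -> l * w j <= mu) ->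
  (P [set t | passes M r x (X r.+1 t)] <= (expR (l * (C1 - x) + c * l ^+ 2 * clock w r.+1))%:E)%E.
Proof.
move=> w0 MS ub c0 l0 MC lw; apply: chain_event; rewrite /=.
set b := expR _; rewrite -[leRHS](cexp_cst kS 1 b [::]) /=.
apply: ler_sum => z _; apply: ler_wpM2l; first exact: kS.1.
apply: le_trans (cexp_passes_le kS w0 MS x ub c0 l0 _ _) _ => //=.
rewrite ler_expR lerD // ?ler_wpM2l ?lerB // ?add1n.
  by rewrite mulr_ge0 // sqr_ge0.
by rewrite lerBlDr lerDl sumr_ge0 // => i _; rewrite sqr_ge0.
Qed.

Lemma passes_chain (M : seq Z -> R) r (x : R) n t : (0 < n <= r.+1)%N -> x <= M (X n t) ->
  passes M r x (X r.+1 t) = true.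
Proof.
move=> nr xM; apply/hasP; exists (r.+1 - n)%N; first by rewrite mem_iota; lia.
rewrite (_ : drop _ _ = X n t) //.
by rewrite -[in X r.+1](subnKC (_ : n <= r.+1)%N) ?chain_drop //; lia.
Qed.

End ChainLaw.

(** * Borel-Cantelli and estimates for logarithms *)

Lemma borel_cantelli_bounded (R : realType) (d : measure_display) (T : measurableType d)
    (P : probability T R) (F : nat -> set T) (C : R) : (forall n, measurable (F n)) ->
  (forall n, (\sum_(0 <= i < n) P (F i) <= C%:E)%E) ->
  {ae P, forall t, \forall n \near \oo, ~ F n t}.
Proof.
move=> mF FC.
have F0 : P (lim_sup_set F) = 0%E.
  apply: lim_sup_set_cvg0 => //; apply: (@le_lt_trans _ _ C%:E); last exact: ltry.
  by apply: lime_le; [exact: is_cvg_nneseries|exact: nearW].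
exists (lim_sup_set F); split => //.
  by apply: bigcap_measurable => // n _; apply: bigcup_measurable.
move=> t /= nt m _.
apply: contrapT => H; apply: nt; exists m => // n /= mn Fn; apply: H.
by exists n.
Qed.

Lemma invr_le_lnB (R : realType) n : n.+2%:R^-1 <= ln n.+2%:R - ln n.+1%:R :> R.
Proof.
have n2 : 0 < n.+2%:R :> R by [].
have n1 : 0 < n.+1%:R :> R by [].
have := @le_ln1Dx R (- n.+2%:R^-1).
have -> : 1 + - n.+2%:R^-1 = n.+1%:R / n.+2%:R :> R.
  by rewrite -[n.+2%:R]natr1; move: (n.+1%:R) n1 => a a0; field; lra.
rewrite ltrN2 invf_lt1 // ltr1n => /(_ isT).
by rewrite ln_div ?posrE // => h; rewrite -[leRHS]opprB lerNr.
Qed.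

(** The summands are i^(-1-e). They are dominated by a telescoping sum, since e (n+2)^(-1-e) <=
    (n+1)^(-e) - (n+2)^(-e) by exp(x) >= 1 + x. *)
Lemma sum_expR_ln_le (R : realType) (e : R) n : 0 < e ->
  \sum_(2 <= i < n.+2) expR (- ((1 + e) * ln i%:R)) <= e^-1 :> R.
Proof.
move=> e0.
suff : \sum_(2 <= i < n.+2) expR (- ((1 + e) * ln i%:R)) <= e^-1 * (1 - expR (- (e * ln n.+1%:R))) :> R.
  move=> /le_trans; apply; rewrite -[leRHS]mulr1 ler_wpM2l ?invr_ge0 ?(ltW e0) //.
elim: n => [|n IH]; first by rewrite big_geq // ln1 mulr0 oppr0 expR0 subrr mulr0.
rewrite big_nat_recr //=; apply: le_trans (lerD IH (lexx _)) _.
set u := expR (- (e * ln n.+1%:R)); set v := expR (- (e * ln n.+2%:R)).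
set q := expR (- ((1 + e) * ln n.+2%:R)).
suff : q * e <= u - v.
  have ei : 0 <= e^-1 by rewrite invr_ge0 ltW.
  move=> /(ler_wpM2l ei); have -> : e^-1 * (q * e) = q by field; rewrite gt_eqF.
  lra.
have n2 : 0 < n.+2%:R :> R by [].
have -> : q = v / n.+2%:R.
  by rewrite /q mulrDl mul1r opprD expRD mulrC (expRN (ln _)) lnK ?posrE.
have lnE := invr_le_lnB R n.
have -> : u = v * expR (e * (ln n.+2%:R - ln n.+1%:R)).
  by rewrite -expRD; congr expR; ring.
have := expR_ge1Dx (e * (ln n.+2%:R - ln n.+1%:R) : R).
have := ler_wpM2l (ltW e0) lnE; have v0 : 0 <= v by exact: expR_ge0.
move=> h1 h2.
have := ler_wpM2l v0 (le_trans (lerD (lexx 1) h1) h2).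
move: (expR _) (n.+2%:R^-1) => E c; lra.
Qed.

(** A constant factor adds at most |ln C| to the logarithm, which is below e ln x once x >= exp(|ln
    C| / e). This allows the index of a geometric block to be exchanged with the logarithm of the
    clock under one further logarithm. *)
Lemma ln_le_scaled (R : realType) (C e : R) : 0 < e -> exists L : R, forall x y,
  L <= x -> 0 < y -> y <= C * x -> ln y <= (1 + e) * ln x.
Proof.
move=> e0; exists (expR (`|ln C| / e)) => x y Lx y0 yx.
have x0 : 0 < x by apply: lt_le_trans Lx; exact: expR_gt0.
have C0 : 0 < C by rewrite -(pmulr_lgt0 _ x0) (lt_le_trans y0).
have : ln y <= ln C + ln x.
  by rewrite -lnM ?posrE // ler_ln ?posrE // mulr_gt0.
have : `|ln C| / e <= ln x by rewrite -ler_expR lnK ?posrE.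
by rewrite ler_pdivrMr // => h1 h2; have := ler_norm (ln C); lra.
Qed.

Lemma sum_shift_le (R : realType) (u : nat -> R) n K : (forall i, 0 <= u i) -> (2 <= K)%N ->
  \sum_(0 <= i < n) u (i + K)%N <= \sum_(2 <= i < (n + K).+2) u i.
Proof.
move=> u0 K2.
have -> : \sum_(0 <= i < n) u (i + K)%N = \sum_(K <= i < n + K) u i.
  by rewrite -[X in \sum_(X <= _ < n + K) _]add0n big_addn addnK.
rewrite [leRHS](@big_cat_nat _ _ _ K) //=; last by lia.
rewrite [X in _ + X](@big_cat_nat _ _ _ (n + K)) //=; [|lia|lia].
by rewrite addrCA lerDl addr_ge0 // sumr_ge0.
Qed.

(** * The law of the iterated logarithm for chains *)

Section Clock.
Variables (R : realType) (w : nat -> R).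
Hypothesis w_infty : forall A, exists n, A < clock w n.

Lemma clock_near A : \forall n \near \oo, A < clock w n.
Proof.
have [m Am] := w_infty A; exists m => // n /= mn.
by apply: lt_le_trans Am _; exact: clock_le.
Qed.

Lemma clock_horizon y : 0 <= y -> exists N, forall n, (clock w n <= y) = (n <= N)%N.
Proof.
move=> y0; have H : exists n, y < clock w n by [].
case: (ex_minnP H) => -[|m]; first by rewrite /clock big_geq // ltNge y0.
move=> ym mmin; exists m => n; rewrite leqNgt; apply/idP/negP.
  move=> ny mn; have := le_trans (clock_le w mn) ny; by rewrite leNgt ym.
by move=> /negP; rewrite leNgt; apply: contra => /mmin.
Qed.

Hypothesis w0 : forall j, 0 <= w j.
Variable C : R.
Hypothesis wC : forall j, w j ^+ 6 <= C * clock w j.+1 ^+ 2.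

Lemma ln_natr_le (n : nat) : ln n%:R <= n%:R :> R.
Proof.
case: n => [|n]; first by rewrite ln0.
by rewrite ltW // ln_sublinear.
Qed.

Lemma ln_natr_ge0 (n : nat) : 0 <= ln n%:R :> R.
Proof. by case: n => [|n]; [rewrite ln0|rewrite ln_ge0 // ler1n]. Qed.

(** Kolmogorov's smallness condition on the steps, at the geometric level E = exp(a k), where ln k
    plays the part of ln ln E: w^6 <= C E^2 makes w^2 at most of order E^(2/3), and E^(1/3) beats ln
    k. *)
Lemma ln_sqr_step_le (a del : R) : 0 < a -> 0 < del -> exists K : nat, forall k j,
  (K <= k)%N -> clock w j.+1 <= expR (a * k%:R) ->
  ln k%:R * w j ^+ 2 <= del * expR (a * k%:R).
Proof.
move=> a0 del0.
have C0 : 0 <= C.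
  have [[|n] cn] := w_infty 0; first by rewrite /clock big_geq // ltxx in cn.
  rewrite -(@pmulr_lge0 _ (clock w n.+1 ^+ 2)) ?exprn_gt0 //.
  by apply: le_trans (wC n); rewrite exprn_ge0.
(* After cubing, with (ln k)^3 <= k^3 and w^6 <= C E^2, it suffices that C k^3 <= del^3 E; the bound
   E >= (a k)^4 / 24 gives this threshold. *)
exists (Num.truncn (24 * C / (del ^+ 3 * a ^+ 4))).+1 => k j Kk jE.
set E := expR _ in jE *.
have E0 : 0 < E by exact: expR_gt0.
have k0 : 0 <= k%:R :> R by [].
have kC : C * k%:R ^+ 3 <= del ^+ 3 * E.
  have h : 24 * C / (del ^+ 3 * a ^+ 4) <= k%:R.
    apply: le_trans (ltW (truncnS_gt _)) _; by rewrite ler_nat.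
  rewrite ler_pdivrMr in h; last by rewrite mulr_gt0 // exprn_gt0.
  have h4 := @expR_ge1Dxn R (a * k%:R) 3 (mulr_ge0 (ltW a0) k0).
  have {}h4 : (a * k%:R) ^+ 4 / 24 <= E by apply: le_trans h4; rewrite lerDr.
  have d3 : 0 <= del ^+ 3 by rewrite exprn_ge0 // ltW.
  have k3 : 0 <= k%:R ^+ 3 :> R by rewrite exprn_ge0.
  have := ler_wpM2l d3 h4; have := ler_wpM2r k3 h.
  rewrite exprMn; lra.
have l0 : 0 <= ln k%:R :> R by exact: ln_natr_ge0.
have w20 : 0 <= w j ^+ 2 by rewrite sqr_ge0.
rewrite -(@ler_pXn2r _ 3) // ?nnegrE ?mulr_ge0 ?(ltW E0) ?(ltW del0) //.
rewrite (exprMn 3 (ln _) (w j ^+ 2)) (exprMn 3 del E).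
have c2 : clock w j.+1 ^+ 2 <= E ^+ 2.
  by rewrite lerXn2r ?nnegrE ?(ltW E0) // sumr_ge0 // => i _; rewrite sqr_ge0.
have h6 : (w j ^+ 2) ^+ 3 <= C * E ^+ 2.
  by rewrite -exprM; apply: le_trans (wC j) _; rewrite ler_wpM2l.
have l3 : ln k%:R ^+ 3 <= k%:R ^+ 3 :> R by rewrite lerXn2r ?nnegrE // ln_natr_le.
apply: le_trans (ler_pM _ _ l3 h6) _; rewrite ?exprn_ge0 //.
have -> : k%:R ^+ 3 * (C * E ^+ 2) = C * k%:R ^+ 3 * E ^+ 2 by ring.
have -> : del ^+ 3 * E ^+ 3 = del ^+ 3 * E * E ^+ 2 by ring.
by rewrite ler_wpM2r // exprn_ge0 // ltW.
Qed.

End Clock.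

(** * Upper half of the law *)

Section UpperLIL.
Variables (R : realType) (Z : finType) (k : seq Z -> Z -> R).
Variables (d : measure_display) (T : measurableType d) (P : probability T R).
Variable (X : nat -> T -> seq Z).
Hypotheses (kS : stochastic k) (XL : chain_law k P X).
Variables (w : nat -> R) (xi : seq Z -> Z -> R) (M : seq Z -> R) (C1 C : R).
Hypotheses (w0 : forall j, 0 <= w j) (w01 : w 0%N = 1) (MS : increments w xi M).
Hypothesis M1 : forall z, M [:: z] <= C1.
Hypothesis ub : forall e : R, 0 < e -> exists2 mu : R, 0 < mu & laplace_ub k xi (1 + e) mu.
Hypothesis w_infty : forall A, exists n, A < clock w n.
Hypothesis wC : forall j, w j ^+ 6 <= C * clock w j.+1 ^+ 2.
Local Notation B := (clock w).

(** The clock is cut at the levels E_i = (1 + e)^i. On each level the maximal inequality at height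
    x_i leaves a probability of order i^(-1-e), which is summable; between two levels the normaliser
    changes only by a factor close to 1. *)
Theorem lil_upper (eps : R) : 0 < eps -> {ae P, forall t, \forall n \near \oo,
  M (X n t) <= (2 + eps) * Num.sqrt (B n * ln (ln (B n)))}.
Proof.
move=> eps0.
(* The loss is 2 (1 + e)^2 <= 2 + 6 e for e <= 1: one factor 1 + e comes from the height, the other
   from comparing the level with the clock. *)
have [e [e0 e1 e6]] : exists e, [/\ 0 < e, e <= 1 & 6 * e <= eps].
  exists (Num.min 1 (eps / 6)); rewrite lt_min ltr01 divr_gt0 // ge_min lexx; split=> //.
  by rewrite mulrC -ler_pdivlMr // ge_min lexx orbT.
have [mu mu0 ubm] := ub e0.
pose a : R := ln (1 + e).
have a0 : 0 < a by rewrite ln_gt0 // ltrDl.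
pose E (i : nat) : R := expR (a * i%:R).
have E0 i : 0 < E i by exact: expR_gt0.
have Emono i j : (i <= j)%N -> E i <= E j.
  by move=> ij; rewrite ler_expR ler_wpM2l ?(ltW a0) // ler_nat.
have [N NP] := choice (fun i => clock_horizon w_infty (ltW (E0 i))).
have N1 i : (0 < N i)%N.
  rewrite -NP /clock big_nat1 w01 expr1n -[leLHS]expR0 ler_expR mulr_ge0 //; exact: ltW.
have [K1 K1P] := ln_sqr_step_le w_infty w0 wC a0 (exprn_gt0 2 mu0).
(* From this index on l <= 1, so the uncentred first step contributes at most the constant factor
   exp |C1|. *)
have [K2 K2P] : exists K2 : nat, forall i, (K2 <= i)%N -> ln i%:R <= E i.
  exists (Num.truncn (2 / a ^+ 2)).+1 => i Ki.
  apply: le_trans (ln_natr_le _ _) _.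
  have h : 2 / a ^+ 2 <= i%:R.
    apply: le_trans (ltW (truncnS_gt _)) _; by rewrite ler_nat.
  rewrite ler_pdivrMr in h; last by rewrite exprn_gt0.
  have i0 : 0 <= i%:R :> R by [].
  have := @expR_ge1Dxn R (a * i%:R) 1 (mulr_ge0 (ltW a0) i0).
  rewrite -/(E i) => h2; have := ler_wpM2r i0 h.
  rewrite (_ : 2`! = 2)%N // in h2; nra.
have [K [Kge2 KK1 KK2]] : exists K, [/\ 2 <= K, K1 <= K & K2 <= K]%N.
  by exists (maxn 2 (maxn K1 K2)); split; lia.
pose x i := 2 * (1 + e) * Num.sqrt (E i * ln i%:R).
(* The minimiser of - l x + (1 + e) l^2 E; the minimum is - (1 + e) ln i. *)
pose l i := Num.sqrt (ln i%:R / E i).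
have lnE0 i : 0 <= ln i%:R / E i by rewrite divr_ge0 ?ln_natr_ge0 // ltW.
have l2E i : l i ^+ 2 * E i = ln i%:R.
  by rewrite sqr_sqrtr // divfK // gt_eqF.
have lxE i : l i * x i = 2 * (1 + e) * ln i%:R.
  rewrite /x mulrCA -sqrtrM //.
  have -> : ln i%:R / E i * (E i * ln i%:R) = ln i%:R ^+ 2 by field; rewrite gt_eqF.
  by rewrite sqrtr_sqr ger0_norm ?ln_natr_ge0.
pose F i := [set t | passes M (N (i + K)%N).-1 (x (i + K)%N) (X (N (i + K)%N).-1.+1 t)].
have PF i : (P (F i) <= (expR `|C1| * expR (- ((1 + e) * ln (i + K)%:R)))%:E)%E.
  rewrite /F; move: (i + K)%N (leq_addl i K) => j Kj.
  apply: le_trans (chain_passes_le (mu := mu) (c := 1 + e) (l := l j) (C1 := C1) kS XL (x j) w0 MS ubm _ _ M1 _) _.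
  - lra.
  - exact: sqrtr_ge0.
  - move=> i0 /andP[_ i0N]; rewrite -ler_sqr ?nnegrE ?mulr_ge0 ?sqrtr_ge0 ?(ltW mu0) //.
    rewrite exprMn sqr_sqrtr // mulrAC ler_pdivrMr //; apply: K1P.
      exact: leq_trans Kj.
    by rewrite -/(E j) NP -(prednK (N1 j)).
  rewrite lee_fin -expRD ler_expR prednK // mulrBr lxE.
  have l1 : l j <= 1.
    rewrite -ler_sqr ?nnegrE ?sqrtr_ge0 // expr1n sqr_sqrtr // ler_pdivrMr // mul1r.
    by apply: K2P; exact: leq_trans Kj.
  have : l j * C1 <= `|C1|.
    apply: le_trans (ler_wpM2l (sqrtr_ge0 _) (ler_norm C1)) _.
    by rewrite ler_piMl.
  have : (1 + e) * l j ^+ 2 * B (N j) <= (1 + e) * ln j%:R.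
    rewrite -mulrA ler_wpM2l // ?addr_ge0 ?(ltW e0) //.
    by rewrite -l2E ler_wpM2l ?sqr_ge0 // NP.
  lra.
have : {ae P, forall t, \forall n \near \oo, ~ F n t}.
  apply: (@borel_cantelli_bounded _ _ _ _ _ (expR `|C1| * e^-1)).
    by move=> n; exact: chain_measurable XL _ _.
  move=> n; apply: le_trans (lee_sum _ (fun i _ => PF i)) _.
  rewrite sumEFin lee_fin -mulr_sumr ler_wpM2l ?expR_ge0 //.
  apply: le_trans (sum_expR_ln_le (n + K)%N e0).
  exact: (@sum_shift_le _ (fun i => expR (- ((1 + e) * ln i%:R)))) (fun=> expR_ge0 _) Kge2.
apply: filterS => t [I _ FI].
(* The first level [j] above the clock satisfies a (j - 1) < ln (B n), hence j <= (1 + 1/a) ln (B n)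
   as soon as ln (B n) >= 1. *)
have [L LP] := ln_le_scaled (1 + a^-1) e0.
near=> n.
have Bn : E (I + K)%N < B n by near: n; exact: clock_near.
have lnB1 : 1 <= ln (B n).
  rewrite -ler_expR lnK ?posrE; last by apply: lt_trans Bn.
  by apply: ltW; near: n; exact: clock_near.
have lnBL : L <= ln (B n).
  rewrite -ler_expR lnK ?posrE; last by apply: lt_trans Bn.
  by apply: ltW; near: n; exact: clock_near.
have B0 : 0 < B n by apply: lt_trans Bn.
have exk : exists j, B n <= E j.
  exists (Num.truncn (B n / a)).+1; apply: le_trans (expR_ge1Dx _).
  have : B n / a <= (Num.truncn (B n / a)).+1%:R by apply: ltW; exact: truncnS_gt.
  rewrite ler_pdivrMr //; lra.
case: (ex_minnP exk) => j jB jmin.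
have jK : (I + K < j)%N.
  by rewrite ltnNge; apply/negP => /Emono; rewrite leNgt (lt_le_trans Bn).
have j1B : E j.-1 < B n.
  by rewrite ltNge; apply/negP => /jmin; rewrite leqNgt prednK ?leqnn // (leq_ltn_trans _ jK).
have jE : j = j.-1.+1 by rewrite prednK // (leq_ltn_trans _ jK).
have Ej : E j <= (1 + e) * B n.
  rewrite jE /E -natr1 mulrDr mulr1 expRD mulrC lnK ?posrE; last by lra.
  by rewrite ler_wpM2l ?ltW //; lra.
have lnj : ln j%:R <= (1 + e) * ln (ln (B n)).
  apply: LP => //; first by rewrite jE.
  have : a * j.-1%:R < ln (B n) by rewrite -ltr_expR lnK.
  rewrite {2}jE -natr1 -ltr_pdivlMl //; lra.
have : M (X n t) < x j.
  rewrite ltNge; apply/negP => xM; apply: (FI (j - K)%N) => /=.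
    by rewrite leq_subRL ?(leq_trans (leq_addl _ _) (ltnW jK)) // addnC ltnW.
  rewrite /F subnK ?(leq_trans (leq_addl _ _) (ltnW jK)) //=.
  apply: (passes_chain XL _ xM); rewrite prednK //.
  rewrite (_ : (n <= N j)%N) ?andbT ?lt0n; last by rewrite -NP.
  apply: contraTneq B0 => ->.
  by rewrite /clock big_geq // ltxx.
move=> /ltW /le_trans; apply.
have LL0 : 0 <= ln (ln (B n)) by rewrite ln_ge0.
apply: (@le_trans _ _ (2 * (1 + e) * ((1 + e) * Num.sqrt (B n * ln (ln (B n)))))).
  rewrite /x ler_wpM2l //; first by lra.
  have -> : (1 + e) * Num.sqrt (B n * ln (ln (B n))) =
      Num.sqrt ((1 + e) * B n * ((1 + e) * ln (ln (B n)))).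
    rewrite (_ : _ * _ * _ = (1 + e) ^+ 2 * (B n * ln (ln (B n)))); last by ring.
    by rewrite [RHS]sqrtrM ?sqr_ge0 // sqrtr_sqr ger0_norm //; lra.
  rewrite ler_sqrt; last by rewrite !mulr_ge0 // ?(ltW B0) //; lra.
  by rewrite ler_pM ?ln_natr_ge0 // ltW.
rewrite mulrA ler_wpM2r ?sqrtr_ge0 //; nra.
Unshelve. all: by end_near. Qed.

End UpperLIL.

Lemma natr_ge_ex (R : realType) (x : R) : exists K : nat, forall i : nat, (K <= i)%N -> x <= i%:R.
Proof.
exists (Num.truncn x).+1 => i Ki; apply: le_trans (ltW (truncnS_gt _)) _.
by rewrite ler_nat.
Qed.

Lemma negligible_small (R : realType) (d : measure_display) (T : measurableType d)
    (P : probability T R) (A : set T) :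
  (forall e : R, 0 < e -> exists B, [/\ measurable B, A `<=` B & (P B <= e%:E)%E]) ->
  P.-negligible A.
Proof.
move=> H.
have [B BP] := choice (fun n : nat => H n.+1%:R^-1 (ltac:(by rewrite invr_gt0))).
have mB : measurable (\bigcap_n B n) by apply: bigcap_measurable => // n _; case: (BP n).
exists (\bigcap_n B n); split => //; last by move=> t At n _; case: (BP n) => _ /(_ t At).
apply/eqP; rewrite -measure_le0; apply/lee_addgt0Pr => e e0; rewrite add0e.
have [K KP] := natr_ge_ex e^-1.
apply: (@le_trans _ _ (P (B K))).
  by apply: le_measure; rewrite ?inE //; [case: (BP K)|exact: bigcap_inf].
apply: (@le_trans _ _ (K.+1%:R^-1)%:E); first by case: (BP K).
by rewrite lee_fin invf_ple ?posrE //; apply: KP.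
Qed.

(** Each factor is j / (j + 1), so the product telescopes. Its decay to 0 expresses the divergence
    of the harmonic series. *)
Lemma prod_harmonic (R : realType) (K n : nat) : (0 < K)%N ->
  \prod_(0 <= i < n) (1 - (K + i).+1%:R^-1) = K%:R / (K + n)%:R :> R.
Proof.
move=> K0; elim: n => [|n IH]; first by rewrite big_geq // addn0 divff // pnatr_eq0 -lt0n.
rewrite big_nat_recr //= IH addnS.
have : (K + n)%:R != 0 :> R by rewrite pnatr_eq0 -lt0n addn_gt0 K0.
rewrite -[(K + n).+1%:R]natr1; have : 0 <= (K + n)%:R :> R by [].
move: (K + n)%:R => x x0 xn; field; rewrite xn /=; lra.
Qed.

(** * Lower half of the law *)

Section LowerLIL.
Variables (R : realType) (Z : finType) (k : seq Z -> Z -> R).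
Variables (d : measure_display) (T : measurableType d) (P : probability T R).
Variable (X : nat -> T -> seq Z).
Hypotheses (kS : stochastic k) (XL : chain_law k P X).
Variables (w : nat -> R) (xi : seq Z -> Z -> R) (M : seq Z -> R) (C1 C mu : R).
Hypotheses (w0 : forall j, 0 <= w j) (w01 : w 0%N = 1) (MS : increments w xi M).
Hypothesis M1 : forall z, `|M [:: z]| <= C1.
Hypothesis ub : forall e : R, 0 < e -> exists2 mu : R, 0 < mu & laplace_ub k xi (1 + e) mu.
Hypothesis w_infty : forall A, exists n, A < clock w n.
Hypothesis wC : forall j, w j ^+ 6 <= C * clock w j.+1 ^+ 2.
Local Notation B := (clock w).

(** For B >= C / e^3 one has w^6 <= C B^2 <= (e B)^3. Hence the clock at its last index below a high
    level nearly fills that level. *)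
Lemma clock_jump (e : R) : 0 < e -> exists A, forall j, A <= B j.+1 -> w j ^+ 2 <= e * B j.+1.
Proof.
move=> e0; exists (Num.max 1 (C / e ^+ 3)) => j; rewrite ge_max => /andP[B1 BC].
have B0 : 0 < B j.+1 by lra.
rewrite -(@ler_pXn2r _ 3) // ?nnegrE ?sqr_ge0 ?mulr_ge0 ?(ltW B0) ?(ltW e0) //.
rewrite (exprMn 3 e) -exprM; apply: le_trans (wC j) _.
move: BC; rewrite ler_pdivrMr ?exprn_gt0 // => BC.
have := ler_wpM2r (sqr_ge0 (B j.+1)) BC; rewrite [B j.+1 ^+ 3]exprS; lra.
Qed.

(** Consecutive levels have ratio e^(-2), so a block carries clock at least (1 - 2e) E_(i+1). The
    choice l = (1 - e) sqrt(L / v) makes the exponent in the tail bound (1 + e)^2 (1 - e)^2 L <= L =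
    ln(i+1), which is exactly what a divergent harmonic series allows. *)
Lemma lower_block (e : R) : 0 < e -> e <= 8^-1 -> laplace_lb k xi (1 - e ^+ 2 / 8) mu -> 0 < mu ->
  let E (i : nat) := expR (- (2 * ln e) * i%:R) in
  forall N : nat -> nat, (forall i n, (B n <= E i) = (n <= N i)%N) ->
  exists K, forall i h, (K <= i)%N -> size h = N i ->
    cexp k (N i.+1 - N i) (fun x => (2 * (1 - e) ^+ 2 * (1 - 2 * e) *
      Num.sqrt (E i.+1 * ln i.+1%:R) <= M x - M h)%R%:R) h >= i.+1%:R^-1.
Proof.
move=> e0 e8 lb mu0 E N NP.
have [mu' mu'0 ub'] : exists2 mu', 0 < mu' & laplace_ub k xi (1 + e ^+ 2 / 8) mu'.
  by apply: ub; rewrite divr_gt0 // exprn_gt0.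
pose m := Num.min mu mu'.
have m0 : 0 < m by rewrite lt_min mu0.
have a0 : 0 < - (2 * ln e).
  by rewrite oppr_gt0 pmulr_rlt0 //; apply: ln_lt0; apply/andP; split; lra.
have E0 i : 0 < E i by exact: expR_gt0.
have ES i : E i = e ^+ 2 * E i.+1.
  have -> : e ^+ 2 = expR (2 * ln e) by rewrite expRM_natl lnK.
  by rewrite /E -expRD -natr1; congr expR; ring.
have [A AP] := clock_jump e0.
(* The square of 2 l w_j is at most 4 L w_j^2 / v; with L w_j^2 <= (m^2 / 8) E and v >= E / 2 this
   stays below m^2. *)
have [K1 K1P] := ln_sqr_step_le w_infty w0 wC a0 (divr_gt0 (exprn_gt0 2 m0) (ltr0n R 8)).
have [K2 K2P] := natr_ge_ex (expR (8 / e ^+ 2)).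
have [K3 K3P] := natr_ge_ex (A / (- (2 * ln e))).
exists (K1 + K2 + K3)%N => i h Ki hN.
have [Ki1 Ki2 Ki3] : [/\ K1 <= i.+1, K2 <= i.+1 & K3 <= i.+1]%N by clear -Ki; split; lia.
have AE : A <= E i.+1.
  have := K3P _ Ki3; rewrite ler_pdivrMr // mulrC => h3.
  by apply: le_trans h3 (le_trans _ (expR_ge1Dx _)); rewrite lerDr.
set L : R := ln i.+1%:R.
have L8 : 8 / e ^+ 2 <= L by rewrite -ler_expR lnK ?posrE //; exact: K2P.
have e20 : 0 < e ^+ 2 by rewrite exprn_gt0.
have L0 : 0 < L by apply: lt_le_trans L8; rewrite divr_gt0.
have e21 : e ^+ 2 <= e by rewrite expr2 ler_piMl ?(ltW e0) //; lra.
have NE : (N i <= N i.+1)%N.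
  rewrite -NP; apply: (@le_trans _ _ (E i)); first by rewrite NP.
  by rewrite ES ler_piMl ?(ltW (E0 _)) //; lra.
set v := B (N i.+1) - B (N i).
have vE : (1 - 2 * e) * E i.+1 <= v.
  have hE : E i.+1 < B (N i.+1).+1 by rewrite ltNge NP ltnn.
  have := AP (N i.+1) (le_trans AE (ltW hE)).
  have : B (N i) <= E i by rewrite NP.
  have := ler_wpM2r (ltW (E0 i.+1)) e21.
  have : (1 - e) * E i.+1 <= (1 - e) * B (N i.+1).+1 by rewrite ler_wpM2l ?(ltW hE) //; lra.
  rewrite (ES i) /v (clockS w (N i.+1)); lra.
have v0 : 0 < v by apply: lt_le_trans vE; rewrite mulr_gt0 //; lra.
pose l := (1 - e) * Num.sqrt (L / v).
have Lv : 0 <= L / v by rewrite divr_ge0 // ltW.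
have l0 : 0 <= l by rewrite mulr_ge0 ?sqrtr_ge0 //; lra.
have l2v : l ^+ 2 * v = (1 - e) ^+ 2 * L.
  by rewrite exprMn sqr_sqrtr // -mulrA divfK // gt_eqF.
have hN0 : (0 < size h)%N.
  by rewrite hN -NP /clock big_nat1 w01 expr1n -[leLHS]expR0 ler_expR mulr_ge0 // ltW.
have NN : (size h + (N i.+1 - N i))%N = N i.+1 by rewrite hN subnKC.
have := @cexp_tail_ge _ _ _ kS w xi M m w0 MS (N i.+1 - N i) l e h e0 _ l0 _ _ hN0.
rewrite /= NN hN -/v l2v => H.
have {}H := H ltac:(lra).
have lvE : l * v = (1 - e) * Num.sqrt (L * v).
  rewrite -mulrA; congr (_ * _); rewrite -{2}(ger0_norm (ltW v0)) -sqrtr_sqr -sqrtrM //.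
  by congr Num.sqrt; field; rewrite gt_eqF.
have thr : 2 * (1 - e) ^+ 2 * (1 - 2 * e) * Num.sqrt (E i.+1 * L) <= 2 * (1 - e) * l * v.
  have -> : 2 * (1 - e) * l * v = 2 * (1 - e) * (l * v) by ring.
  have -> : 2 * (1 - e) ^+ 2 * (1 - 2 * e) * Num.sqrt (E i.+1 * L) =
    2 * (1 - e) * ((1 - e) * ((1 - 2 * e) * Num.sqrt (E i.+1 * L))) by ring.
  rewrite lvE ler_wpM2l //; first by lra.
  rewrite ler_wpM2l //; first by lra.
  have -> : (1 - 2 * e) * Num.sqrt (E i.+1 * L) = Num.sqrt ((1 - 2 * e) ^+ 2 * (E i.+1 * L)).
    by rewrite [RHS]sqrtrM ?sqr_ge0 // sqrtr_sqr ger0_norm //; lra.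
  rewrite ler_sqrt ?mulr_ge0 ?(ltW v0) ?(ltW L0) //.
  rewrite [leRHS]mulrC mulrA ler_wpM2r ?(ltW L0) //; apply: le_trans vE.
  rewrite expr2 -mulrA ler_piMl //; last by lra.
  by rewrite mulr_ge0 ?(ltW (E0 _)) //; lra.
have four : 4 <= e ^+ 2 * ((1 - e) ^+ 2 * L).
  have h8 : 8 <= L * e ^+ 2 by rewrite -ler_pdivrMr.
  have h2 : 2^-1 <= (1 - e) ^+ 2 by nra.
  have Le : 0 <= L * e ^+ 2 by rewrite mulr_ge0 ?(ltW L0) ?(ltW e20).
  by have := ler_wpM2l Le h2; lra.
have {}H : expR (- ((1 + e) ^+ 2 * ((1 - e) ^+ 2 * L))) <=
    cexp k (N i.+1 - N i) (fun x => (2 * (1 - e) * l * v <= M x - M h)%R%:R) h.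
  apply: H => //.
  - by move=> h' l' h0' lm; apply: ub' => //; apply: le_trans lm _; rewrite ge_min lexx orbT.
  - by move=> h' l' h0' lm; apply: lb => //; apply: le_trans lm _; rewrite ge_min lexx.
  - move=> j /andP[_ jN].
    have lw0 : 0 <= 2 * l * w j := mulr_ge0 (mulr_ge0 (ler0n R 2) l0) (w0 j).
    rewrite -(ler_sqr lw0 (ltW m0)).
    have hj : B j.+1 <= E i.+1 by rewrite NP.
    have := K1P i.+1 j Ki1 hj; rewrite -/L -/(E _) => h1.
    have -> : (2 * l * w j) ^+ 2 = 4 * (1 - e) ^+ 2 * (L * w j ^+ 2) / v.
      by rewrite !exprMn sqr_sqrtr //; field; rewrite gt_eqF.
    rewrite ler_pdivrMr //; have m20 := sqr_ge0 m.
    have : (1 - e) ^+ 2 <= 1 by rewrite expr_le1 //; lra.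
    have : m ^+ 2 * ((1 - 2 * e) * E i.+1) <= m ^+ 2 * v by rewrite ler_wpM2l.
    have Lw : 0 <= L * w j ^+ 2 by rewrite mulr_ge0 ?sqr_ge0 // ltW.
    have mE : 0 <= m ^+ 2 * E i.+1 by rewrite mulr_ge0 // ltW.
    have : m ^+ 2 * E i.+1 * e <= m ^+ 2 * E i.+1 * 8^-1 by rewrite ler_wpM2l.
    move=> h2 h3 h4; have := ler_wpM2r Lw h4; lra.
apply: (@le_trans _ _ (expR (- L))); first by rewrite expRN lnK ?posrE.
apply: (@le_trans _ _ (expR (- ((1 + e) ^+ 2 * ((1 - e) ^+ 2 * L))))).
  rewrite ler_expR lerN2 mulrA ler_piMl ?(ltW L0) // -exprMn expr_le1 //; nra.
apply: le_trans H _; apply: (cexp_le kS) => y _; rewrite ler_nat.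
by case: (leP _ (M (y ++ h) - M h)) => // h1; rewrite (le_trans thr h1).
Qed.

(** After any past, block [i] has a large increment with probability at least 1/(i+1), so almost
    surely infinitely many blocks have one. The value at the start of such a block could spoil it;
    the upper law for -M bounds the damage, the clock there being only e^2 times the level. *)
Theorem lil_lower (e : R) : 0 < e -> e <= 8^-1 -> laplace_lb k xi (1 - e ^+ 2 / 8) mu -> 0 < mu ->
  {ae P, forall t, forall n0, exists2 n, (n0 <= n)%N &
    (2 - 16 * e) * Num.sqrt (B n * ln (ln (B n))) <= M (X n t)}.
Proof.
move=> e0 e8 lb mu0.
pose a : R := - (2 * ln e); pose E (i : nat) := expR (a * i%:R).
have a0 : 0 < a.
  by rewrite /a oppr_gt0 pmulr_rlt0 //; apply: ln_lt0; apply/andP; split; lra.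
have E0 i : 0 < E i by exact: expR_gt0.
have ES i : E i = e ^+ 2 * E i.+1.
  have -> : e ^+ 2 = expR (2 * ln e) by rewrite expRM_natl lnK.
  by rewrite /E -expRD -natr1; congr expR; rewrite /a; ring.
have [N NP] := choice (fun i => clock_horizon w_infty (ltW (E0 i))).
have NS i : (N i <= N i.+1)%N.
  rewrite -NP; apply: (@le_trans _ _ (E i)); first by rewrite NP.
  rewrite ler_expR ler_wpM2l ?(ltW a0) // ler_nat; exact: leqnSn.
have [K KP] := lower_block e0 e8 lb mu0 NP.
pose x (i : nat) : R := 2 * (1 - e) ^+ 2 * (1 - 2 * e) * Num.sqrt (E i.+1 * ln i.+1%:R).
have esc : {ae P, forall t, forall K0, exists i, (K + K0 <= i)%N /\ x i <= M (X (N i.+1) t) - M (X (N i) t)}.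
  apply: ae_foralln => K0; apply: negligible_small => eps eps0.
  pose K' := (K + K0).+1.
  pose Q i := [pred y : seq Z | M y - M (drop (N (K' + i).+1 - N (K' + i)) y) < x (K' + i)%N].
  have [n nP] := natr_ge_ex (K'%:R / eps).
  exists [set t | all (fun i => Q i (X (N (K' + i.+1)%N) t)) (iota 0 n)]; split.
  - elim: (iota 0 n) => [|j s IH] /=.
      by rewrite (_ : [set t | _] = setT) //; apply/seteqP; split.
    rewrite (_ : [set t | _] = [set t | Q j (X (N (K' + j.+1)%N) t)] `&`
      [set t | all (fun i => Q i (X (N (K' + i.+1)%N) t)) s]).
      by apply: measurableI => //; exact: chain_measurable XL _ _.
    by apply/seteqP; split=> t /= => [/andP[]|[-> ->]].
  - move=> t /= /forallNP nt; apply/allP => i _ /=.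
    have XE : X (N (K' + i).+1) t = X (N (K' + i) + (N (K' + i).+1 - N (K' + i)))%N t.
      by rewrite subnKC.
    have dropE : drop (N (K' + i).+1 - N (K' + i)) (X (N (K' + i).+1) t) = X (N (K' + i)) t.
      by rewrite XE (chain_drop XL).
    rewrite addnS dropE ltNge; apply/negP => h.
    by apply: (nt (K' + i)%N); split => //; rewrite /K'; clear; lia.
  - have := @chain_all_le _ _ _ _ _ _ _ kS XL (fun i => N (K' + i)%N) Q
      (fun i => 1 - (K' + i).+1%:R^-1) n.
    move=> H; apply: le_trans (H _ _ _) _.
    + by move=> i; rewrite addnS.
    + by move=> i; rewrite subr_ge0 invf_le1 // ler1n.
    + move=> i h hN; rewrite addnS.
      have KK : (K <= K' + i)%N by rewrite /K'; clear; lia.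
      have := KP (K' + i)%N h KK hN; rewrite -/(E _) -/(x _) => h1.
      rewrite lerBrDr; apply: le_trans (lerD (lexx _) h1) _.
      rewrite -cexpD -[leRHS](cexp_cst kS (N (K' + i).+1 - N (K' + i)) 1 h).
      apply: (cexp_le kS) => y yr; rewrite /Q /= -yr drop_size_cat //.
      by case: leP => _; rewrite ?addr0 ?add0r.
    rewrite prod_harmonic // lee_fin ler_pdivrMr ?ltr0n //.
    have := nP n (leqnn _); rewrite ler_pdivrMr // => h1.
    by apply: le_trans h1 _; rewrite mulrC ler_wpM2l ?(ltW eps0) // ler_nat leq_addl.
have MSN := incrementsN MS.
have ubN e' : 0 < e' -> exists2 mu, 0 < mu & laplace_ub k (fun h z => - xi h z) (1 + e') mu.
  by move=> /ub[m m0 um]; exists m => //; exact: laplace_ubN.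
have M1N z : - M [:: z] <= C1 by apply: le_trans (M1 z); rewrite -normrN ler_norm.
move: esc (lil_upper kS XL w0 w01 MSN M1N ubN w_infty wC ltr01).
apply: filterS2 => t esc [n1 _ up] n0.
have [L LP] := ln_le_scaled a e0.
have [K2 K2P] := natr_ge_ex L.
have [K3 K3P] := natr_ge_ex (B (n0 + n1) / a).
have [i [iK xi_le]] := esc (K2 + K3)%N.
have [iK2 iK3] : (K2 <= i.+1)%N /\ (K3 <= i)%N by clear -iK; lia.
have Ni : (n0 + n1 <= N i)%N.
  rewrite -NP; have := K3P _ iK3; rewrite ler_pdivrMr // mulrC => h3.
  by apply: le_trans h3 (le_trans _ (expR_ge1Dx _)); rewrite lerDr.
exists (N i.+1); first by apply: leq_trans (NS i); apply: leq_trans Ni; exact: leq_addr.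
have lnln n : B n <= E i.+1 -> ln (ln (B n)) <= (1 + e) * ln i.+1%:R.
  move=> BE; have [lB|lB] := ltP 0 (ln (B n)); last first.
    by rewrite (ln0 lB) mulr_ge0 ?ln_natr_ge0 //; lra.
  apply: LP => //; first exact: K2P.
  rewrite -ler_expR lnK //; apply: contraTT lB => /negP; rewrite posrE -leNgt => /negP.
  rewrite -leNgt => B0; by rewrite (ln0 B0) lexx.
set S := Num.sqrt (E i.+1 * ln i.+1%:R).
have EL0 : 0 <= E i.+1 * ln i.+1%:R by rewrite mulr_ge0 ?ln_natr_ge0 // ltW.
have S0 : 0 <= S by exact: sqrtr_ge0.
(* Used with f = 1 at the end of the block and f = e at its start. The start costs at most 3 e (1 +
   e) [S], the 3 being 2 + eps in the upper law with eps = 1, and the total loss fits into 16 e. *)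
have sq f n : 0 <= f -> f <= 1 -> B n <= f ^+ 2 * E i.+1 ->
    Num.sqrt (B n * ln (ln (B n))) <= f * (1 + e) * S.
  move=> f0 f1 Bf.
  have Bn0 : 0 <= B n by rewrite sumr_ge0 // => j _; rewrite sqr_ge0.
  have BE : B n <= E i.+1.
    by apply: le_trans Bf _; rewrite ler_piMl ?(ltW (E0 _)) // expr_le1.
  have fe : 0 <= f * (1 + e) by rewrite mulr_ge0 //; lra.
  rewrite -[X in X * S](ger0_norm fe) -sqrtr_sqr -sqrtrM ?sqr_ge0 //; apply: ler_wsqrtr.
  apply: le_trans (ler_wpM2l Bn0 (lnln n BE)) _.
  have Lk0 : 0 <= (1 + e) * ln i.+1%:R by rewrite mulr_ge0 ?ln_natr_ge0 //; lra.
  apply: le_trans (ler_wpM2r Lk0 Bf) _.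
  have -> : (f * (1 + e)) ^+ 2 * (E i.+1 * ln i.+1%:R) =
    f ^+ 2 * E i.+1 * ((1 + e) * ln i.+1%:R) * (1 + e) by ring.
  rewrite ler_peMr //; last by lra.
  by rewrite !mulr_ge0 ?sqr_ge0 ?ln_natr_ge0 ?(ltW (E0 _)) //; lra.
have h1 : Num.sqrt (B (N i.+1) * ln (ln (B (N i.+1)))) <= 1 * (1 + e) * S.
  by apply: sq => //; rewrite expr1n mul1r NP.
have h2 : Num.sqrt (B (N i) * ln (ln (B (N i)))) <= e * (1 + e) * S.
  by apply: sq; [exact: ltW|lra|rewrite -ES NP].
have h3 := up (N i) (leq_trans (leq_addl _ _) Ni).
have c0 : 0 <= 2 - 16 * e by lra.
apply: le_trans (ler_wpM2l c0 h1) _.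
move: xi_le h3; rewrite /x -/S /=; move: (M (X (N i.+1) t)) (M (X (N i) t)) => m1 m2 h4 h5.
have h6 : m2 >= - 3 * (e * (1 + e) * S) by lra.
have : (2 - 16 * e) * (1 * (1 + e) * S) <= (2 * (1 - e) ^+ 2 * (1 - 2 * e) - 3 * (e * (1 + e))) * S.
  by rewrite mul1r [leLHS]mulrA; apply: ler_wpM2r => //; nra.
lra.
Qed.

End LowerLIL.

Lemma prob_bigcup_le (R : realType) (d : measure_display) (T : measurableType d)
    (P : probability T R) (F : nat -> set T) (b : \bar R) : (forall n, measurable (F n)) ->
  (forall n, F n `<=` F n.+1) -> (forall n, (P (F n) <= b)%E) -> (P (\bigcup_n F n) <= b)%E.
Proof.
move=> mF Fm Fb.
have nd : nondecreasing_seq F.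
  by apply/nondecreasing_seqP => n; exact/subsetPset/Fm.
have h := nondecreasing_cvg_mu (mu := P) mF (bigcupT_measurable _ mF) nd.
rewrite -(cvg_lim _ h) //; apply: lime_le; first by apply/cvg_ex; eexists; exact: h.
exact: nearW.
Qed.

(** * Bounded clock: convergence and a limit without atom at 0 *)

Section BoundedClock.
Variables (R : realType) (Z : finType) (k : seq Z -> Z -> R).
Variables (d : measure_display) (T : measurableType d) (P : probability T R).
Variable (X : nat -> T -> seq Z).
Hypotheses (kS : stochastic k) (XL : chain_law k P X).
Variables (w : nat -> R) (xi : seq Z -> Z -> R) (M : seq Z -> R) (c c' mu S : R).
Hypotheses (w0 : forall j, 0 < w j) (MS : increments w xi M).
Hypotheses (c0 : 0 < c) (c'0 : 0 < c') (mu0 : 0 < mu).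
Hypotheses (ub : laplace_ub k xi c' mu) (lb : laplace_lb k xi c mu).
Local Notation B := (clock w).
Hypothesis BS : forall n, B n <= S.

Let w0' j : 0 <= w j. Proof. exact: ltW. Qed.

Lemma clock_cauchy (del : R) : 0 < del -> exists m0, forall m j, (m0 <= m)%N -> (m <= j)%N ->
  B j - B m <= del.
Proof.
move=> del0.
have nd : nondecreasing_seq B by move=> m n; exact: clock_le.
have cB : cvgn B.
  by apply: nondecreasing_is_cvgn => //; exists S => _ [n _ <-].
have /cvgrPdist_lt/(_ _ del0)[m0 _ H] := cB.
exists m0 => m j m0m mj.
have h1 := nondecreasing_cvgn_le nd cB j.
have := H m m0m; rewrite /= => /(le_lt_trans (ler_norm _)); lra.
Qed.

Lemma oscillation (x eta : R) : 0 < x -> 0 < eta -> exists m0, forall m, (m0 <= m)%N ->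
  exists D, [/\ measurable D, (P D <= eta%:E)%E &
    forall t, ~ D t -> forall j, (m <= j)%N -> `|M (X j t) - M (X m t)| <= x].
Proof.
move=> x0 eta0.
(* Once at most 1 / l^2 of the clock is left, the maximal inequality gives exp(c' - l x) = exp(-
   |ln(eta/2)|) <= eta / 2. The index [m1] secures this remainder, [m2] the condition l w_j <=
   mu. *)
pose l := (c' + `|ln (eta / 2)|) / x.
have l0 : 0 < l by rewrite divr_gt0 // ltr_wpDr.
have [m1 m1P] := clock_cauchy (divr_gt0 ltr01 (exprn_gt0 2 l0)).
have [m2 m2P] := clock_cauchy (exprn_gt0 2 (divr_gt0 mu0 l0)).
exists (m1 + m2).+1 => m mm.
have m1m : (m1 <= m)%N by clear -mm; lia.
have m2m : (m2 <= m)%N by clear -mm; lia.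
have m0 : (0 < m)%N by clear -mm; lia.
have side xi' M' : increments w xi' M' -> laplace_ub k xi' c' mu ->
    exists D, [/\ measurable D, (P D <= (eta / 2)%:E)%E &
    forall t, ~ D t -> forall j, (m <= j)%N -> M' (X j t) - M' (X m t) <= x].
  move=> MS' ub'.
  pose Q r y := has (fun j => M' (drop r y) + x <= M' (drop j y)) (iota 0 r.+1).
  pose F r := [set t | Q r (X (m + r)%N t)].
  exists (\bigcup_r F r); split.
  - by apply: bigcupT_measurable => r; exact: chain_measurable XL _ _.
  - apply: prob_bigcup_le.
    + by move=> r; exact: chain_measurable XL _ _.
    + move=> r t /hasP[j]; rewrite mem_iota => /andP[_]; rewrite -[(0 + r.+1)%N]/(r.+1) ltnS => jr.
      rewrite (chain_drop XL) => h; apply/hasP; exists j.+1; first by rewrite mem_iota; clear -jr; lia.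
      rewrite (chain_drop XL); apply: le_trans h _.
      rewrite addnS -(addn1 j) -drop_drop.
      by case: XL => _ dropX _; rewrite dropX.
    + move=> r.
      have -> : F r = [set t | predT (X m t) && Q r (X (m + r)%N t)] by [].
      apply: le_trans (chain_cond_le kS XL (rho := eta / 2) _) _; last first.
        rewrite -[leRHS]mule1; apply: lee_wpmul2l; first by rewrite lee_fin divr_ge0 // ltW.
        by apply: probability_le1; exact: chain_measurable XL _ _.
      move=> h hm _.
      rewrite (eq_cexp kS (G := fun y => (passes M' r (M' h + x) y)%:R)); last first.
        by move=> y yr; rewrite /Q /passes drop_size_cat.
      apply: le_trans (cexp_passes_le kS w0' MS' _ ub' (ltW c'0) (ltW l0) _ _) _.
      - by rewrite hm.
      - move=> j /andP[mj _]; rewrite -ler_pdivlMl // mulrC.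
        rewrite -(ler_sqr (w0' j) (divr_ge0 (ltW mu0) (ltW l0))).
        have := m2P j j.+1 (leq_trans m2m (leq_trans _ mj)) (leqnSn j).
        by rewrite clockS addrAC subrr add0r; apply; rewrite hm.
      - rewrite hm opprD addNKr.
        have hB := m1P m (m + r)%N m1m (leq_addr _ _).
        rewrite -[leRHS]lnK ?posrE ?divr_gt0 // ler_expR.
        have : c' * l ^+ 2 * (B (m + r) - B m) <= c'.
          rewrite -mulrA ler_piMr ?(ltW c'0) // mulrC -ler_pdivlMr ?exprn_gt0 //.
        have -> : l * - x = - (c' + `|ln (eta / 2)|) by rewrite /l; field; rewrite gt_eqF.
        have := ler_norm (- ln (eta / 2)); rewrite normrN; lra.
  - move=> t nD j mj; rewrite leNgt; apply/negP => h; apply: nD; exists (j - m)%N => //.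
    apply/hasP; exists 0%N => //; rewrite drop0 (chain_drop XL) subnKC //; lra.
have [D1 [mD1 PD1 H1]] := side _ _ MS ub.
have [D2 [mD2 PD2 H2]] := side _ _ (incrementsN MS) (laplace_ubN ub).
exists (D1 `|` D2); split; first exact: measurableU.
  apply: (@le_trans _ _ (P D1 + P D2)%E); first exact: measureU2.
  by apply: le_trans (leeD PD1 PD2) _; rewrite -EFinD lee_fin; lra.
move=> t /not_orP[n1 n2] j mj; rewrite ler_norml.
have := H1 t n1 j mj; have := H2 t n2 j mj; lra.
Qed.

Theorem chain_cvg : {ae P, forall t, cvgn (fun n => M (X n t))}.
Proof.
have H n : {ae P, forall t, exists m, forall j, (m <= j)%N ->
    `|M (X j t) - M (X m t)| <= n.+1%:R^-1}.
  apply: negligible_small => eta eta0.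
  have n0 : 0 < n.+1%:R^-1 :> R by rewrite invr_gt0.
  have [m0 /(_ _ (leqnn _))[D [mD PD HD]]] := oscillation n0 eta0.
  by exists D; split => // t /= nt; apply: contrapT => nDt; apply: nt; exists m0; exact: HD.
apply: filterS (ae_foralln H) => t Ht; apply/cauchy_cvgP/cauchy_exP => e e0.
have [n nP] := natr_ge_ex (e^-1 + 1).
have [m mP] := Ht n; exists (M (X m t)); exists m => // j /= mj.
rewrite /ball /= distrC; apply: le_lt_trans (mP j mj) _.
rewrite invf_plt ?posrE //; have := nP n (leqnn _).
rewrite -natr1; lra.
Qed.

Hypothesis spread : forall del, 0 < del -> exists n0, forall n j, (n0 <= n)%N -> (n <= j)%N ->
  w j ^+ 2 <= del * (B (n + n) - B n).

Let e0 := expR (- (4 * c')) * (expR c - expR (c / 2)) ^+ 2.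

Lemma e0_gt0 : 0 < e0.
Proof.
by rewrite /e0 mulr_gt0 ?expR_gt0 // exprn_gt0 // subr_gt0 ltr_expR ltr_pdivrMr // ltr_pMr // ltr1n.
Qed.

(** With chance at least [e0] the later increments push the martingale away from 0, on the side
    where it already stands, by (c/2) sqrt(u), where [u] is the clock spent. [spread] keeps each
    single increment small at this scale, and u >= v makes [kap] the same for all r >= n. *)
Lemma avoid_zero : exists n0, forall n, (n0 <= n)%N -> exists2 kap : R, 0 < kap &
  forall r h, (n <= r)%N -> size h = n -> cexp k r (fun x => (`|M x| < kap)%R%:R) h <= 1 - e0.
Proof.
have [n0 n0P] := spread (divr_gt0 (exprn_gt0 2 mu0) (ltr0n R 4)).
exists n0.+1 => n nn.
pose v := B (n + n) - B n.
have wv j : (n <= j)%N -> w j ^+ 2 <= mu ^+ 2 / 4 * v.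
  by move=> nj; apply: n0P => //; exact: ltnW.
have v0 : 0 < v.
  rewrite -(pmulr_rgt0 _ (_ : 0 < mu ^+ 2 / 4)) ?divr_gt0 ?exprn_gt0 //.
  by apply: lt_le_trans (wv n (leqnn n)); rewrite exprn_gt0.
exists (c / 2 * Num.sqrt v); first by rewrite !mulr_gt0 ?sqrtr_gt0.
move=> r h nr hn.
have side xi' M' : increments w xi' M' -> laplace_ub k xi' c' mu -> laplace_lb k xi' c mu ->
    0 <= M' h -> (forall x, `|M' x| = `|M x|) ->
    cexp k r (fun x => (`|M x| < c / 2 * Num.sqrt v)%R%:R) h <= 1 - e0.
  move=> MS' ub' lb' Mh MN.
  pose u := B (n + r) - B n.
  have vu : v <= u by rewrite lerD2r clock_le // leq_add2l.
  have u0 : 0 < u by apply: lt_le_trans vu.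
  pose l := (Num.sqrt u)^-1.
  have su0 : 0 < Num.sqrt u by rewrite sqrtr_gt0.
  have l0 : 0 < l by rewrite invr_gt0.
  have := @cexp_anticoncentration _ _ _ kS w xi' M' mu w0' MS' r l c c' h c0 (ltW l0) ub' lb'.
  rewrite hn -/u => H.
  have {}H : e0 <= cexp k r (fun x => (c / 2 <= l * (M' x - M' h))%R%:R) h.
    apply: H; first by apply: leq_ltn_trans nn.
      move=> j /andP[nj _].
      rewrite mulrAC -/l ler_pdivrMr //.
      have lw0 : 0 <= 2 * w j by rewrite mulr_ge0.
      have mu1 : 0 <= mu * Num.sqrt u by rewrite mulr_ge0 ?sqrtr_ge0 // ltW.
      rewrite -(ler_sqr lw0 mu1) !exprMn sqr_sqrtr ?(ltW u0) //.
      have := wv j nj; have := ler_wpM2l (sqr_ge0 mu) vu; lra.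
    by rewrite exprVn sqr_sqrtr ?(ltW u0) // mulVf // gt_eqF.
  rewrite lerBrDr; apply: le_trans (lerD (lexx _) H) _.
  rewrite -cexpD -[leRHS](cexp_cst kS r 1 h); apply: (cexp_le kS) => y _ /=.
  have [h1|h1] := leP (c / 2) (l * (M' (y ++ h) - M' h)); last by rewrite addr0 lern1 leq_b1.
  rewrite (_ : (_ < _)%R = false) ?add0r //; apply/negbTE; rewrite -leNgt -MN.
  move: h1; rewrite [l * _]mulrC /l ler_pdivlMr // => h1.
  have : c / 2 * Num.sqrt v <= c / 2 * Num.sqrt u.
    by rewrite ler_wpM2l ?ler_wsqrtr // divr_ge0 // ltW.
  have := ler_norm (M' (y ++ h)); lra.
have [Mh|Mh] := leP 0 (M h); first exact: (side xi M).
apply: (side (fun h z => - xi h z) (fun h => - M h)).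
- exact: incrementsN.
- exact: laplace_ubN.
- exact: laplace_lbN.
- by rewrite oppr_ge0 ltW.
- by move=> x; rewrite normrN.
Qed.

(* If [M] oscillates little after time [n], the event that [M] is small at time [n] approximates both
   the event [M -> 0] and the event that [M] is eventually small, whereas by [avoid_zero]
   the conditional probability of [M -> 0] given any history is at most [1 - e0]. *)
Theorem chain_limit_neq0 : {ae P, forall t, ~ (M (X n t) @[n --> \oo] --> (0 : R))}.
Proof.
pose small x j := [set t | (`|M (X j t)| <= x)%R].
have msmall x j : measurable (small x j) by exact: (chain_measurable XL j (fun h => `|M h| <= x)).
pose ev x := \bigcup_m \bigcap_(j in [set j | (m <= j)%N]) small x j.
have mev x : measurable (ev x).
  by apply: bigcupT_measurable => m; apply: bigcap_measurableType => // j _.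
pose A := \bigcap_i ev i.+1%:R^-1.
have mA : measurable A by apply: bigcapT_measurable.
pose al := fine (P A).
have PE D : measurable D -> P D = (fine (P D))%:E by move=> mD; rewrite fineK // fin_num_measure.
suff al0 : al <= 0.
  exists A; split => //.
    transitivity (fine (P A))%:E; first exact: PE.
    by congr EFin; apply/le_anti; rewrite al0 fine_ge0.
  move=> t /= /contrapT H i _; have /cvgrPdist_le/(_ i.+1%:R^-1) := H.
  rewrite invr_gt0 ltr0n => /(_ isT)[m _ Hm]; exists m => // j mj.
  by have := Hm j mj; rewrite /= sub0r normrN.
have e00 := e0_gt0.
(* Three errors [e3] occur: [ev] against [A], and the exceptional event [D] in each of the two
   inclusions. They give al <= (1 - e0)(al + 2 e3) + e3, hence e0 al <= 3 e3 = e1. *)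
rewrite -(pmulr_rle0 _ e00); apply/ler_addgt0Pr => e1 e10; rewrite add0r.
pose e3 := e1 / 3.
have e30 : 0 < e3 by rewrite divr_gt0.
have [i Pi] : exists i : nat, fine (P (ev i.+1%:R^-1)) <= al + e3.
  have noninc : nonincreasing_seq (fun i : nat => ev i.+1%:R^-1).
    apply/nonincreasing_seqP => i; apply/subsetPset => t [m _ Hm]; exists m => // j mj.
    apply: le_trans (Hm j mj) _; rewrite lef_pV2 ?posrE // ler_nat; exact: leqnSn.
  have h := nonincreasing_cvg_mu (mu := P) _ (fun i => mev i.+1%:R^-1) mA noninc.
  have {}h : P (ev i.+1%:R^-1) @[i --> \oo] --> al%:E.
    rewrite (_ : al%:E = P A); last by apply/esym; exact: PE.
    by apply: h => //; apply: le_lt_trans (probability_le1 _ _) (ltry _); exact: mev.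
  have {}h : fine (P (ev i.+1%:R^-1)) @[i --> \oo] --> al by exact: fine_cvg h.
  move/cvgrPdist_lt: h => /(_ _ e30)[i _ Hi].
  exists i; have := Hi i (leqnn i); rewrite /= distrC => /(le_lt_trans (ler_norm _)); lra.
(* Half the threshold of [ev]: off [D], convergence to 0 forces |M| <= x at time [n], and |M| <= x
   at time [n] forces |M| <= 2x ever after. *)
pose x := (i.+1%:R^-1 : R) / 2.
have x0 : 0 < x by rewrite divr_gt0 // invr_gt0.
have [m0 m0P] := oscillation (divr_gt0 x0 (ltr0n R 2)) e30.
have [n0 n0P] := avoid_zero.
pose n := (m0 + n0)%N.
have [D [mD PD HD]] := m0P n (leq_addr _ _).
have [kap kap0 kapP] := n0P n (leq_addl _ _).
pose H := small x n.
have mH : measurable H by exact: msmall.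
have AD : A `<=` H `|` D.
  move=> t At; have [Dt|nDt] := pselect (D t); [by right|left].
  have [i' i'P] := natr_ge_ex (x / 2)^-1.
  have [m _ Hm] := At i' I.
  have h1 := HD t nDt (maxn m n) (leq_maxr _ _).
  have h2 : `|M (X (maxn m n) t)| <= i'.+1%:R^-1 := Hm _ (leq_maxl m n).
  have h3 : i'.+1%:R^-1 <= x / 2.
    by rewrite invf_ple ?posrE ?divr_gt0 //; exact: i'P.
  rewrite /H /small /=.
  have := ler_normB (M (X (maxn m n) t)) (M (X (maxn m n) t) - M (X n t)).
  rewrite opprB addrCA subrr addr0 => h4; apply: le_trans h4 _.
  by rewrite [leRHS](splitr x) lerD // (le_trans h2).
have HE : H `<=` ev i.+1%:R^-1 `|` D.
  move=> t Ht; have [Dt|nDt] := pselect (D t); [by right|left].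
  exists n => // j nj; have := HD t nDt j nj; rewrite /small /=.
  have Hx : `|M (X n t)| <= x := Ht.
  have xE : i.+1%:R^-1 = 2 * x by rewrite /x; field.
  rewrite xE; have := ler_normD (M (X j t) - M (X n t)) (M (X n t)).
  rewrite subrK; lra.
have e01 : 0 <= 1 - e0.
  have [t _] : [set: T] !=set0.
    apply/set0P/eqP => T0; have := probability_setT P; rewrite T0 measure0.
    by move=> /eqP; rewrite eqe eq_sym oner_eq0.
  apply: le_trans (kapP n (X n t) (leqnn n) (chain_size XL n t)).
  by apply: (cexp_ge0 kS) => y; exact: ler0n.
have PAH : (P (A `&` H) <= ((1 - e0) * fine (P H))%:E)%E.
  pose G m := H `&` \bigcap_(j in [set j | (m <= j)%N]) [set t | (`|M (X j t)| < kap)%R].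
  have mk j : measurable [set t | (`|M (X j t)| < kap)%R].
    exact: (chain_measurable XL j (fun h => `|M h| < kap)).
  have mG m : measurable (G m).
    by apply: measurableI => //; apply: bigcap_measurableType => // j _; exact: mk.
  apply: (@le_trans _ _ (P (\bigcup_m G m))).
    apply: le_measure; rewrite ?inE //; [exact: measurableI|exact: bigcupT_measurable|].
    move=> t [At Ht]; have [i' i'P] := natr_ge_ex (kap^-1 + 1).
    have [m _ Hm] := At i' I; exists m => //; split=> // j mj /=.
    apply: le_lt_trans (Hm j mj) _; rewrite invf_plt ?posrE //.
    by have := i'P i' (leqnn _); rewrite -natr1; lra.
  apply: prob_bigcup_le => // [m t [Ht Gt]|m].
    by split=> // j mj; apply: Gt => /=; exact: ltnW.
  apply: (@le_trans _ _ (P [set t | (`|M (X n t)| <= x) && (`|M (X (n + (n + m))%N t)| < kap)])).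
    apply: le_measure; rewrite ?inE //.
      rewrite (_ : [set t | _] = H `&` [set t | (`|M (X (n + (n + m))%N t)| < kap)%R]).
        exact: measurableI.
      by apply/seteqP; split=> t /= => [/andP[]|[-> ->]].
    move=> t [/= -> Gt] /=; apply: Gt => /=; clear; lia.
  apply: le_trans (chain_cond_le kS XL (A := fun h => `|M h| <= x)
    (Q := fun h => `|M h| < kap) (rho := 1 - e0) _) _.
    by move=> h hn _; apply: kapP => //; clear; lia.
  rewrite EFinM; apply: lee_wpmul2l; last by rewrite -[X in (X <= _)%E]/(P H) {1}(PE H mH).
  by rewrite lee_fin.
have sub E F : measurable E -> measurable F -> E `<=` F `|` D -> fine (P E) <= fine (P F) + e3.
  move=> mE mF EF; rewrite -lee_fin EFinD -!PE //.
  apply: (@le_trans _ _ (P (F `|` D))).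
    by apply: le_measure; rewrite ?inE //; exact: measurableU.
  by apply: le_trans (measureU2 _ _ _) _ => //; exact: leeD.
have h1 : al <= fine (P (A `&` H)) + e3.
  apply: sub => //; first exact: measurableI.
  by move=> t At; case: (AD t At); [left|right].
have h2 : fine (P H) <= fine (P (ev i.+1%:R^-1)) + e3 by exact: sub.
have h3 : fine (P (A `&` H)) <= (1 - e0) * fine (P H).
  by rewrite -lee_fin -PE //; exact: measurableI.
have h4 : (1 - e0) * fine (P H) <= (1 - e0) * (al + 2 * e3).
  by rewrite ler_wpM2l //; lra.
have h5 : 0 <= e0 * e3 by rewrite mulr_ge0 // ltW.
have e3E : e1 = 3 * e3 by rewrite /e3; field.
rewrite e3E; lra.
Qed.

End BoundedClock.

(** * Asymptotics of the weights *)

Section Weights.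
Variables (R : realType) (q : R).
Hypotheses (q1 : -1 < q) (q2 : q < 1).

(* [growth n] is the factor a_(n+1), so that S_n / growth n.-1 is a martingale. *)
Definition growth (n : nat) : R := \prod_(1 <= i < n.+1) (1 + q / i%:R).
Definition weight (n : nat) : R := (growth n)^-1.
Local Notation B := (clock weight).

Lemma growthS n : growth n.+1 = growth n * (1 + q / n.+1%:R).
Proof. by rewrite /growth big_nat_recr. Qed.

Lemma growth0 : growth 0 = 1. Proof. by rewrite /growth big_geq. Qed.

Lemma weight0 : weight 0 = 1. Proof. by rewrite /weight growth0 invr1. Qed.

Lemma factor_gt0 n : 0 < 1 + q / n.+1%:R.
Proof.
have h : 0 < n.+1%:R :> R by [].
have n1 : 1 <= n.+1%:R :> R by rewrite ler1n.
rewrite -(pmulr_lgt0 _ h) mulrDl mul1r divfK ?gt_eqF //.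
move: (n.+1%:R) n1 => x; have := q1; lra.
Qed.

Lemma growth_gt0 n : 0 < growth n.
Proof.
by elim: n => [|n IH]; rewrite ?growth0 // growthS mulr_gt0 // factor_gt0.
Qed.

Lemma weight_gt0 n : 0 < weight n. Proof. by rewrite invr_gt0 growth_gt0. Qed.

Lemma weightS n : weight n = weight n.+1 * (1 + q / n.+1%:R).
Proof.
by rewrite /weight growthS invfM -mulrA mulVf ?mulr1 // gt_eqF // factor_gt0.
Qed.

(** The variance scale n of a walk, measured on the martingale: with k = n + 1 this is k / a_k^2.
    The ratio of clock to gauge is the squared factor between the two normalisations. *)
Definition gauge n : R := n.+1%:R * weight n ^+ 2.

Lemma gauge_gt0 n : 0 < gauge n.
Proof. by rewrite mulr_gt0 // exprn_gt0 // weight_gt0. Qed.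

Lemma gaugeS n : gauge n.+1 - gauge n = weight n.+1 ^+ 2 * (1 - 2 * q - q ^+ 2 / n.+1%:R).
Proof.
rewrite /gauge (weightS n) -[n.+2%:R]natr1.
have : n.+1%:R != 0 :> R by rewrite pnatr_eq0.
by move: (n.+1%:R) (weight n.+1) => x y x0; field.
Qed.

(** Obtained by summing [gaugeS]. When the clock diverges the last sum is of lower order, so gauge /
    clock tends to 1 - 2q; at q = 1/2 this coefficient vanishes and the clock grows
    logarithmically. *)
Lemma gauge_sum n : gauge n = 2 * q + (1 - 2 * q) * B n.+1
  - q ^+ 2 * \sum_(1 <= j < n.+1) weight j ^+ 2 / j%:R.
Proof.
elim: n => [|n IH].
  by rewrite /gauge [in RHS]big_geq // /clock big_nat1 weight0; ring.
rewrite -[LHS](subrK (gauge n)) gaugeS IH [in RHS]big_nat_recr //= (clockS _ n.+1).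
have : n.+1%:R != 0 :> R by rewrite pnatr_eq0.
by move: (n.+1%:R) => x x0; field.
Qed.

Lemma clock1 n : 1 <= B n.+1.
Proof.
apply: (@le_trans _ _ (B 1)); first by rewrite /clock big_nat1 weight0 expr1n.
exact: clock_le.
Qed.

Lemma weight_sum_ge0 n : 0 <= \sum_(1 <= j < n) weight j ^+ 2 / j%:R.
Proof. by apply: sumr_ge0 => j _; rewrite divr_ge0 // sqr_ge0. Qed.

Lemma gauge_le n : gauge n <= 5 * B n.+1.
Proof.
rewrite gauge_sum; have := clock1 n; have := weight_sum_ge0 n.+1.
move=> /(mulr_ge0 (sqr_ge0 q)); have := q1; have := q2.
by move: (B n.+1) (q ^+ 2 * _) => x y; nra.
Qed.

(** A crude linear bound: 1 + q/k >= (k - 1)/k telescopes from k = 2 on, starting from the value 1 /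
    (1 + q) at index 1. *)
Lemma weight_le n : weight n <= 2 / (1 + q) * n.+1%:R.
Proof.
have q10 : 0 < 1 + q by have := q1; lra.
have K0 : 0 <= 2 / (1 + q) by rewrite divr_ge0 // ltW.
suff H m : weight m.+1 <= 2 / (1 + q) * m.+1%:R.
  case: n => [|n]; last by apply: le_trans (H n) _; rewrite ler_wpM2l // ler_nat.
  by rewrite weight0 mulr1 ler_pdivlMr // mul1r; have := q2; lra.
elim: m => [|m IH].
  have := weightS 0; rewrite weight0 divr1 => e.
  have -> : weight 1 = 1 / (1 + q) by apply: (mulIf (lt0r_neq0 q10)); rewrite -e divfK // gt_eqF.
  by rewrite mulr1 ler_wpM2r ?invr_ge0 ?(ltW q10) // ler1n.
have := weightS m.+1; have w0 := weight_gt0 m.+2.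
have m0 : 0 < m.+1%:R :> R by [].
rewrite -[m.+2%:R]natr1; move: (m.+1%:R) (weight m.+1) (weight m.+2) IH m0 w0 => x y z yx x0 z0 yz.
have x1 : 0 < x + 1 by lra.
have h : z * (x / (x + 1)) <= y.
  rewrite yz ler_wpM2l ?(ltW z0) // ler_pdivrMr // mulrDl divfK ?gt_eqF //; have := q1; lra.
have : z * (x / (x + 1)) <= 2 / (1 + q) * x by apply: le_trans yx.
by rewrite mulrCA mulrC ler_pM2r // ler_pdivrMr.
Qed.

(** Eliminating n between n w^2 <= 5 B and w <= K n: n^2 w^6 is the product of the squares of
    [gauge] and w. This is the origin of the exponent 6 in the step condition of the iterated
    logarithm. *)
Lemma weight6_le n : weight n ^+ 6 <= 25 * (2 / (1 + q)) ^+ 2 * B n.+1 ^+ 2.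
Proof.
have h := gauge_le n; have hw := weight_le n; have w0 := weight_gt0 n.
have n0 : 0 < n.+1%:R :> R by [].
rewrite -(ler_pM2l (exprn_gt0 2 n0)).
have -> : n.+1%:R ^+ 2 * weight n ^+ 6 = gauge n ^+ 2 * weight n ^+ 2 by rewrite /gauge; ring.
have -> : n.+1%:R ^+ 2 * (25 * (2 / (1 + q)) ^+ 2 * B n.+1 ^+ 2) =
   (5 * B n.+1) ^+ 2 * (2 / (1 + q) * n.+1%:R) ^+ 2 by ring.
have g0 := ltW (gauge_gt0 n).
have g5 := le_trans g0 h; have w5 := le_trans (ltW w0) hw.
by apply: ler_pM; rewrite ?sqr_ge0 ?lerXn2r ?nnegrE // ltW.
Qed.

Lemma harmonic_le n : \sum_(1 <= i < n.+2) i%:R^-1 <= 1 + ln n.+1%:R :> R.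
Proof.
elim: n => [|n IH]; first by rewrite big_nat1 invr1 ln1 addr0.
rewrite big_nat_recr //=; apply: le_trans (lerD IH (invr_le_lnB R n)) _.
by rewrite -addrA lerD2l addrC subrK.
Qed.

Lemma harmonic_ge n : ln n.+1%:R <= \sum_(1 <= i < n.+1) i%:R^-1 :> R.
Proof.
elim: n => [|n IH]; first by rewrite big_geq // ln1.
rewrite big_nat_recr //=; have n0 : 0 < n.+1%:R :> R by [].
have -> : n.+2%:R = n.+1%:R * (1 + n.+1%:R^-1) :> R.
  by rewrite -[n.+2%:R]natr1 mulrDr mulr1 divff // gt_eqF.
rewrite lnM ?posrE //.
apply: lerD IH _; apply: le_ln1Dx; apply: (@lt_trans _ _ 0); first by lra.
by rewrite invr_gt0.
Qed.

Lemma growth_le n : 0 <= q -> growth n.+1 <= expR (q * (1 + ln n.+1%:R)).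
Proof.
move=> q0; apply: (@le_trans _ _ (expR (q * \sum_(1 <= i < n.+2) i%:R^-1))); last first.
  by rewrite ler_expR ler_wpM2l // harmonic_le.
elim: n.+1 => [|m IH]; first by rewrite growth0 big_geq // mulr0 expR0.
rewrite growthS big_nat_recr //= [X in expR X]mulrDr expRD; apply: ler_pM => //.
- exact: ltW (growth_gt0 m).
- exact: ltW (factor_gt0 m).
- exact: expR_ge1Dx.
Qed.

Lemma clock_ge n : 0 <= q -> expR (- 2) * expR ((1 - 2 * q) * ln n.+1%:R) <= B n.+1.
Proof.
move=> q0.
have lw j : (j <= n)%N -> expR (- (2 * q * (1 + ln n.+1%:R))) <= weight j ^+ 2.
  move=> jn; rewrite /weight exprVn expRN lef_pV2 ?posrE ?exprn_gt0 ?expR_gt0 ?growth_gt0 //.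
  have -> : expR (2 * q * (1 + ln n.+1%:R)) = expR (q * (1 + ln n.+1%:R)) ^+ 2.
    by rewrite -expRM_natl; congr expR; ring.
  rewrite lerXn2r ?nnegrE ?expR_ge0 ?(ltW (growth_gt0 _)) //.
  case: j jn => [|j] jn.
    by rewrite growth0 -[leLHS]expR0 ler_expR mulr_ge0 // addr_ge0 // ln_ge0 // ler1n.
  apply: le_trans (growth_le j q0) _; rewrite ler_expR ler_wpM2l // lerD2l.
  by rewrite ler_ln ?posrE // ler_nat; exact: ltnW.
apply: (@le_trans _ _ (\sum_(0 <= j < n.+1) expR (- (2 * q * (1 + ln n.+1%:R))))); last first.
  by rewrite /clock !big_mkord ler_sum // => j _; apply: lw; rewrite -ltnS.
rewrite sumr_const_nat subn0 -[leRHS]mulr_natl.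
have nE : n.+1%:R = expR (ln n.+1%:R) :> R by rewrite lnK ?posrE.
rewrite [X in _ <= X * _]nE -!expRD ler_expR; have := q2; lra.
Qed.

End Weights.

(** * From the clock normalisation to the stated one *)

Lemma limn_esup_transfer (R : realType) (D t phi : nat -> R) (rho : R) : 0 < rho ->
  (forall e : R, 0 < e -> \forall n \near \oo, D n <= (2 + e) * t n) ->
  (forall e : R, 0 < e -> forall n0, exists2 n, (n0 <= n)%N & (2 - e) * t n <= D n) ->
  (\forall n \near \oo, 0 < phi n) -> (t n / phi n @[n --> \oo] --> rho) ->
  limn_esup (fun n => (D n / phi n)%:E) = (2 * rho)%:E.
Proof.
move=> rho0 up low phi0 /cvgrPdist_le tphi.
(* For e <= 1 the product (2 + e)(rho + e) exceeds 2 rho by at most e (3 + rho). *)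
have [e_ e_P] : exists e_ : R -> R, forall eps, 0 < eps ->
    [/\ 0 < e_ eps, e_ eps <= 1 & e_ eps * (3 + rho) <= eps].
  exists (fun eps => Num.min 1 (eps / (3 + rho))) => eps eps0.
  have r3 : 0 < 3 + rho by lra.
  split; [by rewrite lt_min ltr01 divr_gt0|by rewrite ge_min lexx|].
  by rewrite -ler_pdivlMr // ge_min lexx orbT.
apply/eqP; rewrite eq_le; apply/andP; split.
  apply/lee_addgt0Pr => eps eps0; have [e0 e1 er] := e_P eps eps0.
  pose V := [set n | D n <= (2 + e_ eps) * t n /\ (0 < phi n /\ `|rho - t n / phi n| <= e_ eps)].
  have nV : \oo V by apply: filterI; [exact: up|apply: filterI => //; exact: tphi].
  apply: ge_ereal_inf; exists (ereal_sup [set (D n / phi n)%:E | n in V]); first by exists V.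
  apply: ge_ereal_sup => _ [n [Dn [pn tn]] <-].
  rewrite -EFinD lee_fin ler_pdivrMr //.
  have tn' : t n <= (rho + e_ eps) * phi n.
    rewrite -ler_pdivrMr //; move: tn; rewrite distrC => /(le_trans (ler_norm _)); lra.
  apply: le_trans Dn _.
  have h2 : 0 <= 2 + e_ eps by lra.
  have := ler_wpM2l h2 tn'.
  have : (2 + e_ eps) * (rho + e_ eps) <= 2 * rho + eps by nra.
  move=> /(ler_wpM2r (ltW pn)); lra.
apply: le_ereal_inf_tmp => _ [V [N _ NV] <-].
apply/lee_subgt0Pr => eps eps0; have [e0 e1 er] := e_P eps eps0.
have [N1 _ N1P] : \forall n \near \oo, 0 < phi n /\ `|rho - t n / phi n| <= e_ eps.
  by apply: filterI => //; exact: tphi.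
have [n nN Dn] := low _ e0 (maxn N N1).
have [pn tn] : 0 < phi n /\ `|rho - t n / phi n| <= e_ eps.
  by apply: N1P; exact: leq_trans (leq_maxr _ _) nN.
apply: le_trans (ereal_sup_ubound (_ : _ (D n / phi n)%:E)); last first.
  by exists n => //; apply: NV; exact: leq_trans (leq_maxl _ _) nN.
rewrite -EFinB lee_fin ler_pdivlMr //.
have tn' : (rho - e_ eps) * phi n <= t n.
  rewrite -ler_pdivlMr //; move: tn => /(le_trans (ler_norm _)); lra.
apply: le_trans Dn.
have h2 : 0 <= 2 - e_ eps by lra.
have := ler_wpM2l h2 tn'.
have : 2 * rho - eps <= (2 - e_ eps) * (rho - e_ eps) by nra.
move=> /(ler_wpM2r (ltW pn)); lra.
Qed.

Lemma cvg_ln_pinfty (R : realType) (x : nat -> R) :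
  (x n @[n --> \oo] --> +oo) -> (ln (x n) @[n --> \oo] --> +oo).
Proof.
move=> /cvgryPgt xoo; apply/cvgryPgt => A.
apply: filterS (xoo (expR A)) => n h.
by rewrite -ltr_expR lnK // posrE; apply: lt_trans h; exact: expR_gt0.
Qed.

Lemma ln_ratio_cvg1 (R : realType) (x y : nat -> R) (a b : R) : 0 < a ->
  (x n @[n --> \oo] --> +oo) -> (\forall n \near \oo, a * x n <= y n <= b * x n) ->
  ln (y n) / ln (x n) @[n --> \oo] --> (1 : R).
Proof.
move=> a0 xoo yab; have /cvgryPgt lnx := cvg_ln_pinfty xoo.
move/cvgryPgt: xoo => xoo; apply/cvgrPdist_le => e e0.
have [L1 L1P] := ln_le_scaled b e0; have [L2 L2P] := ln_le_scaled a^-1 e0.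
near=> n.
have /andP[ay yb] : a * x n <= y n <= b * x n by near: n.
have x0 : 0 < x n by near: n; exact: xoo.
have l0 : 0 < ln (x n) by near: n; exact: lnx.
have y0 : 0 < y n by apply: lt_le_trans ay; rewrite mulr_gt0.
have h1 : ln (y n) <= (1 + e) * ln (x n).
  by apply: L1P => //; apply: ltW; near: n; exact: xoo.
have h2 : ln (x n) <= (1 + e) * ln (y n).
  apply: L2P => //; last by rewrite ler_pdivlMl.
  apply: le_trans ay; rewrite -ler_pdivrMl //; apply: ltW; near: n; exact: xoo.
have r1 : ln (y n) / ln (x n) <= 1 + e by rewrite ler_pdivrMr.
have r2 : 1 - e <= ln (y n) / ln (x n).
  rewrite ler_pdivlMr //.
  have y1 : 0 <= ln (y n) by rewrite -(pmulr_rge0 _ (_ : 0 < 1 + e)) ?(le_trans (ltW l0)) //; lra.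
  have [e1|e1] := leP e 1; last by apply: le_trans y1; rewrite mulr_le0_ge0 ?(ltW l0) //; lra.
  have e1' : 0 <= 1 - e by lra.
  have := ler_wpM2l e1' h2; have := mulr_ge0 (sqr_ge0 e) y1; lra.
by rewrite ler_norml; move: (_ / _) r1 r2 => r r1 r2; lra.
Unshelve. all: by end_near. Qed.

Lemma ratio_bounds (R : realType) (g y x : R) : 0 < g -> 0 < x -> `|g - y / x| <= g / 2 ->
  g / 2 * x <= y <= 2 * g * x.
Proof.
move=> g0 x0; rewrite ler_norml => /andP[h1 h2].
apply/andP; split; [rewrite -ler_pdivlMr //|rewrite -ler_pdivrMr //]; lra.
Qed.

(** * The clock below, at and above q = 1/2 *)

Section WeightAsymptotics.
Variables (R : realType) (q : R).
Hypotheses (q1 : -1 < q) (q2 : q < 1).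
Local Notation W := (weight q).
Local Notation B := (clock (weight q)).
Local Notation G := (gauge q).

(** Terms before [J] use 1/j <= 1, the others 1/j <= 1/J. With [J] fixed and large, the sum is
    negligible against a diverging clock. *)
Lemma weight_sum_split J n : (0 < J)%N ->
  \sum_(1 <= j < n.+1) W j ^+ 2 / j%:R <= B J + J%:R^-1 * B n.+1.
Proof.
move=> J0; have J1 : 0 < J%:R :> R by rewrite ltr0n.
suff H : \sum_(1 <= j < n.+1) W j ^+ 2 / j%:R <= B (minn n.+1 J) + J%:R^-1 * B n.+1.
  by apply: le_trans H _; rewrite lerD2r clock_le // geq_minr.
elim: n => [|n IH].
  by rewrite big_geq // addr_ge0 // ?mulr_ge0 ?invr_ge0 ?(ltW J1) // sumr_ge0 // => i _;
    rewrite sqr_ge0.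
rewrite big_nat_recr //= (clockS _ n.+1) mulrDr.
have n0 : 0 < n.+1%:R :> R by [].
have w20 : 0 <= W n.+1 ^+ 2 by rewrite sqr_ge0.
have [nJ|nJ] := ltnP n.+1 J.
  rewrite (minn_idPl nJ) (clockS _ n.+1); move: IH; rewrite (minn_idPl (ltnW nJ)) => IH.
  have h1 : W n.+1 ^+ 2 / n.+1%:R <= W n.+1 ^+ 2.
    by rewrite ler_piMr // invf_le1 // ler1n.
  have h2 : 0 <= J%:R^-1 * W n.+1 ^+ 2 by rewrite mulr_ge0 // invr_ge0 ltW.
  apply: le_trans (lerD IH h1) _; move: (_ / _) h1 (J%:R^-1 * W n.+1 ^+ 2) h2 (J%:R^-1 * _) => x _ y y0 z; lra.
rewrite (minn_idPr (leqW nJ)); move: IH; rewrite (minn_idPr nJ) => IH.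
rewrite addrA lerD // mulrC ler_wpM2r // lef_pV2 ?posrE // ler_nat //.
Qed.

Lemma gauge_ratio : (B n @[n --> \oo] --> +oo) ->
  G n / B n.+1 @[n --> \oo] --> 1 - 2 * q.
Proof.
move=> /cvgryPgt Boo; apply/cvgrPdist_le => e e0.
have [J JP] := natr_ge_ex (2 / e).
have [N _ NP] := Boo (2 / e * (2 + B J.+1)).
near=> n.
have Bn : 2 / e * (2 + B J.+1) < B n.+1.
  by apply: NP => /=; apply: leqW; near: n; exists N.
have B1 := clock1 q n.
rewrite gauge_sum; set S := \sum_(1 <= j < n.+1) W j ^+ 2 / j%:R.
have S0 : 0 <= S := weight_sum_ge0 q n.+1.
have SJ := weight_sum_split n (ltn0Sn J); rewrite -/S in SJ.
have J2 : J.+1%:R^-1 <= e / 2.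
  by rewrite invf_ple ?posrE ?divr_gt0 // invf_div; apply: JP.
have -> : 1 - 2 * q - (2 * q + (1 - 2 * q) * B n.+1 - q ^+ 2 * S) / B n.+1 =
    (q ^+ 2 * S - 2 * q) / B n.+1 by field; rewrite gt_eqF //; lra.
have B0 : 0 < B n.+1 by lra.
rewrite normrM normfV (ger0_norm (ltW B0)) ler_pdivrMr //.
have h1 : `|q ^+ 2 * S - 2 * q| <= S + 2.
  apply: le_trans (ler_normB _ _) _; apply: lerD.
    rewrite (ger0_norm (mulr_ge0 (sqr_ge0 q) S0)) ler_piMl //; have := q1; have := q2; nra.
  by rewrite normrM ger0_norm // ler_piMr // ler_norml; have := q1; have := q2; lra.
apply: le_trans h1 _.
have h2 : 2 + B J.+1 <= e / 2 * B n.+1.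
  move: Bn; rewrite mulrAC -ltr_pdivlMr ?invr_gt0 // invrK => /ltW; lra.
have h3 : J.+1%:R^-1 * B n.+1 <= e / 2 * B n.+1 by rewrite ler_wpM2r // ltW.
apply: le_trans (lerD SJ (lexx _)) _.
rewrite addrAC addrC; move: (_^-1 * _) h3 => z h3; lra.
Unshelve. all: by end_near. Qed.

Lemma ln_natr_pinfty : ln n%:R @[n --> \oo] --> (+oo : set_system R).
Proof. by apply: cvg_ln_pinfty; exact: cvgr_idn. Qed.

(** Only ln ln of the clock enters the normaliser, so polynomial bounds of the wrong degree are
    enough: ln B comparable to ln n gives ln ln B equivalent to ln ln n. *)
Lemma ln_clock_bounds : q < 2^-1 -> exists a b : R, 0 < a /\
  \forall n \near \oo, a * ln n%:R <= ln (B n) <= b * ln n%:R.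
Proof.
move=> qh.
have [al [al0 [C alP]]] : exists al : R, 0 < al /\ exists C : R, forall n,
    al * ln n.+1%:R - C <= ln (B n.+1).
  have [q0|q0] := leP 0 q.
    exists (1 - 2 * q); split; first lra.
    exists 2 => n; have B0 : 0 < B n.+1 by apply: lt_le_trans (clock1 q n).
    by rewrite -ler_expR lnK ?posrE // addrC expRD; exact: clock_ge.
  exists 1; split => //; exists 0 => n; rewrite mul1r subr0.
  have B0 : 0 < B n.+1 by apply: lt_le_trans (clock1 q n).
  rewrite ler_ln ?posrE //.
  have -> : n.+1%:R = \sum_(0 <= j < n.+1) (1 : R) by rewrite sumr_const_nat subn0.
  rewrite /clock !big_mkord; apply: ler_sum => j _.
  rewrite exprn_ege1 //.
  elim: (nat_of_ord j) => [|i IH]; first by rewrite weight0.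
  apply: le_trans IH _; rewrite (weightS q1 i) ler_piMr ?(ltW (weight_gt0 q1 _)) //.
  by rewrite gerDl ler_pdivrMr // mul0r ltW.
have [C' C'P] : exists C', forall n, ln (B n.+1) <= C' + 3 * ln n.+1%:R.
  pose K := (2 / (1 + q)) ^+ 2; exists (ln K) => n.
  have B0 : 0 < B n.+1 by apply: lt_le_trans (clock1 q n).
  have K0 : 0 < K by rewrite exprn_gt0 // divr_gt0 //; have := q1; lra.
  have -> : 3 * ln n.+1%:R = ln (n.+1%:R ^+ 3) :> R by rewrite lnXn // mulr_natl.
  have n3 : 0 < n.+1%:R ^+ 3 :> R by rewrite exprn_gt0.
  have -> : ln K + ln (n.+1%:R ^+ 3) = ln (K * n.+1%:R ^+ 3) by rewrite [RHS]lnM ?posrE.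
  have Kn := mulr_gt0 K0 n3.
  rewrite ler_ln ?posrE //.
  apply: (@le_trans _ _ (\sum_(0 <= j < n.+1) (K * n.+1%:R ^+ 2))); last first.
    by rewrite sumr_const_nat subn0 -[leLHS]mulr_natr [X in _ <= K * X]exprSr mulrA.
  rewrite /clock !big_mkord; apply: ler_sum => j _; rewrite /K -exprMn.
  have h := weight_le q1 q2 j.
  have h0 := ltW (weight_gt0 q1 j).
  have h1 : 2 / (1 + q) * j.+1%:R <= 2 / (1 + q) * n.+1%:R.
    by rewrite ler_wpM2l ?ler_nat // divr_ge0 //; have := q1; lra.
  by rewrite lerXn2r ?nnegrE ?(le_trans h) // (le_trans h0) // (le_trans h).
exists (al / 2), 4; split; first by rewrite divr_gt0.
have /cvgryPgt lnoo := ln_natr_pinfty.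
near=> n.
have l1 : 2 / al * C < ln n%:R by near: n; exact: lnoo.
have l2 : C' < ln n%:R by near: n; exact: lnoo.
have n0 : (0 < n)%N by near: n; exists 1%N.
have := alP n.-1; have := C'P n.-1; rewrite prednK // => h1 h2.
have l3 : C < al / 2 * ln n%:R.
  by rewrite -ltr_pdivrMl ?divr_gt0 // invf_div.
apply/andP; split; lra.
Unshelve. all: by end_near. Qed.

Lemma clock_pinfty_lt : q < 2^-1 -> B n @[n --> \oo] --> (+oo : set_system R).
Proof.
move=> qh; have [a [b [a0 ab]]] := ln_clock_bounds qh.
have /cvgryPgt lnoo := ln_natr_pinfty; apply/cvgryPgt => A.
near=> n.
have /andP[h _] : a * ln n%:R <= ln (B n) <= b * ln n%:R by near: n.
have n0 : (0 < n)%N by near: n; exists 1%N.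
have B0 : 0 < B n by rewrite -(prednK n0); apply: lt_le_trans (clock1 q _).
have l1 : a^-1 * A < ln n%:R by near: n; exact: lnoo.
apply: (@lt_le_trans _ _ (1 + ln (B n))); last first.
  by apply: le_trans (expR_ge1Dx _) _; rewrite lnK.
by move: l1; rewrite ltr_pdivrMl //; lra.
Unshelve. all: by end_near. Qed.

Lemma weight_sqr n : W n ^+ 2 = G n / n.+1%:R.
Proof. by rewrite /gauge mulrC mulKf // pnatr_eq0. Qed.

Lemma normalizer_sqr (f g : R) n : (0 < n)%N -> 0 <= f -> 0 < g ->
  Num.sqrt (B n * f) * growth q n.-1 / Num.sqrt (n%:R * g) = Num.sqrt (B n / G n.-1 * (f / g)).
Proof.
move=> n0 f0 g0; have B0 : 0 < B n by rewrite -(prednK n0); apply: lt_le_trans (clock1 q _).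
have gr0 := growth_gt0 q1 n.-1; have nr : 0 < n%:R :> R by rewrite ltr0n.
have h1 := mulr_ge0 (ltW B0) f0; have h2 := mulr_ge0 (ltW nr) (ltW g0).
have h3 := mulr_ge0 h1 (sqr_ge0 (growth q n.-1)).
rewrite -{1}(ger0_norm (ltW gr0)) -sqrtr_sqr -(sqrtrM _ h1) -(sqrtrV h2) -(sqrtrM _ h3).
congr Num.sqrt; rewrite /gauge /weight prednK // exprVn; field.
by rewrite !gt_eqF.
Qed.

Lemma sqrt_cvg (u : nat -> R) (l : R) :
  (u n @[n --> \oo] --> l) -> Num.sqrt (u n) @[n --> \oo] --> Num.sqrt l.
Proof. by move=> ul; apply: continuous_cvg => //; exact: sqrt_continuous. Qed.

Lemma normalizer_lt_half : q < 2^-1 ->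
  Num.sqrt (B n * ln (ln (B n))) * growth q n.-1 / Num.sqrt (n%:R * ln (ln n%:R))
    @[n --> \oo] --> (Num.sqrt (1 - 2 * q))^-1.
Proof.
move=> qh; have [a [b [a0 ab]]] := ln_clock_bounds qh.
have q0 : 0 < 1 - 2 * q by lra.
have r1 : B n / G n.-1 @[n --> \oo] --> (1 - 2 * q)^-1.
  have h := gauge_ratio (clock_pinfty_lt qh).
  rewrite -cvg_shiftS (_ : [sequence _]_n = (fun n => (G n / B n.+1)^-1)).
    exact: cvgV (lt0r_neq0 q0) h.
  by apply/funext => n /=; rewrite invf_div.
have r2 := ln_ratio_cvg1 a0 ln_natr_pinfty ab.
have r12 : B n / G n.-1 * (ln (ln (B n)) / ln (ln n%:R)) @[n --> \oo] --> (1 - 2 * q)^-1 * 1.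
  exact: cvgM r1 r2.
have /cvgryPgt lnoo := ln_natr_pinfty.
have := sqrt_cvg r12; rewrite mulr1 -sqrtrV ?(ltW q0) //.
apply: cvg_trans; apply: near_eq_cvg; near=> n.
have lnn : 1 < ln n%:R :> R by near: n; exact: lnoo.
have lnb : 1 <= ln (B n).
  have /andP[h _] : a * ln n%:R <= ln (B n) <= b * ln n%:R by near: n.
  apply: le_trans h; rewrite -ler_pdivrMl // mulr1; apply: ltW.
  near: n; exact: lnoo.
apply/esym; apply: normalizer_sqr; first by near: n; exists 1%N.
  exact: ln_ge0.
exact: ln_gt0.
Unshelve. all: by end_near. Qed.

Section Half.
Hypothesis qh : q = 2^-1.

Lemma gauge_half_nonincreasing : nonincreasing_seq G.
Proof.
apply/nonincreasing_seqP => n; rewrite -subr_le0 (gaugeS q1) qh mulfV // subrr sub0r mulrN oppr_le0.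
by rewrite mulr_ge0 ?sqr_ge0 // divr_ge0 // sqr_ge0.
Qed.

(** The gauge decreases, but its product with (n+1)/(n+2) increases from the value 1/2. Hence the
    gauge has a positive limit. *)
Lemma gauge_half_ge n : 2^-1 <= G n.
Proof.
suff H : 2^-1 <= G n * (n.+1%:R / n.+2%:R).
  apply: le_trans H _; rewrite ler_piMr ?(ltW (gauge_gt0 q1 n)) // ler_pdivrMr // mul1r ler_nat.
  exact: leqnSn.
elim: n => [|n IH]; first by rewrite /gauge weight0 expr1n !mul1r.
have e2 : q / n.+1%:R = 2^-1 / n.+1%:R by rewrite qh.
apply: le_trans IH _; rewrite /gauge (weightS q1 n) e2.
have w0 := sqr_ge0 (W n.+1); have n0 : 0 < n.+1%:R :> R by [].
rewrite -[n.+3%:R]natr1 -[n.+2%:R]natr1; move: (n.+1%:R) (W n.+1) w0 n0 => x y y0 x0.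
have -> : x * (y * (1 + 2^-1 / x)) ^+ 2 * (x / (x + 1)) =
   y ^+ 2 * ((x + 2^-1) ^+ 2 / (x + 1)) by field; rewrite !gt_eqF //; lra.
have -> : (x + 1) * y ^+ 2 * ((x + 1) / (x + 1 + 1)) = y ^+ 2 * ((x + 1) ^+ 2 / (x + 1 + 1)).
  by ring.
rewrite ler_wpM2l // ler_pdivrMr; last by lra.
rewrite mulrAC ler_pdivlMr; last by lra.
have -> : (x + 1) ^+ 2 * (x + 1) = (x + 2^-1) ^+ 2 * (x + 1 + 1) + (4^-1 * 3 * x + 2^-1) by field.
rewrite lerDl; nra.
Qed.

Lemma clock_half_ge (g : R) n : (forall j, g <= G j) -> 0 <= g -> g * ln n.+1%:R <= B n.
Proof.
move=> gG g0; apply: (@le_trans _ _ (g * \sum_(1 <= i < n.+1) i%:R^-1)).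
  by rewrite ler_wpM2l // harmonic_ge.
rewrite big_add1 /= mulr_sumr /clock !big_mkord; apply: ler_sum => j _.
by rewrite weight_sqr ler_wpM2r // invr_ge0.
Qed.

Lemma clock_half_le (g : R) J n : (forall j, (J <= j)%N -> G j <= g) -> 0 <= g ->
  B n.+1 <= B J + g * (1 + ln n.+1%:R).
Proof.
move=> gG g0.
suff H m : B m <= B (minn m J) + g * \sum_(1 <= i < m.+1) i%:R^-1.
  apply: le_trans (H n.+1) _; apply: lerD; first by rewrite clock_le // geq_minr.
  by rewrite ler_wpM2l // harmonic_le.
elim: m => [|m IH].
  by rewrite min0n big_geq // mulr0 addr0.
rewrite big_nat_recr //= mulrDr (clockS _ m).
have h0 : 0 <= g / m.+1%:R by rewrite divr_ge0.
have [mJ|mJ] := ltnP m J.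
  rewrite (minn_idPl mJ) (clockS _ m) lerDl addr_ge0 // mulr_ge0 //.
  by apply: sumr_ge0 => i _; rewrite invr_ge0.
rewrite (minn_idPr (leqW mJ)); move: IH; rewrite (minn_idPr mJ) => IH.
rewrite addrA lerD // weight_sqr ler_wpM2r ?invr_ge0 //; exact: gG.
Qed.

Lemma gauge_half_cvg : exists2 g : R, 2^-1 <= g & (G n @[n --> \oo] --> g) /\ forall j, g <= G j.
Proof.
have cG : cvgn G.
  apply: nonincreasing_is_cvgn gauge_half_nonincreasing _.
  by exists 2^-1 => _ [n _ <-]; exact: gauge_half_ge.
exists (limn G); first by apply: limr_ge => //; apply: nearW; exact: gauge_half_ge.
by split => // j; exact: nonincreasing_cvgn_ge gauge_half_nonincreasing cG j.
Qed.

Lemma clock_half_ratio (g : R) : 2^-1 <= g -> (G n @[n --> \oo] --> g) -> (forall j, g <= G j) ->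
  B n / ln n%:R @[n --> \oo] --> g.
Proof.
move=> g2 Gg gG; have g0 : 0 < g by lra.
have /cvgryPgt lnoo := ln_natr_pinfty.
apply/cvgrPdist_le => e e0.
have [J _ JP] : \forall n \near \oo, G n <= g + e / 2.
  move/cvgrPdist_le: Gg => /(_ (e / 2)); rewrite divr_gt0 // => /(_ isT).
  by apply: filterS => n; rewrite distrC => /(le_trans (ler_norm _)); lra.
near=> n.
have n0 : (0 < n)%N by near: n; exists 1%N.
have l0 : 1 < ln n%:R :> R by near: n; exact: lnoo.
have lA : (e / 2)^-1 * (B J + (g + e / 2)) < ln n%:R by near: n; exact: lnoo.
have h1 : g * ln n%:R <= B n.
  apply: le_trans (clock_half_ge n gG (ltW g0)); rewrite ler_wpM2l ?(ltW g0) //.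
  by rewrite ler_ln ?posrE ?ltr0n // ler_nat.
have h2 : B n <= B J + (g + e / 2) * (1 + ln n%:R).
  rewrite -{1}(prednK n0); apply: le_trans (clock_half_le n.-1 JP _) _; first by lra.
  by rewrite prednK.
have h3 : B J + (g + e / 2) < e / 2 * ln n%:R by rewrite -ltr_pdivrMl // divr_gt0.
have ln0 : 0 < ln n%:R :> R by lra.
have r1 : g <= B n / ln n%:R by rewrite ler_pdivlMr.
have r2 : B n / ln n%:R <= g + e by rewrite ler_pdivrMr //; lra.
by rewrite ler_norml; move: (_ / _) r1 r2 => r r1 r2; lra.
Unshelve. all: by end_near. Qed.

Lemma clock_pinfty_half : B n @[n --> \oo] --> (+oo : set_system R).
Proof.
have [g g2 [Gg gG]] := gauge_half_cvg.
have /cvgryPgt lnoo := ln_natr_pinfty; apply/cvgryPgt => A.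
near=> n.
have l1 : g^-1 * A < ln n%:R by near: n; exact: lnoo.
have n0 : (0 < n)%N by near: n; exists 1%N.
have g0 : 0 < g by lra.
apply: lt_le_trans (clock_half_ge n gG (ltW g0)); rewrite -ltr_pdivrMl //.
by apply: lt_le_trans l1 _; rewrite ler_ln ?posrE ?ltr0n // ler_nat.
Unshelve. all: by end_near. Qed.

(** The limit [g] of the gauge is never computed: the clock is equivalent to g ln n and the gauge to
    [g], so it cancels. Comparability passes through the logarithm twice to reach ln ln ln n. *)
Lemma normalizer_half :
  Num.sqrt (B n * ln (ln (B n))) * growth q n.-1 /
    Num.sqrt (n%:R * ln n%:R * ln (ln (ln n%:R))) @[n --> \oo] --> (1 : R).
Proof.
have [g g2 [Gg gG]] := gauge_half_cvg.
have g0 : 0 < g by lra.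
have BL := clock_half_ratio g2 Gg gG.
have lnoo := ln_natr_pinfty; have lnlnoo := cvg_ln_pinfty lnoo.
have lnlnlnoo := cvg_ln_pinfty lnlnoo.
have b1 : \forall n \near \oo, g / 2 * ln n%:R <= B n <= 2 * g * ln n%:R.
  move/cvgrPdist_le: BL => /(_ (g / 2)); rewrite divr_gt0 // => /(_ isT) h.
  move/cvgryPgt: lnoo => /(_ 0) l0; near=> n.
  by apply: ratio_bounds => //; near: n.
have r2 := ln_ratio_cvg1 (divr_gt0 g0 (ltr0n R 2)) lnoo b1.
have b2 : \forall n \near \oo, 1 / 2 * ln (ln n%:R) <= ln (B n) <= 2 * 1 * ln (ln n%:R).
  move/cvgrPdist_le: r2 => /(_ (1 / 2)); rewrite divr_gt0 // => /(_ isT) h.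
  move/cvgryPgt: lnlnoo => /(_ 0) l0; near=> n.
  by apply: ratio_bounds => //; near: n.
have half0 : 0 < 1 / 2 :> R by rewrite divr_gt0.
have r3 := ln_ratio_cvg1 half0 lnlnoo b2.
have r1 : B n / ln n%:R / G n.-1 @[n --> \oo] --> (1 : R).
  have Gg' : G n.-1 @[n --> \oo] --> g by rewrite -cvg_shiftS.
  have h : B n / ln n%:R / G n.-1 @[n --> \oo] --> g / g by exact: cvgM BL (cvgV (lt0r_neq0 g0) Gg').
  by rewrite mulfV ?gt_eqF in h.
have r13 : B n / ln n%:R / G n.-1 * (ln (ln (B n)) / ln (ln (ln n%:R))) @[n --> \oo] -->
    (1 * 1 : R) by exact: cvgM r1 r3.
move/cvgryPgt: lnoo => lnoo; move/cvgryPgt: lnlnoo => lnlnoo; move/cvgryPgt: lnlnlnoo => lnlnlnoo.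
have := sqrt_cvg r13; rewrite mulr1 sqrtr1.
apply: cvg_trans; apply: near_eq_cvg; near=> n.
have l1 : 0 < ln n%:R :> R by near: n; exact: lnoo.
have l2 : 2 < ln (ln n%:R) :> R by near: n; exact: lnlnoo.
have l3 : 0 < ln (ln (ln n%:R)) :> R by near: n; exact: lnlnlnoo.
have lnb : 1 <= ln (B n).
  have /andP[h _] : 1 / 2 * ln (ln n%:R) <= ln (B n) <= 2 * 1 * ln (ln n%:R) by near: n.
  lra.
rewrite -(mulrA n%:R) normalizer_sqr //; last 3 first.
- by near: n; exists 1%N.
- exact: ln_ge0.
- exact: mulr_gt0.
by congr Num.sqrt; field; rewrite !gt_eqF // gauge_gt0.
Unshelve. all: by end_near. Qed.

End Half.

Section AboveHalf.
Hypothesis qh : 2^-1 < q.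

(** The quantity gauge + (2q - 1)(clock - 1) starts at 1 and never increases: in [gaugeS] the clock
    part cancels and the term with q^2 has the right sign. *)
Lemma clock_bounded n : B n <= 1 + (2 * q - 1)^-1.
Proof.
have d0 : 0 < 2 * q - 1 by have := qh; lra.
apply: (@le_trans _ _ (B n.+1)); first exact: clock_le.
have H m : G m + (2 * q - 1) * (B m.+1 - 1) <= 1.
  elim: m => [|m IH].
    by rewrite /gauge weight0 /clock big_nat1 weight0 !expr1n subrr mulr0 addr0 mulr1.
  apply: le_trans IH; rewrite (clockS _ m.+1) -subr_ge0.
  have -> : G m + (2 * q - 1) * (B m.+1 - 1) - (G m.+1 + (2 * q - 1) * (B m.+1 + W m.+1 ^+ 2 - 1))
    = - (G m.+1 - G m) - (2 * q - 1) * W m.+1 ^+ 2 by ring.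
  rewrite (gaugeS q1).
  have -> : - (W m.+1 ^+ 2 * (1 - 2 * q - q ^+ 2 / m.+1%:R)) - (2 * q - 1) * W m.+1 ^+ 2 =
     W m.+1 ^+ 2 * (q ^+ 2 / m.+1%:R) by ring.
  by rewrite mulr_ge0 ?sqr_ge0 // divr_ge0 // sqr_ge0.
have := H n; have := gauge_gt0 q1 n => g0 h.
rewrite -lerBlDl -[leRHS]mul1r ler_pdivlMr //; lra.
Qed.

Lemma weight_nonincreasing m n : (m <= n)%N -> W n <= W m.
Proof.
move=> /subnKC <-; elim: (n - m)%N => [|i IH]; first by rewrite addn0.
apply: le_trans IH; rewrite addnS (weightS q1 (m + i)) ler_peMr ?(ltW (weight_gt0 q1 _)) //.
by rewrite lerDl divr_ge0 //; have := qh; lra.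
Qed.

(** Since 1 + q/k <= (k + 1)/k, the product of weight n and n + 1 is nondecreasing. *)
Lemma weight_double n : W n <= 2 * W (n + n).
Proof.
have H i : W n * n.+1%:R <= W (n + i) * (n + i).+1%:R.
  elim: i => [|i IH]; first by rewrite addn0.
  apply: le_trans IH _; rewrite addnS (weightS q1 (n + i)) -mulrA.
  rewrite ler_wpM2l ?(ltW (weight_gt0 q1 _)) // -[(n + i).+2%:R]natr1.
  have : 0 < (n + i).+1%:R :> R by [].
  move: ((n + i).+1%:R) => x x0; rewrite mulrDl mul1r divfK ?gt_eqF // lerD2l; have := q2; lra.
have n0 : 0 < n.+1%:R :> R by [].
rewrite -(ler_pM2r n0); apply: le_trans (H n) _.
rewrite [leRHS]mulrAC mulrC ler_wpM2r ?(ltW (weight_gt0 q1 _)) // -natrM ler_nat.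
by clear; lia.
Qed.

(** Between n and 2n every weight is at least half the weight at n, so the clock gains at least n/4
    times its square; later weights are smaller still. *)
Lemma weight_spread del : 0 < del -> exists n0, forall n j, (n0 <= n)%N -> (n <= j)%N ->
  W j ^+ 2 <= del * (B (n + n) - B n).
Proof.
move=> del0; have [n0 n0P] := natr_ge_ex (4 / del).
exists n0 => n j nn nj.
have wj : W j ^+ 2 <= W n ^+ 2.
  by rewrite lerXn2r ?nnegrE ?(ltW (weight_gt0 q1 _)) // weight_nonincreasing.
have Bn : n%:R * (W n ^+ 2 / 4) <= B (n + n) - B n.
  have w2 i : (i <= n + n)%N -> W n ^+ 2 / 4 <= W i ^+ 2.
    move=> /weight_nonincreasing h; have := weight_double n => h'.
    have h0 := ltW (weight_gt0 q1 n).
    have : W n <= 2 * W i by apply: le_trans h' _; rewrite ler_wpM2l.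
    by move=> h2; rewrite ler_pdivrMr //; nra.
  suff H i : (i <= n)%N -> i%:R * (W n ^+ 2 / 4) <= B (n + i) - B n by exact: H.
  elim: i => [|i IH] ni; first by rewrite mul0r addn0 subrr.
  rewrite addnS (clockS _ (n + i)) -natr1 mulrDl mul1r addrAC lerD ?IH ?(ltnW ni) //.
  by apply: w2; rewrite leq_add2l ltnW.
apply: le_trans wj _; have := n0P n nn; rewrite ler_pdivrMr // => h.
have w0 : 0 <= W n ^+ 2 / 4 by rewrite divr_ge0 // sqr_ge0.
have := ler_wpM2r w0 h; have := ler_wpM2l (ltW del0) Bn; lra.
Qed.

(** Bernoulli's inequality for (1 + x)^q. Add exp(y) >= 1 + y at y = ln(1+x) - ln(1+qx) with weight
    q and at y = - ln(1+qx) with weight 1 - q: the weighted exponentials sum to 1. *)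
Lemma expR_bernoulli (x : R) : 0 <= x -> expR (q * ln (1 + x)) <= 1 + q * x.
Proof.
move=> x0; have q0 : 0 < q by have := qh; lra.
have y0 : 0 < 1 + q * x by rewrite ltr_pwDl // mulr_ge0 // ltW.
have x1 : 0 < 1 + x by lra.
rewrite -[leRHS]lnK ?posrE // ler_expR.
have h1 := expR_ge1Dx (ln (1 + x) - ln (1 + q * x)).
have h2 := expR_ge1Dx (- ln (1 + q * x)).
rewrite expRB !lnK ?posrE // in h1; rewrite expRN lnK ?posrE // in h2.
have q1' : 0 <= 1 - q by have := q2; lra.
have := lerD (ler_wpM2l (ltW q0) h1) (ler_wpM2l q1' h2).
have -> : q * ((1 + x) / (1 + q * x)) + (1 - q) * (1 + q * x)^-1 = 1.
  by field; rewrite gt_eqF.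
lra.
Qed.

(** The ratio is nondecreasing by Bernoulli's inequality at x = 1/(n+1), and at most exp(q) by the
    harmonic sum bound, so a positive limit exists without computing it. *)
Lemma growth_power_cvg : exists2 c : R, 0 < c &
  growth q n.-1 / (n%:R `^ q) @[n --> \oo] --> c.
Proof.
have q0 : 0 < q by have := qh; lra.
pose u n := growth q n / expR (q * ln n.+1%:R).
have nd : nondecreasing_seq u.
  apply/nondecreasing_seqP => n; rewrite /u growthS.
  have n0 : 0 < n.+1%:R :> R by [].
  have -> : n.+2%:R = n.+1%:R * (1 + n.+1%:R^-1) :> R.
    by rewrite -[n.+2%:R]natr1 mulrDr mulr1 divff // gt_eqF.
  rewrite lnM ?posrE ?ltr_wpDr ?invr_ge0 // (mulrDr q) expRD invfM mulrACA.
  rewrite ler_peMr ?divr_ge0 ?expR_ge0 ?(ltW (growth_gt0 q1 _)) //.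
  rewrite ler_pdivlMr ?expR_gt0 // mul1r; apply: expR_bernoulli; by rewrite invr_ge0.
have ub n : u n <= expR q.
  rewrite /u ler_pdivrMr ?expR_gt0 // -expRD.
  have -> : q + q * ln n.+1%:R = q * (1 + ln n.+1%:R) by ring.
  case: n => [|n]; first by rewrite growth0 -[leLHS]expR0 ler_expR ln1 addr0 mulr1 ltW.
  apply: le_trans (growth_le q1 n (ltW q0)) _; rewrite ler_expR ler_wpM2l ?(ltW q0) //.
  by rewrite lerD2l ler_ln ?posrE // ler_nat.
have cu : cvgn u by apply: nondecreasing_is_cvgn => //; exists (expR q) => _ [n _ <-].
exists (limn u).
  apply: lt_le_trans (nondecreasing_cvgn_le nd cu 0%N).
  by rewrite /u growth0 ln1 mulr0 expR0 divr1.
rewrite -cvg_shiftS; move: cu; apply: cvg_trans; apply: near_eq_cvg; near=> n => /=.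
by rewrite /u /powR pnatr_eq0 /=.
Unshelve. all: by end_near. Qed.

End AboveHalf.
End WeightAsymptotics.

(** * The martingale of the elephant walk *)

Section ElephantMartingale.
Variables (R : realType) (p s : R).
Hypotheses (p0 : 0 < p) (p1 : p < 1) (s0 : 0 <= s) (s1 : s <= 1).
Local Notation q := (2 * p - 1).
Local Notation k := (kpair p s).
Local Notation sg := (@sg R).
Local Notation state := (bool * bool)%type.

Let q1 : -1 < q. Proof. by have := p0; lra. Qed.
Let q2 : q < 1. Proof. by have := p1; lra. Qed.
Let kS : stochastic k.
Proof. by apply: stochastic_kpair; rewrite ?s0 ?s1 // (ltW p0) (ltW p1). Qed.

Definition ssum (l : seq bool) : R := \sum_(b <- l) sg b.

Lemma ssum_norm_le l : `|ssum l| <= (size l)%:R.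
Proof.
elim: l => [|b l IH]; first by rewrite /ssum big_nil normr0.
rewrite /ssum big_cons [size _]/= -natr1 addrC; apply: le_trans (ler_normD _ _) (lerD IH _).
by case: b; rewrite /sg ?normrN normr1.
Qed.

Definition drift (l : seq bool) : R := q * ssum l / (size l)%:R.

Lemma kstep_mean l : (0 < size l)%N -> \sum_b kstep p s l b * sg b = drift l.
Proof.
case: l => // a l _; rewrite big_bool /sg /= mulr1 mulrN1 -mulrBr -sumrB /drift mulrC; congr (_ / _).
rewrite /ssum mulr_sumr; apply: eq_bigr => -[] _; rewrite /sg /=; ring.
Qed.

Lemma kstep_var l : (0 < size l)%N ->
  \sum_b kstep p s l b * (sg b - drift l) ^+ 2 = 1 - drift l ^+ 2.
Proof.
move=> l0; have := kstep_sum p s l; have := kstep_mean l0.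
rewrite !big_bool /sg /=; move: (kstep p s l true) (kstep p s l false) (drift l) => x y m e1 e2.
have -> : y = 1 - x by lra.
have -> : m = 2 * x - 1 by lra.
ring.
Qed.

Lemma drift_norm_le l : `|drift l| <= `|q|.
Proof.
rewrite /drift normrM normrM normfV -mulrA ler_piMr //.
have [->|l0] := eqVneq (size l) 0%N; first by rewrite normr0 invr0 mulr0.
rewrite (@ger0_norm _ (size l)%:R) // ler_pdivrMr ?ltr0n ?lt0n // mul1r; exact: ssum_norm_le.
Qed.

Lemma drift_sqr_le l : drift l ^+ 2 <= q ^+ 2.
Proof.
by rewrite -(real_normK (num_real (drift l))) -(real_normK (num_real q)) lerXn2r ?nnegrE ?drift_norm_le.
Qed.

Lemma q_sqr_lt1 : q ^+ 2 < 1. Proof. by have := q1; have := q2; nra. Qed.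

(* The martingale increments of [a S + b S'] (before weighting). *)
Definition incr (a b : R) (h : seq state) (z : state) : R :=
  a * (sg z.1 - drift (unzip1 h)) + b * (sg z.2 - drift (unzip2 h)).

Lemma drift_bound l (x : bool) : `|sg x - drift l| <= 2.
Proof.
apply: le_trans (ler_normB _ _) _; apply: lerD.
  by case: x; rewrite /sg ?normrN normr1.
by apply: le_trans (drift_norm_le l) _; rewrite ler_norml; have := q1; have := q2; lra.
Qed.

Lemma incr_bound a b h z : `|a| <= 1 -> `|b| <= 1 -> `|incr a b h z| <= 4.
Proof.
move=> a1 b1; apply: le_trans (ler_normD _ _) _; rewrite !normrM.
have -> : 4 = 1 * 2 + 1 * 2 :> R by ring.
by apply: lerD; apply: ler_pM => //; exact: drift_bound.
Qed.

Lemma kpair_sum2 h (f g : bool -> R) :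
  \sum_z k h z * (f z.1 * g z.2) =
  (\sum_b kstep p s (unzip1 h) b * f b) * (\sum_b kstep p s (unzip2 h) b * g b).
Proof.
rewrite (sum_kpair p s h (fun z => f z.1 * g z.2)) mulr_suml; apply: eq_bigr => b _.
by rewrite !mulr_sumr; apply: eq_bigr => b' _ /=; ring.
Qed.

Lemma kpair_sum_left h (f : bool -> R) :
  \sum_z k h z * f z.1 = \sum_b kstep p s (unzip1 h) b * f b.
Proof.
have := kpair_sum2 h f (fun=> 1).
under eq_bigr do rewrite mulr1.
by rewrite [in X in _ * X](eq_bigr _ (fun b _ => mulr1 _)) kstep_sum mulr1.
Qed.

Lemma kpair_sum_right h (f : bool -> R) :
  \sum_z k h z * f z.2 = \sum_b kstep p s (unzip2 h) b * f b.
Proof.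
have := kpair_sum2 h (fun=> 1) f.
under eq_bigr do rewrite mul1r.
by rewrite [in X in X * _](eq_bigr _ (fun b _ => mulr1 _)) kstep_sum mul1r.
Qed.

Lemma centred_mean l : (0 < size l)%N -> \sum_b kstep p s l b * (sg b - drift l) = 0.
Proof.
move=> l0; under eq_bigr do rewrite mulrBr.
by rewrite sumrB -mulr_suml kstep_sum mul1r kstep_mean // subrr.
Qed.

Lemma incr_mean a b h : (0 < size h)%N -> \sum_z k h z * incr a b h z = 0.
Proof.
move=> h0.
have -> : \sum_z k h z * incr a b h z = a * (\sum_z k h z * (sg z.1 - drift (unzip1 h)))
    + b * (\sum_z k h z * (sg z.2 - drift (unzip2 h))).
  by rewrite !mulr_sumr -big_split /=; apply: eq_bigr => z _; rewrite /incr; ring.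
rewrite (kpair_sum_left h (fun x => sg x - drift (unzip1 h))).
rewrite (kpair_sum_right h (fun x => sg x - drift (unzip2 h))).
by rewrite !centred_mean ?size_map // !mulr0 addr0.
Qed.

Lemma incr_var a b h : (0 < size h)%N -> \sum_z k h z * incr a b h z ^+ 2 =
  a ^+ 2 * (1 - drift (unzip1 h) ^+ 2) + b ^+ 2 * (1 - drift (unzip2 h) ^+ 2).
Proof.
move=> h0; pose f x := sg x - drift (unzip1 h); pose g x := sg x - drift (unzip2 h).
have -> : \sum_z k h z * incr a b h z ^+ 2 = a ^+ 2 * (\sum_z k h z * f z.1 ^+ 2)
    + b ^+ 2 * (\sum_z k h z * g z.2 ^+ 2) + 2 * a * b * (\sum_z k h z * (f z.1 * g z.2)).
  by rewrite !mulr_sumr -!big_split /=; apply: eq_bigr => z _; rewrite /incr /f /g; ring.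
rewrite kpair_sum2 (kpair_sum_left h (fun x => f x ^+ 2)) (kpair_sum_right h (fun x => g x ^+ 2)).
by rewrite centred_mean ?size_map // mul0r mulr0 addr0 !kstep_var ?size_map.
Qed.

Lemma incr_laplace_ub a b e : `|a| <= 1 -> `|b| <= 1 -> 0 < e ->
  exists2 mu, 0 < mu & laplace_ub k (incr a b) (1 + e) mu.
Proof.
move=> a1 b1 e0; pose d := Num.min 1 e.
have d0 : 0 < d by rewrite lt_min ltr01.
have d1 : d <= 1 by rewrite ge_min lexx.
have de : d <= e by rewrite ge_min lexx orbT.
exists (d / (4 * 4)); first by rewrite divr_gt0 // mulr_gt0.
move=> h l h0 lm; apply: (@le_trans _ _ (expR (1 * (1 + d) * l ^+ 2))); last first.
  by rewrite ler_expR mul1r ler_wpM2r ?sqr_ge0 // lerD2l.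
apply: (@laplace_le _ _ (k h) (incr a b h) 4) => //; [exact: kS.1|exact: kS.2|exact: incr_mean| | | |].
- by move=> z; exact: incr_bound.
- by lra.
- rewrite incr_var //.
  have a2 : a ^+ 2 <= 1 by rewrite -(real_normK (num_real a)) expr_le1.
  have b2 : b ^+ 2 <= 1 by rewrite -(real_normK (num_real b)) expr_le1.
  have := sqr_ge0 (drift (unzip1 h)); have := sqr_ge0 (drift (unzip2 h)).
  move=> /(mulr_ge0 (sqr_ge0 b)) h2 /(mulr_ge0 (sqr_ge0 a)) h1; lra.
- exact: ltW.
Qed.

Fixpoint msum (xi : seq state -> state -> R) (h : seq state) : R :=
  if h is z :: h' then msum xi h' + weight q (size h') * xi h' z else 0.

Lemma msum_increments xi : increments (weight q) xi (msum xi).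
Proof. by []. Qed.

Lemma drift_mul l : drift l * (size l)%:R = q * ssum l.
Proof.
rewrite /drift; case: l => [|a l]; first by rewrite /ssum big_nil !mulr0.
by rewrite divfK // pnatr_eq0.
Qed.

Lemma msum_incrE a b h : msum (incr a b) h =
  (a * ssum (unzip1 h) + b * ssum (unzip2 h)) * weight q (size h).-1.
Proof.
elim: h => [|z h IH]; first by rewrite /ssum !big_nil !mulr0 addr0 mul0r.
rewrite [LHS]/= IH /incr /ssum /= !big_cons -/(ssum _) -/(ssum _).
(* On the empty history the drift is 0, an empty sum multiplied by the inverse of 0, so the first
   increment is the first step itself, with weight 1. *)
case: h IH => [|y h] IH.
  by rewrite /drift /ssum !big_nil /= weight0; ring.
rewrite [(size (y :: h)).-1]/= (weightS q1 (size h)) -/(size (y :: h)).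
have := drift_mul (unzip1 (y :: h)); have := drift_mul (unzip2 (y :: h)).
rewrite !size_map; have : (size (y :: h))%:R != 0 :> R by rewrite pnatr_eq0.
move: (size (y :: h))%:R (weight _ _) (drift _) (drift _) (ssum _) (ssum _) => x w d1 d2 u1 u2 x0 e2 e1.
have -> : d1 = q * u1 / x by rewrite -e1 mulfK.
have -> : d2 = q * u2 / x by rewrite -e2 mulfK.
by field.
Qed.

Section Truncation.
Variable eta : R.
Hypotheses (eta0 : 0 < eta).

Definition good (h : seq state) := (`|drift (unzip1 h)| <= eta) && (`|drift (unzip2 h)| <= eta).

Definition resid (h : seq state) := 2 - drift (unzip1 h) ^+ 2 - drift (unzip2 h) ^+ 2.

(* On bad histories the increment is rescaled to have conditional variance exactly 2. *)
Definition tincr (a : R) (h : seq state) (z : state) : R :=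
  if good h then incr a (- a) h z else Num.sqrt (2 / resid h) * incr a (- a) h z.

(** The largest possible rescaling factor: each squared drift is at most q^2, so 2 / resid <= 1 / (1
    - q^2). *)
Let kap : R := Num.sqrt (1 - q ^+ 2)^-1.

Lemma kap_ge1 : 1 <= kap.
Proof.
have := q_sqr_lt1 => h; rewrite /kap -[leLHS]sqrtr1 ler_wsqrtr // -[leLHS]invr1.
by rewrite lef_pV2 ?posrE // ?subr_gt0 // gerBl sqr_ge0.
Qed.

Lemma resid_ge h : 2 * (1 - q ^+ 2) <= resid h.
Proof.
by rewrite /resid; have := drift_sqr_le (unzip1 h); have := drift_sqr_le (unzip2 h); lra.
Qed.

Lemma resid_gt0 h : 0 < resid h.
Proof. by apply: lt_le_trans (resid_ge h); have := q_sqr_lt1; lra. Qed.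

Lemma tincr_bound a h z : `|a| <= 1 -> `|tincr a h z| <= 4 * kap.
Proof.
move=> a1; have a1' : `|- a| <= 1 by rewrite normrN.
have ib := incr_bound h z a1 a1'; have k1 := kap_ge1.
rewrite /tincr; case: (good h).
  by apply: le_trans ib _; rewrite ler_peMr.
rewrite normrM mulrC; apply: ler_pM => //.
rewrite ger0_norm ?sqrtr_ge0 // ler_wsqrtr // ler_pdivrMr ?resid_gt0 //.
have := resid_ge h; have : 0 < 1 - q ^+ 2 by have := q_sqr_lt1; lra.
by move: (1 - q ^+ 2) (resid h) => x y x0 yx; rewrite mulrC ler_pdivlMr.
Qed.

Lemma tincr_mean a h : (0 < size h)%N -> \sum_z k h z * tincr a h z = 0.
Proof.
move=> h0; rewrite /tincr; case: (good h); first exact: incr_mean.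
by under eq_bigr do rewrite mulrCA; rewrite -mulr_sumr incr_mean // mulr0.
Qed.

Lemma incr_var1 a h : a ^+ 2 = 1 -> (0 < size h)%N ->
  \sum_z k h z * incr a (- a) h z ^+ 2 = resid h.
Proof. by move=> a2 h0; rewrite incr_var // sqrrN a2 /resid; ring. Qed.

Lemma tincr_var a h : a ^+ 2 = 1 -> (0 < size h)%N ->
  2 * (1 - eta ^+ 2) <= \sum_z k h z * tincr a h z ^+ 2 <= 2.
Proof.
move=> a2 h0; rewrite /tincr; case E : (good h); first (move: E => /andP[g1 g2]).
  rewrite incr_var1 // /resid.
  have h1 : drift (unzip1 h) ^+ 2 <= eta ^+ 2.
    by rewrite -(real_normK (num_real (drift _))) lerXn2r ?nnegrE // ltW.
  have h2 : drift (unzip2 h) ^+ 2 <= eta ^+ 2.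
    by rewrite -(real_normK (num_real (drift _))) lerXn2r ?nnegrE // ltW.
  have := sqr_ge0 (drift (unzip1 h)); have := sqr_ge0 (drift (unzip2 h)).
  by move=> h3 h4; apply/andP; split; lra.
under eq_bigr do rewrite exprMn mulrCA.
rewrite -mulr_sumr incr_var1 // sqr_sqrtr ?divr_ge0 ?(ltW (resid_gt0 h)) //.
rewrite divfK ?gt_eqF ?resid_gt0 // lexx andbT.
by rewrite ler_piMr // gerBl sqr_ge0.
Qed.

Lemma tincr_laplace_ub a e : a ^+ 2 = 1 -> 0 < e ->
  exists2 mu, 0 < mu & laplace_ub k (tincr a) (1 + e) mu.
Proof.
move=> a2 e0; pose d := Num.min 1 e.
have a1 : `|a| <= 1 by rewrite -(@expr_le1 _ 2) // real_normK ?num_real // a2.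
have d0 : 0 < d by rewrite lt_min ltr01.
have d1 : d <= 1 by rewrite ge_min lexx.
have de : d <= e by rewrite ge_min lexx orbT.
have k1 := kap_ge1.
exists (d / (4 * (4 * kap))); first by rewrite divr_gt0 // !mulr_gt0 //; lra.
move=> h l h0 lm; apply: (@le_trans _ _ (expR (1 * (1 + d) * l ^+ 2))); last first.
  by rewrite ler_expR mul1r ler_wpM2r ?sqr_ge0 // lerD2l.
apply: (@laplace_le _ _ (k h) (tincr a h) (4 * kap)) => //;
  [exact: kS.1|exact: kS.2|exact: tincr_mean| | | |].
- by move=> z; exact: tincr_bound.
- by lra.
- by have /andP[_ h2] := tincr_var a2 h0; rewrite mulr1.
- exact: ltW.
Qed.

(** Half of [d] pays for the variance missing on good histories, at most a fraction eta^2; the other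
    half pays for the Laplace expansion. *)
Lemma tincr_laplace_lb a d : a ^+ 2 = 1 -> 0 < d -> d <= 1 -> eta ^+ 2 <= d / 2 ->
  exists2 mu, 0 < mu & laplace_lb k (tincr a) (1 - d) mu.
Proof.
move=> a2 d0 d1 ed.
have a1 : `|a| <= 1 by rewrite -(@expr_le1 _ 2) // real_normK ?num_real // a2.
have k1 := kap_ge1.
exists (d / 2 / (8 * (4 * kap))); first by rewrite !divr_gt0 // !mulr_gt0 //; lra.
move=> h l h0 lm; apply: (@le_trans _ _ (expR ((1 - eta ^+ 2) * (1 - d / 2) * l ^+ 2))).
  rewrite ler_expR ler_wpM2r ?sqr_ge0 //.
  have := mulr_ge0 (sqr_ge0 eta) (ltW d0); lra.
have e20 := sqr_ge0 eta.
apply: (@laplace_ge _ _ (k h) (tincr a h) (4 * kap)) => //;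
  [exact: kS.1|exact: kS.2|exact: tincr_mean|by move=> z; exact: tincr_bound|lra|lra|lra| |lra|lra].
by have /andP[h2 _] := tincr_var a2 h0.
Qed.

(** After a good history both martingales take the same increment, so their difference freezes once
    all histories are good. The random constant is invisible against a normaliser that tends to
    infinity. *)
Lemma msum_trunc_eventually a (X : nat -> seq state) :
  (forall n, size (X n) = n) -> (forall n, drop 1 (X n.+1) = X n) ->
  (\forall n \near \oo, good (X n)) ->
  exists c : R, \forall n \near \oo, msum (incr a (- a)) (X n) = msum (tincr a) (X n) + c.
Proof.
move=> sX dX [N _ HN].
exists (msum (incr a (- a)) (X N) - msum (tincr a) (X N)); exists N => // n /= /subnKC <-.
elim: (n - N)%N => [|i IH]; first by rewrite addn0; ring.
have := dX (N + i)%N; have := sX (N + i).+1; rewrite addnS.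
case E : (X (N + i).+1) => [//|z h] _; rewrite /= drop0 => hE; subst h.
by rewrite IH /tincr HN /=; [ring|exact: leq_addr].
Qed.

End Truncation.
End ElephantMartingale.

(** * The iterated logarithm for the pair of walks *)

Section IteratedLogarithm.
Variables (R : realType) (p s : R).
Hypotheses (p0 : 0 < p) (p1 : p < 1) (s0 : 0 <= s) (s1 : s <= 1).
Variables (d : measure_display) (T : measurableType d) (P : probability T R).
Variable X : nat -> T -> seq (bool * bool).
Hypothesis XL : chain_law (kpair p s) P X.
Local Notation q := (2 * p - 1).
Local Notation w := (weight q).
Local Notation scale n := (Num.sqrt (clock w n * ln (ln (clock w n)))).

Let q1 : -1 < q. Proof. by have := p0; lra. Qed.
Let q2 : q < 1. Proof. by have := p1; lra. Qed.
Let kS : stochastic (kpair p s).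
Proof. by apply: stochastic_kpair; rewrite ?s0 ?s1 // (ltW p0) (ltW p1). Qed.
Let w0 j : 0 <= w j. Proof. exact/ltW/weight_gt0. Qed.

Hypothesis clock_pinfty : clock w n @[n --> \oo] --> +oo.

Let w_infty A : exists n, A < clock w n.
Proof.
have [N _ HN] := clock_pinfty (nbhs_pinfty_gt (num_real A)).
by exists N; apply: (HN N); rewrite /=.
Qed.

Lemma scale_pinfty_ge A : \forall n \near \oo, A <= scale n.
Proof.
have h1 := clock_pinfty (nbhs_pinfty_ge (num_real (Num.max A 1))).
have h2 := cvg_ln_pinfty (cvg_ln_pinfty clock_pinfty) (nbhs_pinfty_ge (num_real (Num.max A 1))).
near=> n.
have : Num.max A 1 <= clock w n by near: n; exact: h1.
have : Num.max A 1 <= ln (ln (clock w n)) by near: n; exact: h2.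
rewrite !ge_max => /andP[a1 b1] /andP[a2 b2].
have [A0|/ltW A0] := leP 0 A; last by apply: le_trans A0 (sqrtr_ge0 _).
by rewrite -[A]ger0_norm // -sqrtr_sqr ler_wsqrtr // expr2 ler_pM.
Unshelve. all: by end_near. Qed.

Definition comb (a b : R) (h : seq (bool * bool)) := a * ssum R (unzip1 h) + b * ssum R (unzip2 h).

Lemma msum_incr_growth a b n t :
  msum p (incr p a b) (X n t) * growth q n.-1 = comb a b (X n t).
Proof.
have [sX _ _] := XL.
by rewrite msum_incrE // sX /weight divfK // gt_eqF // growth_gt0.
Qed.

Local Notation target n := (scale n * growth q n.-1).

Lemma comb_upper a b eps : `|a| <= 1 -> `|b| <= 1 -> 0 < eps ->
  {ae P, forall t, \forall n \near \oo, comb a b (X n t) <= (2 + eps) * target n}.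
Proof.
move=> a1 b1 eps0.
have M1 z : msum p (incr p a b) [:: z] <= 4.
  by rewrite /= add0r weight0 mul1r; apply: le_trans (ler_norm _) _; exact: incr_bound.
have := lil_upper kS XL w0 (weight0 _) (msum_increments p (incr p a b)) M1
  (fun e e0 => incr_laplace_ub p0 p1 s0 s1 a1 b1 e0) w_infty (weight6_le q1 q2) eps0.
apply: filterS => t; apply: filterS => n h.
by rewrite -msum_incr_growth mulrA ler_wpM2r // ltW // growth_gt0.
Qed.

Variables (phi : nat -> R) (rho : R).
Hypotheses (rho0 : 0 < rho) (phi0 : \forall n \near \oo, 0 < phi n)
  (target_phi : target n / phi n @[n --> \oo] --> rho)
  (phi_small : forall e, 0 < e -> \forall n \near \oo, phi n <= e * n%:R).

Lemma target_small e : 0 < e -> \forall n \near \oo, target n <= e * n%:R.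
Proof.
move=> e0; have r1 : 0 < rho + 1 by have := rho0; lra.
have h1 : \forall n \near \oo, target n / phi n < rho + 1.
  by apply: (cvgr_lt _ target_phi); rewrite ltrDl.
have h2 := phi_small (divr_gt0 e0 r1).
near=> n.
have f0 : 0 < phi n by near: n.
have : target n / phi n < rho + 1 by near: n.
rewrite ltr_pdivrMr // => /ltW/le_trans; apply.
rewrite mulrC -ler_pdivlMr // mulrAC; near: n; exact: h2.
Unshelve. all: by end_near. Qed.

Lemma good_eventually eta : 0 < eta ->
  {ae P, forall t, \forall n \near \oo, good p eta (X n t)}.
Proof.
move=> eta0.
have n1 : `|1 : R| <= 1 by rewrite normr1.
have nN : `|-1 : R| <= 1 by rewrite normrN1.
have nz : `|0 : R| <= 1 by rewrite normr0.
(* The four one-sided bounds below are used with eps = 1, hence are 3 times the target; this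
   explains eta / 3. *)
have hS := target_small (divr_gt0 eta0 (ltr0n R 3)).
have [sX _ _] := XL.
have H1 := comb_upper n1 nz ltr01; have H2 := comb_upper nN nz ltr01.
have H3 := comb_upper nz n1 ltr01; have H4 := comb_upper nz nN ltr01.
have dr l n : (0 < n)%N -> size l = n -> ssum R l <= eta * n%:R -> - ssum R l <= eta * n%:R ->
    `|drift p l| <= eta.
  move=> n0 ln u1 u2; rewrite /drift normrM normrM normfV ln (@ger0_norm _ n%:R) //.
  rewrite ler_pdivrMr ?ltr0n //; apply: le_trans (_ : 1 * (eta * n%:R) <= _); last by rewrite mul1r.
  apply: ler_pM => //; first by rewrite ler_norml; apply/andP; split; have := q1; have := q2; lra.
  by rewrite ler_norml; apply/andP; split; lra.
apply: filterS (filterI (filterI H1 H2) (filterI H3 H4)) => t [[h1 h2] [h3 h4]].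
near=> n.
have n0 : (0 < n)%N by near: n; exists 1%N.
have tn : (2 + 1) * target n <= eta * n%:R.
  have : target n <= eta / 3 * n%:R by near: n.
  by move: (target n) (n%:R) => x y; lra.
have : comb 1 0 (X n t) <= (2 + 1) * target n by near: n.
have : comb (-1) 0 (X n t) <= (2 + 1) * target n by near: n.
have : comb 0 1 (X n t) <= (2 + 1) * target n by near: n.
have : comb 0 (-1) (X n t) <= (2 + 1) * target n by near: n.
rewrite /comb !mul0r !addr0 !add0r !mul1r !mulN1r => g4 g3 g2 g1.
by apply/andP; split; apply: (dr _ n); rewrite ?size_map ?sX //; apply: le_trans tn.
Unshelve. all: by end_near. Qed.

Lemma comb_lower a e : a ^+ 2 = 1 -> 0 < e -> e <= 8^-1 ->
  {ae P, forall t, forall n0, exists2 n, (n0 <= n)%N &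
    (2 - 17 * e) * target n <= comb a (- a) (X n t)}.
Proof.
move=> a2 e0 e8; have [sX dX _] := XL.
(* This makes eta^2 = e^2 / 16, half of the defect e^2 / 8 that [lil_lower] allows in the lower
   Laplace bound. *)
pose eta := e / 4; have eta0 : 0 < eta by rewrite divr_gt0.
have a1 : `|a| <= 1 by rewrite -(@expr_le1 _ 2) // real_normK ?num_real // a2.
have d0 : 0 < e ^+ 2 / 8 by rewrite divr_gt0 // exprn_gt0.
have d1 : e ^+ 2 / 8 <= 1 by nra.
have eta2 : eta ^+ 2 <= e ^+ 2 / 8 / 2 by rewrite /eta; lra.
have [mu mu0 lb] := tincr_laplace_lb p0 p1 s0 s1 eta0 a2 d0 d1 eta2.
have M1 z : `|msum p (tincr p eta a) [:: z]| <= 4 * Num.sqrt (1 - q ^+ 2)^-1.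
  by rewrite /= add0r weight0 mul1r; exact: tincr_bound.
have L := lil_lower kS XL w0 (weight0 _) (msum_increments p (tincr p eta a)) M1
  (fun e e0 => tincr_laplace_ub p0 p1 s0 s1 eta0 a2 e0) w_infty (weight6_le q1 q2) e0 e8 lb mu0.
apply: filterS2 (good_eventually eta0) L => t gt Lt n0.
have [c hc] := msum_trunc_eventually a (sX^~ t) (dX^~ t) gt.
have [N _ HN] := filterI hc (scale_pinfty_ge (- c / e)).
have [n nn hn] := Lt (maxn n0 N).
move: nn; rewrite geq_max => /andP[n0n Nn]; exists n => //.
have [h1 h2] := HN n Nn.
rewrite -msum_incr_growth mulrA ler_wpM2r //; first by rewrite ltW // growth_gt0.
by move: h2; rewrite h1 ler_pdivrMr //; lra.
Qed.

Theorem iterated_logarithm : {ae P, forall t,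
  limn_esup (fun n => ((ssum R (unzip1 (X n t)) - ssum R (unzip2 (X n t))) / phi n)%:E) = (2 * rho)%:E /\
  limn_esup (fun n => (- (ssum R (unzip1 (X n t)) - ssum R (unzip2 (X n t))) / phi n)%:E) = (2 * rho)%:E}.
Proof.
have n1 : `|1 : R| <= 1 by rewrite normr1.
have nN : `|-1 : R| <= 1 by rewrite normrN1.
(* Countably many precisions are used, so that the almost sure events can be intersected; the shift
   by 8 keeps the second family below the bound 1/8 of [comb_lower]. *)
have i0 i : 0 < (i.+1%:R^-1 : R) by rewrite invr_gt0 ltr0n.
have j0 i : 0 < ((i + 8)%:R^-1 : R) by rewrite invr_gt0 ltr0n addnS.
have j8 i : ((i + 8)%:R^-1 : R) <= 8^-1 by rewrite lef_pV2 ?posrE ?ltr0n ?ler_nat ?leq_addl // addnS.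
have U1 := ae_foralln (fun i => comb_upper n1 nN (i0 i)).
have U2 := ae_foralln (fun i => comb_upper nN n1 (i0 i)).
have L1 := ae_foralln (fun i => comb_lower (expr1n _ 2) (j0 i) (j8 i)).
have L2 := ae_foralln (fun i => comb_lower (etrans (sqrrN 1) (expr1n _ 2)) (j0 i) (j8 i)).
have tg0 n : 0 <= target n by rewrite mulr_ge0 ?sqrtr_ge0 // ltW // growth_gt0.
have tr (D : nat -> R) :
    (forall i, \forall n \near \oo, D n <= (2 + i.+1%:R^-1) * target n) ->
    (forall i n0, exists2 n, (n0 <= n)%N & (2 - 17 * (i + 8)%:R^-1) * target n <= D n) ->
    limn_esup (fun n => (D n / phi n)%:E) = (2 * rho)%:E.
  move=> u l; apply: (limn_esup_transfer rho0 _ _ phi0 target_phi) => e e0.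
    have [i ie] := natr_ge_ex (e^-1).
    apply: filterS (u i) => n /le_trans; apply; rewrite ler_wpM2r // lerD2l.
    rewrite -[leRHS]invrK lef_pV2 ?posrE ?invr_gt0 ?ltr0n //.
    exact: ie.
  move=> n0; have [i ie] := natr_ge_ex (17 / e).
  have [n nn hn] := l i n0; exists n => //; apply: le_trans hn.
  have := ie _ (leq_addr 8 i); have := j0 i; rewrite invr_gt0 => i8.
  by rewrite ler_pdivrMr // mulrC => i17; rewrite ler_wpM2r // lerD2l lerN2 ler_pdivrMr.
apply: filterS (filterI (filterI U1 U2) (filterI L1 L2)) => t [[u1 u2] [l1 l2]].
split; apply: tr => i.
- by move: (u1 i); apply: filterS => n; rewrite /comb mul1r mulN1r.
- by move=> n0; have [n nn b] := l1 i n0; exists n => //; move: b; rewrite /comb mul1r mulN1r.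
- by move: (u2 i); apply: filterS => n; rewrite /comb mul1r mulN1r opprB addrC.
- move=> n0; have [n nn b] := l2 i n0; exists n => //.
  by move: b; rewrite /comb mulN1r opprK mul1r opprB (addrC (- _)).
Qed.

End IteratedLogarithm.

(** * Size of the stated normalisations *)

Lemma ln_sqr_small (R : realType) (e : R) : 0 < e ->
  \forall n \near \oo, ln (n%:R : R) ^+ 2 <= e * n%:R.
Proof.
move=> e0; have h := @ln_natr_pinfty R _ (nbhs_pinfty_ge (num_real (Num.max 1 (6 / e)))).
near=> n.
have : Num.max 1 (6 / e) <= ln (n%:R : R) by near: n; exact: h.
rewrite ge_max ler_pdivrMr // => /andP[l1 le].
have n0 : (0 : R) < n%:R by rewrite ltr0n; near: n; exists 1%N.
have := @expR_ge1Dxn R (ln n%:R) 2 (le_trans ler01 l1).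
rewrite lnK ?posrE // => h3.
have : 0 <= ln (n%:R : R) ^+ 2 by exact: sqr_ge0.
move: h3 l1 le; rewrite -[(3`!)%N]/6%N; move: (n%:R : R) (ln n%:R) => N x h3 l1 le x2.
have : 6 * x ^+ 2 <= e * x ^+ 3 by rewrite [x ^+ 3]exprSr; nra.
have : e * (1 + x ^+ 3 / 6) <= e * N by rewrite ler_pM2l.
lra.
Unshelve. all: by end_near. Qed.

Lemma lnln_pinfty (R : realType) : ln (ln (n%:R : R)) @[n --> \oo] --> +oo.
Proof. exact/cvg_ln_pinfty/ln_natr_pinfty. Qed.

Lemma lnlnln_pinfty (R : realType) : ln (ln (ln (n%:R : R))) @[n --> \oo] --> +oo.
Proof. exact/cvg_ln_pinfty/lnln_pinfty. Qed.

Lemma sqrt_gauge_small (R : realType) (g : nat -> R) :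
  (\forall n \near \oo, g n <= n%:R * ln n%:R ^+ 2) ->
  forall e, 0 < e -> \forall n \near \oo, Num.sqrt (g n) <= e * n%:R.
Proof.
move=> h e e0; apply: filterS2 h (ln_sqr_small (exprn_gt0 2 e0)) => n h1 h2.
rewrite -[leRHS]ger0_norm ?mulr_ge0 ?ler0n // ?(ltW e0) // -sqrtr_sqr ler_wsqrtr //.
apply: le_trans h1 _; rewrite exprMn mulrC [n%:R ^+ 2]expr2 mulrA ler_wpM2r //.
Qed.

Section Gauges.
Variable R : realType.

Lemma lil_gauge_gt0 : \forall n \near \oo, 0 < Num.sqrt (n%:R * ln (ln (n%:R : R))).
Proof.
have h := @lnln_pinfty R _ (nbhs_pinfty_gt (num_real 0)).
near=> n; rewrite sqrtr_gt0 mulr_gt0 //; last by near: n; exact: h.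
by rewrite ltr0n; near: n; exists 1%N.
Unshelve. all: by end_near. Qed.

Lemma lil_gauge_small (e : R) : 0 < e ->
  \forall n \near \oo, Num.sqrt (n%:R * ln (ln (n%:R : R))) <= e * n%:R.
Proof.
apply: sqrt_gauge_small; have h := @ln_natr_pinfty R _ (nbhs_pinfty_ge (num_real 1)).
near=> n; have l1 : 1 <= ln (n%:R : R) by near: n; exact: h.
rewrite ler_wpM2l //; apply: (@le_trans _ _ (ln n%:R)).
  by apply/ltW/ln_sublinear; apply: lt_le_trans l1.
by rewrite expr2 ler_peMr // (le_trans _ l1).
Unshelve. all: by end_near. Qed.

Lemma critical_gauge_gt0 :
  \forall n \near \oo, 0 < Num.sqrt (n%:R * ln (n%:R : R) * ln (ln (ln n%:R))).
Proof.
have h := @lnlnln_pinfty R _ (nbhs_pinfty_gt (num_real 0)).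
have h' := @ln_natr_pinfty R _ (nbhs_pinfty_gt (num_real 0)).
near=> n; rewrite sqrtr_gt0 mulr_gt0 ?mulr_gt0 //; last by near: n; exact: h.
  by rewrite ltr0n; near: n; exists 1%N.
by near: n; exact: h'.
Unshelve. all: by end_near. Qed.

Lemma critical_gauge_small (e : R) : 0 < e ->
  \forall n \near \oo, Num.sqrt (n%:R * ln (n%:R : R) * ln (ln (ln n%:R))) <= e * n%:R.
Proof.
apply: sqrt_gauge_small; have h := @lnln_pinfty R _ (nbhs_pinfty_ge (num_real 1)).
have h' := @ln_natr_pinfty R _ (nbhs_pinfty_ge (num_real 1)).
near=> n; have l1 : 1 <= ln (n%:R : R) by near: n; exact: h'.
have l2 : 1 <= ln (ln (n%:R : R)) by near: n; exact: h.
have l0 := lt_le_trans ltr01 l1.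
rewrite expr2 mulrA ler_wpM2l ?mulr_ge0 ?(ltW l0) //.
apply: le_trans (ltW (ln_sublinear l0)).
by apply/ltW/ln_sublinear; apply: lt_le_trans l2.
Unshelve. all: by end_near. Qed.

End Gauges.

(** * The superdiffusive regime *)

Section SuperdiffusiveLimit.
Variables (R : realType) (p s : R).
Hypotheses (p34 : 3 / 4 < p) (p1 : p < 1) (s0 : 0 <= s) (s1 : s <= 1).
Variables (d : measure_display) (T : measurableType d) (P : probability T R).
Variable X : nat -> T -> seq (bool * bool).
Hypothesis XL : chain_law (kpair p s) P X.
Local Notation q := (2 * p - 1).
Local Notation w := (weight q).

Let p0 : 0 < p. Proof. by have := p34; lra. Qed.
Let q1 : -1 < q. Proof. by have := p0; lra. Qed.
Let q2 : q < 1. Proof. by have := p1; lra. Qed.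
Let qh : 2^-1 < q. Proof. by have := p34; lra. Qed.
Let kS : stochastic (kpair p s).
Proof. by apply: stochastic_kpair; rewrite ?s0 ?s1 // (ltW p0) (ltW p1). Qed.

(** Some positive constant is enough here, so the true increments serve: after every nonempty
    history their conditional variance is at least 2 (1 - q^2), and half of it is given up to the
    Laplace expansion. *)
Lemma incr_laplace_lb a : a ^+ 2 = 1 ->
  exists2 mu, 0 < mu & laplace_lb (kpair p s) (incr p a (- a)) ((1 - q ^+ 2) / 2) mu.
Proof.
move=> a2; have q21 := q_sqr_lt1 p0 p1; have q20 := sqr_ge0 q.
have a1 : `|a| <= 1 by rewrite -(@expr_le1 _ 2) // real_normK ?num_real // a2.
exists (2^-1 / (8 * 4)); first by rewrite divr_gt0.
move=> h l h0 lm.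
have -> : (1 - q ^+ 2) / 2 = (1 - q ^+ 2) * (1 - 2^-1) by field.
apply: (@laplace_ge _ _ (kpair p s h) (incr p a (- a) h) 4) => //;
  [exact: kS.1|exact: kS.2|exact: incr_mean| |lra|lra|lra| |lra].
  by move=> z; apply: incr_bound; rewrite ?normrN.
by rewrite incr_var1 //; exact: resid_ge.
Qed.

Let M h := msum p (incr p 1 (- 1)) h.

Lemma incr_chain_cvg : {ae P, forall t, cvgn (fun n => M (X n t)) /\ ~ (M (X n t) @[n --> \oo] --> 0)}.
Proof.
have n1 : `|1 : R| <= 1 by rewrite normr1.
have nN : `|-1 : R| <= 1 by rewrite normrN1.
have [mu mu0 ub] := incr_laplace_ub p0 p1 s0 s1 n1 nN ltr01.
have [mu' mu'0 lb] := incr_laplace_lb (expr1n _ 2).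
pose m := Num.min mu mu'.
have m0 : 0 < m by rewrite lt_min mu0.
have ub' : laplace_ub (kpair p s) (incr p 1 (- 1)) (1 + 1) m.
  by move=> h l h0 lm; apply: ub => //; apply: le_trans lm _; rewrite ge_min lexx.
have lb' : laplace_lb (kpair p s) (incr p 1 (- 1)) ((1 - q ^+ 2) / 2) m.
  by move=> h l h0 lm; apply: lb => //; apply: le_trans lm _; rewrite ge_min lexx orbT.
have c0 : 0 < (1 - q ^+ 2) / 2 by have := q_sqr_lt1 p0 p1; lra.
have c'0 : (0 : R) < 1 + 1 by lra.
have MS := msum_increments p (incr p 1 (- 1)).
apply: filterS2 (chain_cvg kS XL (weight_gt0 q1) MS c'0 m0 ub' (clock_bounded q1 qh))
  (chain_limit_neq0 kS XL (weight_gt0 q1) MS c0 c'0 m0 ub' lb' (clock_bounded q1 qh)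
    (weight_spread q1 q2 qh)) => t.
by split.
Qed.

Lemma chain_measurable_fun n (F : seq (bool * bool) -> R) :
  measurable_fun setT (fun t => F (X n t)).
Proof.
move=> _ B _; rewrite setTI.
have := chain_measurable XL n (fun h => `[< B (F h) >]).
rewrite (_ : [set t | _] = (fun t => F (X n t)) @^-1` B) //.
by apply/seteqP; split => t /= /asboolP.
Qed.

Theorem superdiffusive_limit : exists N : T -> R, [/\ measurable_fun setT N,
  P [set t | N t != 0] = 1%E &
  {ae P, forall t, (ssum R (unzip1 (X n t)) - ssum R (unzip2 (X n t))) / (n%:R `^ q)
    @[n --> \oo] --> N t}].
Proof.
have [c c0 cg] := growth_power_cvg q1 q2 qh.
(* The upper limit is measurable whether or not the sequence converges, and almost surely it is the
   limit; the value 0 that [fine] gives to an infinite upper limit matters only on a null set. The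
   factor [c] restores a_n / n^q. *)
pose L t := limn_esup (fun n => (M (X n t))%:E); pose N t := c * fine (L t).
have mN : measurable_fun setT N.
  apply: measurable_funM => //; apply: measurableT_comp => //.
  apply: measurable_fun_limn_esup => n; apply/measurable_EFinP; exact: chain_measurable_fun.
have lim : {ae P, forall t, M (X n t) @[n --> \oo] --> fine (L t) /\ fine (L t) != 0}.
  move: incr_chain_cvg; apply: filterS => t [cv n0].
  have E : L t = (limn (fun n => M (X n t)))%:E.
    have cE : (fun n => (M (X n t))%:E) @ \oo --> (limn (fun n => M (X n t)))%:E.
      by apply: cvg_EFin => //; exact: nearW.
    by rewrite /L (cvg_limn_einf_sup cE).2.
  rewrite E /=; split => //; apply/eqP => l0; apply: n0; rewrite -[X in _ --> X]l0; exact: cv.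
exists N; split => //.
  have mA : measurable [set t | N t != 0].
    rewrite (_ : [set t | _] = N @^-1` [set~ 0]); last first.
      by apply/seteqP; split => t /= /eqP.
    by rewrite -[_ @^-1` _]setTI; apply: mN => //; apply: measurableC.
  have [B [mB PB BN]] := lim.
  apply/eqP; rewrite eq_le probability_le1 //=.
  have <- : P (~` B) = 1%E by rewrite probability_setC // PB sube0.
  apply: le_measure; rewrite ?inE //; first exact: measurableC.
  move=> t /= tB; apply: contrapT => /negP; rewrite negbK => /eqP Nt; apply/tB/BN => -[_].
  by move/eqP; apply; move/eqP: Nt; rewrite mulf_eq0 gt_eqF //= => /eqP.
move: lim; apply: filterS => t [cv _].
have [sX _ _] := XL.
rewrite /N [c * _]mulrC (_ : (fun n => _) = fun n => M (X n t) * (growth q n.-1 / (n%:R `^ q))).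
  by apply: cvgM => //; exact: cg.
by apply/funext => n; rewrite mulrA (msum_incr_growth p0 XL) /comb mul1r mulN1r.
Qed.

End SuperdiffusiveLimit.

Theorem theorem2 (R : realType) (d : measure_display) (T : measurableType d)
    (P : probability T R) (p s : R) (Y : erw_index -> T -> nat) :
  0 < p < 1 -> 0 <= s <= 1 -> erw_pair_family P p s Y ->
  let D := fun (n : nat) (t : T) => erw_S Y true n t - erw_S Y false n t in
  [/\ (p < 3 / 4 ->
        {ae P, forall t,
          limn_esup (fun n => (D n t / Num.sqrt (n%:R * ln (ln n%:R)))%:E)
            = (2 / Num.sqrt (3 - 4 * p))%:E /\
          limn_esup (fun n => (- D n t / Num.sqrt (n%:R * ln (ln n%:R)))%:E)
            = (2 / Num.sqrt (3 - 4 * p))%:E}),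
      (p = 3 / 4 ->
        {ae P, forall t,
          limn_esup (fun n =>
              (D n t / Num.sqrt (n%:R * ln n%:R * ln (ln (ln n%:R))))%:E)
            = 2%:E /\
          limn_esup (fun n =>
              (- D n t / Num.sqrt (n%:R * ln n%:R * ln (ln (ln n%:R))))%:E)
            = 2%:E}) &
      (3 / 4 < p ->
        exists M : T -> R, measurable_fun setT M /\
          P [set t | M t != 0] = 1%E /\
          {ae P, forall t,
            (fun n => D n t / (n%:R `^ (2 * p - 1))) @ \oo --> M t})].

Proof.
move=> /andP[p0 p1] /andP[s0 s1] YP D.
have XL : chain_law (kpair p s) P (fun n t => hist (Y^~ t) n).
  split=> [n t|n t|n A]; [exact: size_hist|by rewrite histS /= drop0|exact: hist_law].
have DE : {ae P, forall t, forall n, D n t =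
    ssum R (unzip1 (hist (Y^~ t) n)) - ssum R (unzip2 (hist (Y^~ t) n))}.
  move: (erw_S_signs YP); apply: filterS => t h n.
  by rewrite /D !h unzip1_hist unzip2_hist.
have q1 : -1 < 2 * p - 1 by lra.
have q2 : 2 * p - 1 < 1 by lra.
split=> p34.
- have qh : 2 * p - 1 < 2^-1 by lra.
  have rho0 : 0 < (Num.sqrt (1 - 2 * (2 * p - 1)))^-1 by rewrite invr_gt0 sqrtr_gt0; lra.
  have := iterated_logarithm p0 p1 s0 s1 XL (clock_pinfty_lt q1 q2 qh) rho0 (lil_gauge_gt0 R)
    (normalizer_lt_half q1 q2 qh) (@lil_gauge_small R).
  have -> : 1 - 2 * (2 * p - 1) = 3 - 4 * p by ring.
  move: DE; apply: filterS2 => t Dt [h1 h2].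
  by split; [rewrite -h1|rewrite -h2]; congr limn_esup; apply/funext => n; rewrite Dt.
- have qh : 2 * p - 1 = 2^-1 by lra.
  have := iterated_logarithm p0 p1 s0 s1 XL (clock_pinfty_half q1 qh) ltr01 (critical_gauge_gt0 R)
    (normalizer_half q1 qh) (@critical_gauge_small R).
  rewrite mulr1; move: DE; apply: filterS2 => t Dt [h1 h2].
  by split; [rewrite -h1|rewrite -h2]; congr limn_esup; apply/funext => n; rewrite Dt.
- have [M [mM PM cM]] := superdiffusive_limit p34 p1 s0 s1 XL.
  exists M; split=> //; split=> //.
  move: DE cM; apply: filterS2 => t Dt.
  by rewrite (_ : (fun n => D n t / _) = fun n =>
    (ssum R (unzip1 (hist (Y^~ t) n)) - ssum R (unzip2 (hist (Y^~ t) n))) / n%:R `^ (2 * p - 1)) //;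
    apply/funext => n; rewrite Dt.
Qed.
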